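(* For Schulze elections, the bribery problem is fixed-parameter tractable (in FPT) with respect to the parameter ''number of candidates''. This holds in both the succinct and the nonsuccinct input models, for both constructive and destructive bribery, and in both the nonunique-winner model and the unique-winner model.
   Context: An election consists of a finite candidate set $C$ and a collection $V$ of voters, each casting a tie-free linear order over $C$. The weighted majority graph (WMG) has, for each ordered pair of distinct candidates $(c,d)$, an edge of weight $D(c,d)$ equal to the number of voters preferring $c$ to $d$ minus the number preferring $d$ to $c$. The strength of a directed path in the WMG is the minimum weight of its edges. In Schulze voting, a candidate $c$ is a winner iff for every other candidate $d$ there is a simple path from $c$ to $d$ whose strength is at least that of every simple path from $d$ to $c$. Bribery problem: given $C$, $V$, a distinguished candidate $p\in C$, and a nonnegative integer $k$, is it possible to change the votes of at most $k$ voters so that $p$ is a winner (constructive) / is not a winner (destructive)? In the unique-winner model ''a winner'' is replaced by ''the unique winner''. Nonsuccinct input: each vote is listed separately; succinct input: each distinct vote that occurs is listed once together with its multiplicity in binary. A problem is in FPT with respect to a parameter if it can be solved in time $f(j)\cdot I^{O(1)}$, where $j$ is the parameter value, $f$ is a computable function, and $I$ is the input size. *)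

(* Defs.v *)
From mathcomp Require Import all_boot all_order all_algebra.
Set Implicit Arguments. Unset Strict Implicit. Unset Printing Implicit Defensive.
Import Order.TTheory GRing.Theory Num.Theory.

(* 1. Machine model: deterministic Turing machines with one two-way         *)
(*    infinite tape over the alphabet {0,1} plus blank (None).              *)
(*    States are 0 .. tm_states-1; 0 = start, 1 = accept, 2 = reject;      *)
(*    states 1 and 2 are halting.                                           *)

Inductive move := MoveL | MoveR | MoveS.

Definition sym := option bool.

Record TM := { tm_states : nat;
               tm_delta : nat -> sym -> nat * sym * move }.

Definition TM_wf (M : TM) : Prop :=
  3 <= tm_states M /\
  forall q s, q < tm_states M -> (tm_delta M q s).1.1 < tm_states M.

(* configuration: state, reversed left part, head symbol, right part *)
Definition config := (nat * (seq sym * sym * seq sym))%type.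

Definition halting (q : nat) : bool := (q == 1) || (q == 2).

Definition tm_step (M : TM) (cf : config) : config :=
  let: (q, (l, h, r)) := cf in
  if halting q then cf else
  let: (q', w, mv) := tm_delta M q h in
  match mv with
  | MoveS => (q', (l, w, r))
  | MoveL => match l with
             | [::] => (q', ([::], None, w :: r))
             | a :: l' => (q', (l', a, w :: r))
             end
  | MoveR => match r with
             | [::] => (q', (w :: l, None, [::]))
             | a :: r' => (q', (w :: l, a, r'))
             end
  end.

Definition tm_run (M : TM) (t : nat) (cf : config) : config := iter t (tm_step M) cf.

Definition tm_init (x : seq bool) : config :=
  (0, ([::], head None (map Some x), behead (map Some x))).

Definition decides_within (M : TM) (x : seq bool) (T : nat) (b : Prop) : Prop :=
  exists t, t <= T /\
    let q := (tm_run M t (tm_init x)).1 in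
    halting q /\ (q = 1 <-> b).

Definition tm_output (cf : config) : seq bool :=
  let: (_, (_, h, r)) := cf in
  let s := h :: r in map (odflt false) (take (find (pred1 None) s) s).

Definition computable (f : nat -> nat) : Prop :=
  exists M : TM, TM_wf M /\
    forall j, exists t, (tm_run M t (tm_init (nseq j true))).1 = 1 /\
                        tm_output (tm_run M t (tm_init (nseq j true))) = nseq (f j) true.

Definition FPT (I : Type) (valid : I -> Prop) (enc : I -> seq bool)
           (param : I -> nat) (yes : I -> Prop) : Prop :=
  exists (M : TM) (f : nat -> nat) (c : nat),
    TM_wf M /\ computable f /\
    forall x, valid x ->
      decides_within M (enc x) (f (param x) * (size (enc x)).+1 ^ c) (yes x).

(*    Candidates are 0 .. m-1.  A vote is a sequence listing all candidates *)
(*    exactly once, most preferred first.                                   *)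

Definition is_vote (m : nat) (v : seq nat) : bool := perm_eq v (iota 0 m).

Definition prefers (v : seq nat) (c d : nat) : bool := index c v < index d v.

Definition D (V : seq (seq nat)) (c d : nat) : int :=
  ((count (fun v => prefers v c d) V)%:Z - (count (fun v => prefers v d c) V)%:Z)%R.

Definition minz (a b : int) : int := if (a <= b)%R then a else b.

(* strength of the path c :: s (minimum edge weight); s is nonempty *)
Fixpoint strength (V : seq (seq nat)) (c : nat) (s : seq nat) : int :=
  match s with
  | [::] => 0%R
  | [:: d] => D V c d
  | d :: (_ :: _) as s' => minz (D V c d) (strength V d s')
  end.

Definition simple_path (m : nat) (c d : nat) (s : seq nat) : bool :=
  [&& s != [::], last c s == d, uniq (c :: s) & all (fun x => x < m) (c :: s)].

Definition schulze_winner (m : nat) (V : seq (seq nat)) (c : nat) : Prop :=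
  c < m /\
  forall d, d < m -> d != c ->
    exists s, simple_path m c d s /\
      forall t, simple_path m d c t -> (strength V d t <= strength V c s)%R.

Definition schulze_unique_winner (m : nat) (V : seq (seq nat)) (c : nat) : Prop :=
  schulze_winner m V c /\ forall d, d < m -> d != c -> ~ schulze_winner m V d.

Definition nchanged (V V' : seq (seq nat)) : nat :=
  count (fun vv => vv.1 != vv.2) (zip V V').

Definition bribery_yes (constructive unique : bool)
           (m : nat) (V : seq (seq nat)) (p k : nat) : Prop :=
  exists V' : seq (seq nat),
    [/\ size V' = size V, all (is_vote m) V', nchanged V V' <= k &
      let W := if unique then schulze_unique_winner m V' p
               else schulze_winner m V' p in
      if constructive then W else ~ W].

Fixpoint bits_aux (fuel n : nat) : seq bool :=
  match fuel with
  | 0 => [::]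
  | fuel'.+1 => if n is 0 then [::] else odd n :: bits_aux fuel' n./2
  end.
Definition bits (n : nat) : seq bool := bits_aux n n.

(* prefix-free list encoding: each item preceded by 1, list ended by 0 *)
Definition enc_list (T : Type) (f : T -> seq bool) (xs : seq T) : seq bool :=
  flatten [seq true :: f x | x <- xs] ++ [:: false].

Definition enc_nat (n : nat) : seq bool := enc_list (fun b => [:: b]) (bits n).

Definition enc_vote (v : seq nat) : seq bool := enc_list enc_nat v.

Record ns_instance := NSInst { ns_m : nat; ns_votes : seq (seq nat);
                               ns_p : nat; ns_k : nat }.

Definition ns_valid (x : ns_instance) : Prop :=
  ns_p x < ns_m x /\ all (is_vote (ns_m x)) (ns_votes x).

Definition ns_enc (x : ns_instance) : seq bool :=
  enc_nat (ns_m x) ++ enc_list enc_vote (ns_votes x) ++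
  enc_nat (ns_p x) ++ enc_nat (ns_k x).

(* succinct instance: m, list of (distinct vote, multiplicity >= 1), p, k;
   multiplicities (and all numbers) are written in binary *)
Record s_instance := SInst { s_m : nat; s_votes : seq (seq nat * nat);
                             s_p : nat; s_k : nat }.

Definition s_valid (x : s_instance) : Prop :=
  [/\ s_p x < s_m x, all (fun vn => is_vote (s_m x) vn.1 && (0 < vn.2)) (s_votes x)
    & uniq (map fst (s_votes x))].

Definition s_expand (S : seq (seq nat * nat)) : seq (seq nat) :=
  flatten [seq nseq vn.2 vn.1 | vn <- S].

Definition s_enc (x : s_instance) : seq bool :=
  enc_nat (s_m x) ++
  enc_list (fun vn : seq nat * nat => enc_vote vn.1 ++ enc_nat vn.2) (s_votes x) ++
  enc_nat (s_p x) ++ enc_nat (s_k x).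

Definition schulze_bribery_FPT (succinct constructive unique : bool) : Prop :=
  if succinct then
    FPT s_valid s_enc s_m
        (fun x => bribery_yes constructive unique (s_m x) (s_expand (s_votes x)) (s_p x) (s_k x))
  else
    FPT ns_valid ns_enc ns_m
        (fun x => bribery_yes constructive unique (ns_m x) (ns_votes x) (ns_p x) (ns_k x)).

(* Main.v *)
(* The number of candidates bounds the number m! of possible votes. With n_v voters
   casting the vote v, the preference profile after bribery is determined by its vote
   counts y_v, and the bribery is possible iff there are y_v and a_v with
   n_v <= y_v + a_v, Sum a_v <= k and Sum y_v = Sum n_v such that the counts y_v
   produce the desired outcome. Whether p wins depends only
   on the comparisons between the weights D(c, d), which are the signs of linear
   forms in y. Hence all requirements are signs of linear forms with small
   coefficients in (n, y, a, k), and only n and k are large. Reading n and k in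
   binary from the least significant bit, and guessing the bits of y and a, one only
   has to remember the carry of every form, and the sign of a form is the sign of its
   last carry. The carries are bounded in terms of the coefficients, so the
   set of reachable carry vectors is a state whose size is bounded by a function of
   the number of candidates, and one pass over the input per bit suffices.

   For the machine, this algorithm is written with primitive recursive functions on
   binary trees. Such a function comes with a cost; on arguments of size bounded by the
   parameter the cost is bounded by a monotone function which is itself primitive
   recursive, hence computable, and no further analysis is needed. Only parsing and the
   two nested folds over the input need a polynomial bound. The tree programs are
   compiled to stack programs, and the stacks are interleaved on the tape. *)

Require Import Defs.
From mathcomp Require Import all_boot all_order all_algebra.
From mathcomp Require Import zify.
Set Implicit Arguments. Unset Strict Implicit. Unset Printing Implicit Defensive.

(** * Stack programs *)

(** The winning condition is a Boolean combination of linear inequalities, not a conjunction, and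
    destructive or unique-winner bribery negates parts of it. Tracking all forms in one state defers
    this combination to a final evaluation, so the eight problems share one automaton. The numbers
    a_v are there because the amount by which n_v exceeds y_v is not a linear form. All counts and k
    lie below 2 to the input length, and the unknowns may be kept below it too, so the input itself
    serves as the clock. In the nonsuccinct model no binary counts are given: a pass computes the
    parity of each count and thins out the voters, so that the next pass sees the halved counts. The
    obstacle to the time bound is that polynomial bounds are not stable under iteration: whatever a
    fold feeds back to itself needs a size bound known in advance. For parsing this is a linear
    tradeoff, for the list of votes it is that no pass lets it grow, and for the set of carry
    vectors it is that every step filters a fixed table. *)

Inductive cmd :=
| Skip
| Push (i : nat) (b : bool)
| Seq (c1 c2 : cmd)
| Case (i : nat) (ce c0 c1 : cmd)
| Loop (i : nat) (c0 c1 : cmd).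

Definition store := seq (seq bool).
Definition get (s : store) (i : nat) : seq bool := nth [::] s i.
Definition put (s : store) (i : nat) (v : seq bool) : store := set_nth [::] s i v.

(* [Case] and [Loop] consume the symbol they branch on; [Loop] stops on the empty stack. *)
Inductive exec : cmd -> store -> nat -> store -> Prop :=
| ESkip s : exec Skip s 0 s
| EPush i b s : exec (Push i b) s 1 (put s i (b :: get s i))
| ESeq c1 c2 s1 t1 s2 t2 s3 :
    exec c1 s1 t1 s2 -> exec c2 s2 t2 s3 -> exec (Seq c1 c2) s1 (t1 + t2) s3
| ECaseE i ce c0 c1 s t s' :
    get s i = [::] -> exec ce s t s' -> exec (Case i ce c0 c1) s t.+1 s'
| ECaseB i ce c0 c1 s b l t s' :
    get s i = b :: l -> exec (if b then c1 else c0) (put s i l) t s' ->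
    exec (Case i ce c0 c1) s t.+1 s'
| ELoopE i c0 c1 s : get s i = [::] -> exec (Loop i c0 c1) s 1 s
| ELoopB i c0 c1 s b l t s1 t' s' :
    get s i = b :: l -> exec (if b then c1 else c0) (put s i l) t s1 ->
    exec (Loop i c0 c1) s1 t' s' -> exec (Loop i c0 c1) s (t + t').+1 s'.

Inductive instr :=
| IPush (i : nat) (b : bool) (n : nat)
| ICase (i : nat) (ne n0 n1 : nat)
| IEnd (b : bool).

Notation fetch P pc := (nth (IEnd false) P pc).

Definition stk (x : instr) : nat :=
  match x with IPush i _ _ => i | ICase i _ _ _ => i | IEnd _ => 0 end.

Definition target (x : instr) (r : option bool) : nat :=
  match x with
  | IPush _ _ n => n
  | ICase _ ne n0 n1 => match r with None => ne | Some b => if b then n1 else n0 end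
  | IEnd _ => 0
  end.

Inductive istep (P : seq instr) : nat * store -> nat * store -> Prop :=
| SPush pc s i b n : fetch P pc = IPush i b n ->
    istep P (pc, s) (n, put s i (b :: get s i))
| SCaseE pc s i ne n0 n1 : fetch P pc = ICase i ne n0 n1 -> get s i = [::] ->
    istep P (pc, s) (ne, s)
| SCaseB pc s i ne n0 n1 b l : fetch P pc = ICase i ne n0 n1 -> get s i = b :: l ->
    istep P (pc, s) (if b then n1 else n0, put s i l).

Inductive isteps (P : seq instr) : nat -> nat * store -> nat * store -> Prop :=
| SNil x : isteps P 0 x x
| SCons t x y z : istep P x y -> isteps P t y z -> isteps P t.+1 x z.

Lemma isteps_trans P t1 t2 x y z :
  isteps P t1 x y -> isteps P t2 y z -> isteps P (t1 + t2) x z.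
Proof. by elim=> [//|t a b c ab _ IH] /IH; apply: SCons. Qed.

(* Compiles [c] to the addresses from [base] on, leaving to address [out];
   returns the code and its entry point. *)
Fixpoint flat (c : cmd) (base out : nat) : seq instr * nat :=
  match c with
  | Skip => ([::], out)
  | Push i b => ([:: IPush i b out], base)
  | Seq c1 c2 =>
      let: (k2, e2) := flat c2 base out in
      let: (k1, e1) := flat c1 (base + size k2) e2 in
      (k2 ++ k1, e1)
  | Case i ce c0 c1 =>
      let: (ke, ee) := flat ce base out in
      let: (k0, e0) := flat c0 (base + size ke) out in
      let: (k1, e1) := flat c1 (base + size ke + size k0) out in
      (ke ++ k0 ++ k1 ++ [:: ICase i ee e0 e1], base + size ke + size k0 + size k1)
  | Loop i c0 c1 =>
      let k0 := (flat c0 base 0).1 in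
      let k1 := (flat c1 (base + size k0) 0).1 in
      let a := base + size k0 + size k1 in
      let: (k0, e0) := flat c0 base a in
      let: (k1, e1) := flat c1 (base + size k0) a in
      (k0 ++ k1 ++ [:: ICase i out e0 e1], a)
  end.

(** Makes the layout of [Loop] consistent: its bodies exit to the test at [a], whose address depends
    on their sizes, so they are first compiled with the dummy exit 0 only to be measured. *)
Lemma size_flat c b o b' o' : size (flat c b o).1 = size (flat c b' o').1.
Proof.
elim: c b o b' o' => //=.
- move=> c1 IH1 c2 IH2 b o b' o'.
  case E2: (flat c2 b o) => [k2 e2]; case E1: (flat c1 _ _) => [k1 e1].
  case E2': (flat c2 b' o') => [k2' e2']; case E1': (flat c1 _ _) => [k1' e1'] /=.
  rewrite !size_cat; have := IH2 b o b' o'; rewrite E2 E2' /= => ->.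
  by have := IH1 (b + size k2) e2 (b' + size k2') e2'; rewrite E1 E1' /= => ->.
- move=> i c IH c0 IH0 c1 IH1 b o b' o'.
  case E: (flat c b o) => [k e]; case E0: (flat c0 _ _) => [k0 e0].
  case E1: (flat c1 _ _) => [k1 e1].
  case E': (flat c b' o') => [k' e']; case E0': (flat c0 _ _) => [k0' e0'].
  case E1': (flat c1 _ _) => [k1' e1'] /=; rewrite !size_cat /=.
  have := IH b o b' o'; rewrite E E' /= => ->.
  have := IH0 (b + size k) o (b' + size k') o'; rewrite E0 E0' /= => ->.
  by have := IH1 (b + size k + size k0) o (b' + size k' + size k0') o'; rewrite E1 E1' /= => ->.
- move=> i c0 IH0 c1 IH1 b o b' o'.
  case E0: (flat c0 _ (_ + _)) => [k0 e0]; case E1: (flat c1 _ (_ + _)) => [k1 e1].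
  case E0': (flat c0 _ (_ + _)) => [k0' e0']; case E1': (flat c1 _ (_ + _)) => [k1' e1'] /=.
  rewrite !size_cat /=.
  have -> : size k0 = size k0' by rewrite -[k0]/((k0, e0).1) -E0 -[k0']/((k0', e0').1) -E0'; apply: IH0.
  by have -> : size k1 = size k1' by rewrite -[k1]/((k1, e1).1) -E1 -[k1']/((k1', e1').1) -E1'; apply: IH1.
Qed.

Definition holds_at (P : seq instr) (base : nat) (k : seq instr) : Prop :=
  exists a b, P = a ++ k ++ b /\ size a = base.

Lemma holds_at_cat P base k1 k2 :
  holds_at P base (k1 ++ k2) -> holds_at P base k1 /\ holds_at P (base + size k1) k2.
Proof.
move=> [a [b [-> <-]]]; split; first by exists a, (k2 ++ b); rewrite !catA.
by exists (a ++ k1), b; rewrite size_cat !catA.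
Qed.

Lemma holds_at1 P base x : holds_at P base [:: x] -> fetch P base = x.
Proof. by move=> [a [b [-> <-]]]; rewrite nth_cat ltnn subnn. Qed.

(** The step counts agree exactly: exits are passed down as addresses, so [Skip] and [Seq] emit no
    instruction, while each push and each test emits one. *)
Lemma flat_exec P c s t s' : exec c s t s' -> forall base out,
  holds_at P base (flat c base out).1 -> isteps P t ((flat c base out).2, s) (out, s').
Proof.
elim=> {c s t s'} /=.
- by move=> s base out _; apply: SNil.
- move=> i b s base out /holds_at1 H; apply: (SCons (t := 0)); last exact: SNil.
  exact: SPush H.
- move=> c1 c2 s1 t1 s2 t2 s3 _ IH1 _ IH2 base out.
  case E2: (flat c2 base out) => [k2 e2]; case E1: (flat c1 _ _) => [k1 e1] /=.
  case/holds_at_cat => H2 H1.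
  have := IH1 (base + size k2) e2; rewrite E1 => /(_ H1) S1.
  by have := IH2 base out; rewrite E2 => /(_ H2); apply: isteps_trans S1.
- move=> i ce c0 c1 s t s' g _ IH base out.
  case E: (flat ce base out) => [k e]; case E0: (flat c0 _ _) => [k0 e0].
  case E1: (flat c1 _ _) => [k1 e1] /=.
  case/holds_at_cat => He /holds_at_cat[_ /holds_at_cat[_ /holds_at1 H]].
  apply: (SCons (y := (e, s))); first by apply: SCaseE H _.
  by have := IH base out; rewrite E; apply.
- move=> i ce c0 c1 s b l t s' g _ IH base out.
  case E: (flat ce base out) => [k e]; case E0: (flat c0 _ _) => [k0 e0].
  case E1: (flat c1 _ _) => [k1 e1] /=.
  case/holds_at_cat => He /holds_at_cat[H0 /holds_at_cat[H1 /holds_at1 H]].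
  apply: SCons; first exact: SCaseB H g.
  case: b {g} IH => IH.
    by have := IH (base + size k + size k0) out; rewrite E1; apply.
  by have := IH (base + size k) out; rewrite E0; apply.
- move=> i c0 c1 s g base out.
  case E0: (flat c0 _ (_ + _)) => [k0 e0]; case E1: (flat c1 _ (_ + _)) => [k1 e1] /=.
  case/holds_at_cat => H0 /holds_at_cat[H1 /holds_at1].
  have -> : size (flat c0 base 0).1 = size k0.
    by rewrite -[k0]/((k0, e0).1) -E0; apply: size_flat.
  have -> : size (flat c1 (base + size k0) 0).1 = size k1.
    by rewrite -[k1]/((k1, e1).1) -E1; apply: size_flat.
  move=> H; apply: (SCons (t := 0)); last exact: SNil.
  exact: SCaseE H g.
- move=> i c0 c1 s b l t s1 t' s' g _ IH _ IHL base out; move: IHL.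
  move=> /(_ base out) /=.
  case E0: (flat c0 _ (_ + _)) => [k0 e0]; case E1: (flat c1 _ (_ + _)) => [k1 e1] /=.
  have e0E : size (flat c0 base 0).1 = size k0.
    by rewrite -[k0]/((k0, e0).1) -E0; apply: size_flat.
  have e1E : size (flat c1 (base + size k0) 0).1 = size k1.
    by rewrite -[k1]/((k1, e1).1) -E1; apply: size_flat.
  rewrite e0E e1E in E0 E1 *; set a := base + _ + _ in E0 E1 *.
  move=> IHL H; have IHL' := IHL H.
  case/holds_at_cat: H => H0 /holds_at_cat[H1 /holds_at1 H].
  apply: SCons; first exact: SCaseB H g.
  apply: isteps_trans IHL'.
  case: b {g} IH => IH; first by have := IH (base + size k0) a; rewrite E1; apply.
  by have := IH base a; rewrite E0; apply.
Qed.

(** * Stack programs on a Turing machine *)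

(** Reading blanks beyond both lists identifies tapes that differ only in outer blanks. [agree] then
    uses absolute coordinates, so a move of the head changes the position and not the contents. *)
Definition tape_at (tp : seq sym * sym * seq sym) (i : int) : sym :=
  let: (l, h, r) := tp in
  match i with
  | Posz 0 => h
  | Posz n.+1 => nth None r n
  | Negz n => nth None l n
  end.

Definition agree (f : int -> sym) (pos : int) tp := forall i, tape_at tp i = f (pos + i)%R.

Definition shift (mv : move) : int :=
  match mv with MoveL => -1 | MoveR => 1 | MoveS => 0 end%R.

Definition write (f : int -> sym) (pos : int) (w : sym) : int -> sym :=
  fun z => if z == pos then w else f z.

Lemma tm_step_agree M q f pos tp q' w mv :
  agree f pos tp -> ~~ halting q -> tm_delta M q (f pos) = (q', w, mv) ->
  exists2 tp', tm_step M (q, tp) = (q', tp')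
    & agree (write f pos w) (pos + shift mv)%R tp'.
Proof.
case: tp => [[l h] r] A nh; have := A 0%R; rewrite GRing.addr0 /= => <- E.
rewrite /tm_step (negbTE nh) E.
case: mv {E}.
- have AL n : nth None l n = f (pos - n.+1%:Z)%R by have := A (Negz n); rewrite NegzE.
  have AR n : nth None r n = f (pos + n.+1%:Z)%R by have := A (Posz n.+1).
  case: l A AL => [|a l] A AL; eexists; try reflexivity; case=> [[|[|n]]|n] /=; rewrite /write.
  + by rewrite ifN; [have := AL 0; rewrite /= => ->; congr f; lia | lia].
  + by rewrite ifT //; lia.
  + by rewrite ifN; [rewrite AR; congr f; lia | lia].
  + by rewrite ifN; [have := AL n.+1; rewrite !nth_nil => ->; congr f; lia | lia].
  + by rewrite ifN; [have := AL 0; rewrite /= => ->; congr f; lia | lia].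
  + by rewrite ifT //; lia.
  + by rewrite ifN; [rewrite AR; congr f; lia | lia].
  + by rewrite ifN; [have := AL n.+1; rewrite /= => ->; congr f; lia | lia].
- have AL n : nth None l n = f (pos - n.+1%:Z)%R by have := A (Negz n); rewrite NegzE.
  have AR n : nth None r n = f (pos + n.+1%:Z)%R by have := A (Posz n.+1).
  case: r A AR => [|a r] A AR; eexists; try reflexivity; case=> [[|n]|[|n]] /=; rewrite /write.
  + by rewrite ifN; [have := AR 0; rewrite /= => ->; congr f; lia | lia].
  + by rewrite ifN; [have := AR n.+1; rewrite !nth_nil => ->; congr f; lia | lia].
  + by rewrite ifT //; lia.
  + by rewrite ifN; [rewrite AL; congr f; lia | lia].
  + by rewrite ifN; [have := AR 0; rewrite /= => ->; congr f; lia | lia].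
  + by rewrite ifN; [have := AR n.+1; rewrite /= => ->; congr f; lia | lia].
  + by rewrite ifT //; lia.
  + by rewrite ifN; [rewrite AL; congr f; lia | lia].
- eexists; first reflexivity.
  case=> [[|n]|n] /=; rewrite /write.
  + by rewrite ifT //; lia.
  + by rewrite ifN; [have := A (Posz n.+1); rewrite /= => ->; congr f; lia | lia].
  + by rewrite ifN; [have := A (Negz n); rewrite /= => ->; congr f; lia | lia].
Qed.

Definition reach (M : TM) (T : nat) (q : nat) (f : int -> sym) (pos : int)
    (q' : nat) (f' : int -> sym) (pos' : int) : Prop :=
  forall tp, agree f pos tp -> exists t tp',
    [/\ t <= T, tm_run M t (q, tp) = (q', tp') & agree f' pos' tp'].

Lemma reach0 M q f pos : reach M 0 q f pos q f pos.
Proof. by move=> tp A; exists 0, tp. Qed.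

Lemma reach_trans M T1 T2 q1 f1 p1 q2 f2 p2 q3 f3 p3 :
  reach M T1 q1 f1 p1 q2 f2 p2 -> reach M T2 q2 f2 p2 q3 f3 p3 ->
  reach M (T1 + T2) q1 f1 p1 q3 f3 p3.
Proof.
move=> R1 R2 tp /R1[t1 [tp1 [l1 r1 A1]]]; have [t2 [tp2 [l2 r2 A2]]] := R2 _ A1.
exists (t2 + t1), tp2; split=> //; first by rewrite addnC leq_add.
by rewrite /tm_run iterD -/(tm_run M t1 _) r1.
Qed.

Lemma reach_le M T T' q f p q' f' p' :
  T <= T' -> reach M T q f p q' f' p' -> reach M T' q f p q' f' p'.
Proof. by move=> le R tp /R[t [tp' [l r A]]]; exists t, tp'; split=> //; apply: leq_trans le. Qed.

Lemma reach_ext M T q f p q' f1 f2 p' :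
  f1 =1 f2 -> reach M T q f p q' f1 p' -> reach M T q f p q' f2 p'.
Proof. by move=> E R tp /R[t [tp' [l r A]]]; exists t, tp'; split=> // i; rewrite A E. Qed.

Section Compile.

Variables (P : seq instr) (start : nat).
Let K := (foldr maxn 0 [seq stk x | x <- P]).+1.

Lemma stk_le pc : stk (fetch P pc) < K.
Proof.
rewrite ltnS /K; elim: P pc => [|x p IH] [|pc] //=; first exact: leq_maxl.
by apply: leq_trans (IH pc) _; apply: leq_maxr.
Qed.

(* Stack 0 occupies the cells right of the home cell 0; stack [i > 0] occupies
   the cells [-(i + h * K)], [h > 0], from bottom to top. The cells with
   [h = 0] stay blank and stop the way back from the top of the stack. *)
Definition cell (i h : nat) : int :=
  if i == 0 then h%:Z%R else (- (i + h * K)%N%:Z)%R.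

Definition stride (i : nat) : nat := if i == 0 then 1 else K.
Definition outward (i : nat) : move := if i == 0 then MoveR else MoveL.
Definition inward (i : nat) : move := if i == 0 then MoveL else MoveR.

Definition symbol (s : store) (i h : nat) : sym :=
  if h is h'.+1 then nth None (map Some (rev (get s i))) h' else None.

Definition rep (s : store) (f : int -> sym) : Prop :=
  forall i h, i < K -> f (cell i h) = symbol s i h.

Lemma cell_inj i h j h' : i < K -> j < K -> cell i h = cell j h' -> i = j /\ h = h'.
Proof.
move=> iK jK; rewrite /cell; case: eqP => [->|i0]; case: eqP => [->|j0]; try lia.
move=> E; have {}E : i + h * K = j + h' * K by lia.
suff hh : h = h' by lia.
case: (ltngtP h h') => // lt; have := leq_mul lt (leqnn K); lia.
Qed.

(* A control state is the program counter, a phase, a step counter and the popped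
   symbol. Phases: 0 go to the foot of the stack, 1 climb to the first blank,
   2 step back and read, 3 descend to the foot, 4 return home. *)
Definition ctl := ((nat * nat) * (nat * option bool))%type.

(** Jump targets are arbitrary numbers. All addresses past the end fetch [IEnd false], so merging
    them changes nothing and leaves finitely many control states. *)
Definition clamp n := minn n (size P).

Lemma fetch_clamp n : fetch P (clamp n) = fetch P n.
Proof.
by rewrite /clamp; case: leqP => // le; rewrite !nth_default // ltnW.
Qed.

Definition entry (n : nat) : ctl := ((clamp n, 0), (stk (fetch P n), None)).

Definition delta (x : ctl) (h : sym) : (ctl + bool) * sym * move :=
  let: ((pc, ph), (c, res)) := x in
  let ins := fetch P pc in
  if ins is IEnd b then (inr b, h, MoveR) else
  let i := stk ins in
  let go ph' c' res' := inl ((pc, ph'), (c', res')) in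
  match ph, c with
  | 0, c'.+1 => (go 0 c' res, h, MoveL)
  | 0, 0 => (go 1 (stride i) res, h, MoveS)
  | 1, c'.+1 => (go 1 c' res, h, outward i)
  | 1, 0 =>
      match h, ins with
      | Some _, _ => (go 1 (stride i) res, h, MoveS)
      | None, IPush _ b _ => (go 3 (stride i) res, Some b, MoveS)
      | None, _ => (go 2 (stride i) res, h, MoveS)
      end
  | 2, c'.+1 => (go 2 c' res, h, inward i)
  | 2, 0 =>
      match h with
      | None => (go 4 i None, None, MoveS)
      | Some b => (go 3 (stride i) (Some b), None, MoveS)
      end
  | 3, c'.+1 => (go 3 c' res, h, inward i)
  | 3, 0 => if h is None then (go 4 i res, h, MoveS) else (go 3 (stride i) res, h, MoveS)
  | _, c'.+1 => (go 4 c' res, h, MoveR)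
  | _, 0 => (inl (entry (target ins res)), h, MoveS)
  end.

Definition ctls : seq ctl :=
  [seq (a, b) | a <- [seq (pc, ph) | pc <- iota 0 (size P).+1, ph <- iota 0 5],
                b <- [seq (c, r) | c <- iota 0 K.+1, r <- [:: None; Some true; Some false]]].

Lemma mem_ctls pc ph c r : pc <= size P -> ph < 5 -> c <= K -> ((pc, ph), (c, r)) \in ctls.
Proof.
move=> h1 h2 h3; apply: allpairs_f; apply: allpairs_f; rewrite ?mem_iota //.
by case: r => [[]|].
Qed.

(** The fallback to state 2 gives well-formedness without a proof that [delta] stays inside [ctls].
    The shift by 3 leaves room for the start state and the two halting states. *)
Definition encode (x : ctl + bool) : nat :=
  match x with
  | inr true => 1
  | inr false => 2
  | inl y => if y \in ctls then 3 + index y ctls else 2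
  end.

Arguments ctls : simpl never.
Arguments encode : simpl never.

(** State 0 serves only to step left from the first input symbol, at position 1, onto the home cell
    0. *)
Definition machine : TM := {|
  tm_states := 3 + size ctls;
  tm_delta := fun q h =>
    if q == 0 then (encode (inl (entry start)), h, MoveL)
    else let: (y, w, mv) := delta (nth (entry 0) ctls (q - 3)) h in (encode y, w, mv) |}.

Lemma machine_wf : TM_wf machine.
Proof.
split=> // q h _; rewrite /tm_delta /=.
have E x : encode x < 3 + size ctls.
  by case: x => [y|[]]; rewrite /encode //; case: ifP => // m; rewrite ltn_add2l index_mem.
by case: ifP => _; [apply: E | case: delta => [[y w] mv]; apply: E].
Qed.

Lemma reach_step x f pos y w mv : x \in ctls -> delta x (f pos) = (y, w, mv) ->
  reach machine 1 (encode (inl x)) f pos (encode y) (write f pos w) (pos + shift mv)%R.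
Proof.
move=> xin dx tp A; rewrite [encode (inl x)]/encode xin.
have [||tp' E A'] := @tm_step_agree machine (3 + index x ctls) f pos tp (encode y) w mv A.
- by rewrite /halting.
- by rewrite /= addKn nth_index // dx.
by exists 1, tp'.
Qed.

Lemma write_id f pos : write f pos (f pos) =1 f.
Proof. by move=> z; rewrite /write; case: eqP => [->|]. Qed.

Lemma reach_stay x f pos y mv : x \in ctls -> delta x (f pos) = (y, f pos, mv) ->
  reach machine 1 (encode (inl x)) f pos (encode y) f (pos + shift mv)%R.
Proof. by move=> xin dx; apply: reach_ext (reach_step xin dx); apply: write_id. Qed.

Lemma reach_walk pc ph res mv f : pc <= size P -> ph < 5 ->
  (forall c h, delta ((pc, ph), (c.+1, res)) h = (inl ((pc, ph), (c, res)), h, mv)) ->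
  forall c pos, c <= K ->
  reach machine c (encode (inl ((pc, ph), (c, res)))) f pos
    (encode (inl ((pc, ph), (0, res)))) f (pos + shift mv * c%:Z)%R.
Proof.
move=> hpc hph D; elim=> [|c IH] pos cK.
  by rewrite GRing.mulr0 GRing.addr0; apply: reach0.
have -> : (pos + shift mv * c.+1%:Z = pos + shift mv + shift mv * c%:Z)%R by lia.
rewrite -addn1 addnC; apply: reach_trans (IH _ (ltnW cK)).
by apply: reach_stay; [apply: mem_ctls | apply: D].
Qed.

Lemma shift_outward i h : cell i h.+1 = (cell i h + shift (outward i) * (stride i)%:Z)%R.
Proof. by rewrite /cell /outward /stride; case: eqP => /= _; lia. Qed.

Lemma shift_inward i h : cell i h = (cell i h.+1 + shift (inward i) * (stride i)%:Z)%R.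
Proof. by rewrite /cell /inward /stride; case: eqP => /= _; lia. Qed.

Lemma cell0 i : cell i 0 = (- i%:Z)%R.
Proof. by rewrite /cell; case: eqP => [->|]; lia. Qed.

Lemma stride_le i : stride i <= K.
Proof. by rewrite /stride; case: eqP. Qed.

Lemma symbol_some s i h : h < size (get s i) -> exists b, symbol s i h.+1 = Some b.
Proof. by move=> lt; rewrite /= (nth_map false) ?size_rev //; eexists. Qed.

Lemma symbol_top s i : symbol s i (size (get s i)).+1 = None.
Proof. by rewrite /= nth_default // size_map size_rev. Qed.

Lemma rep_write s i v f h w : i < K -> rep s f ->
  (forall j, symbol (put s i v) i j = if j == h then w else symbol s i j) ->
  rep (put s i v) (write f (cell i h) w).
Proof.
move=> iK rp E j k jK; rewrite /write.
case: (j =P i) => [->|ji].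
  rewrite E; case: (k =P h) => [->|kh]; first by rewrite eqxx.
  by rewrite ifN ?rp //; apply/eqP => /(cell_inj iK iK)[].
rewrite ifN; last by apply/eqP => /(cell_inj jK iK)[].
by rewrite rp // /symbol /get /put nth_set_nth /= ifN //; apply/eqP.
Qed.

Lemma get_put s i v : get (put s i v) i = v.
Proof. by rewrite /get /put nth_set_nth /= eqxx. Qed.

(** * One stack instruction as a walk of the head *)

Section Instruction.

Variables (pc : nat) (s : store) (f : int -> sym).
Let ins := fetch P pc.
Let i := stk ins.
Let q ph c res := encode (inl ((clamp pc, ph), (c, res))).
Hypothesis rp : rep s f.
Hypothesis not_end : forall b, ins <> IEnd b.

Let cpc : clamp pc <= size P.
Proof. exact: geq_minr. Qed.

Let iK : i < K := stk_le pc.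

Lemma delta_walk ph c res h : ph < 5 ->
  delta ((clamp pc, ph), (c.+1, res)) h =
  (inl ((clamp pc, ph), (c, res)), h,
   match ph with 0 => MoveL | 1 => outward i | 4 => MoveR | _ => inward i end).
Proof.
rewrite /delta fetch_clamp -/ins -/i; move: not_end; rewrite /i.
by case: ins => [? ? ?|? ? ? ?|b] ne; [| | by have := ne b]; case: ph => [|[|[|[|[|]]]]].
Qed.

Lemma reach_climb res :
  reach machine ((size (get s i)).+1 * K.+1) (q 1 (stride i) res) f (cell i 0)
    (q 1 0 res) f (cell i (size (get s i)).+1).
Proof.
have up h : reach machine K (q 1 (stride i) res) f (cell i h) (q 1 0 res) f (cell i h.+1).
  rewrite shift_outward; apply: reach_le (stride_le i) _.
  by apply: reach_walk => // [c x|]; [rewrite delta_walk | apply: stride_le].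
have: size (get s i) <= size (get s i) by [].
elim: {-2}(size (get s i)) => [|h IH] le; first by apply: reach_le (up 0); lia.
rewrite mulSn addnC; apply: reach_trans (IH (ltnW le)) _.
rewrite -add1n; apply: reach_trans (up h.+1).
rewrite -{2}[cell i h.+1]GRing.addr0; have [b Eb] := symbol_some le.
apply: (@reach_stay _ _ _ _ MoveS); first exact: mem_ctls.
rewrite rp // Eb /delta fetch_clamp -/ins -/i; move: not_end.
by case: ins => [? ? ?|? ? ? ?|e] ne //; have := ne e.
Qed.

Lemma reach_go :
  reach machine K.+1 (encode (inl (entry pc))) f 0%R (q 1 (stride i) None) f (cell i 0).
Proof.
have -> : entry pc = ((clamp pc, 0), (i, None)) by [].
rewrite -addn1; apply: (@reach_trans _ _ _ _ _ _ (q 0 0 None) f (cell i 0)).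
  have -> : cell i 0 = (0 + shift MoveL * i%:Z)%R by rewrite cell0 /=; lia.
  apply: reach_le (ltnW iK) _; apply: reach_walk => // [c x|]; last exact: ltnW.
  by rewrite delta_walk.
rewrite -{2}[cell i 0]GRing.addr0.
apply: (@reach_stay _ _ _ _ MoveS); first exact: mem_ctls.
rewrite /delta fetch_clamp -/ins -/i; move: not_end.
by case: ins => [? ? ?|? ? ? ?|e] ne //; have := ne e.
Qed.

Lemma reach_home f1 res :
  reach machine K.+1 (q 4 i res) f1 (cell i 0) (encode (inl (entry (target ins res)))) f1 0%R.
Proof.
rewrite -addn1; apply: (@reach_trans _ _ _ _ _ _ (q 4 0 res) f1 0%R).
  have -> : 0%R = (cell i 0 + shift MoveR * i%:Z)%R by rewrite cell0 /=; lia.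
  apply: reach_le (ltnW iK) _; apply: reach_walk => // [c x|]; last exact: ltnW.
  by rewrite delta_walk.
have {2}-> : 0%R = (0 + shift MoveS)%R by [].
apply: reach_stay; first exact: mem_ctls.
rewrite /delta fetch_clamp -/ins -/i; move: not_end.
by case: ins => [? ? ?|? ? ? ?|e] ne //; have := ne e.
Qed.

(** The start level [h.+1] is the new top after a push, and the cell just blanked above the top
    after a pop; only the levels 1 to [h] have to be nonblank. The blank foot at level 0 ends the
    descent. *)
Lemma reach_descend s' f' res h : rep s' f' -> h <= size (get s' i) ->
  reach machine (h.+1 * K.+1 + K.+1) (q 3 (stride i) res) f' (cell i h.+1)
    (encode (inl (entry (target ins res)))) f' 0%R.
Proof.
move=> rp'.
have down j : reach machine K (q 3 (stride i) res) f' (cell i j.+1) (q 3 0 res) f' (cell i j).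
  rewrite (shift_inward i j); apply: reach_le (stride_le i) _.
  by apply: reach_walk => // [c x|]; [rewrite delta_walk | apply: stride_le].
have look j y : delta ((clamp pc, 3), (0, res)) (f' (cell i j)) = (y, f' (cell i j), MoveS) ->
    reach machine 1 (q 3 0 res) f' (cell i j) (encode y) f' (cell i j).
  move=> D; rewrite -{2}[cell i j]GRing.addr0.
  by apply: (@reach_stay _ _ _ _ MoveS) D; apply: mem_ctls.
elim: h => [|h IH] le.
  rewrite mul1n; apply: (reach_trans _ (@reach_home f' res)).
  rewrite -[K.+1]addn1; apply: reach_trans (down 0) _; apply: (look 0 (inl ((clamp pc, 4), (i, res)))).
  rewrite rp' //= fetch_clamp -/ins -/i; move: not_end.
  by case: ins => [? ? ?|? ? ? ?|e] ne //; have := ne e.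
rewrite mulSn -addnA; apply: (reach_trans _ (IH (ltnW le))).
rewrite -[K.+1]addn1; apply: reach_trans (down h.+1) _; apply: (look h.+1 (inl ((clamp pc, 3), (stride i, res)))).
have [b Eb] := symbol_some le; rewrite rp' // Eb /delta fetch_clamp -/ins -/i; move: not_end.
by case: ins => [? ? ?|? ? ? ?|e] ne //; have := ne e.
Qed.

End Instruction.

Lemma nth_symbols b l j :
  nth None (map Some (rev (b :: l))) j =
  if j == size l then Some b else nth None (map Some (rev l)) j :> option bool.
Proof.
rewrite rev_cons map_rcons nth_rcons size_map size_rev.
case: ltngtP => // lt; by rewrite nth_default // size_map size_rev ltnW.
Qed.

(** An instruction is a round trip: home to foot, foot to the first blank, back to the foot, home.
    Each level costs at most a stride and one test, that is [K.+1] steps, and is passed twice; the 3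
    covers the ends of the trip. *)
Lemma reach_istep (s : store) f x y : rep s f -> istep P (x, s) y ->
  exists2 f', rep y.2 f' &
  reach machine (2 * K.+1 * (sumn (map size s) + 3))
    (encode (inl (entry x))) f 0%R (encode (inl (entry y.1))) f' 0%R.
Proof.
move=> rp st.
have get_le i : size (get s i) <= sumn (map size s).
  rewrite /get; elim: (s) i => [|a l IH] [|i] //=; rewrite ?leq_addr //.
  by apply: leq_trans (IH i) _; rewrite leq_addl.
move Ex : (x, s) st => xs st; case: st Ex => {xs y} pc s1 i.
- move=> b n Ei [? ?]; subst pc s1 => /=.
  have ne e : fetch P x <> IEnd e by rewrite Ei.
  have [iE nE] : stk (fetch P x) = i /\ target (fetch P x) None = n by rewrite Ei.
  have iK : i < K by rewrite -iE; apply: stk_le.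
  set L := size (get s i).
  have rp' : rep (put s i (b :: get s i)) (write f (cell i L.+1) (Some b)).
    apply: rep_write => // [[|j]] //=; rewrite get_put nth_symbols eqSS.
    by case: eqP => // ->.
  exists (write f (cell i L.+1) (Some b)) => //.
  have := @reach_go x f ne; cbv beta; rewrite iE => G.
  have := @reach_climb x s f rp ne None; cbv beta; rewrite iE => C.
  have := @reach_descend x ne _ _ None L rp'; cbv beta; rewrite iE nE get_put => /(_ (leqnSn _)) D.
  apply: reach_le (reach_trans G (reach_trans C (reach_trans (T1 := 1) _ D))).
    by have := get_le i; rewrite -/L -/K; move: (sumn _) => N; nia.
  rewrite -{3}[cell i L.+1]GRing.addr0.
  apply: (@reach_step _ _ _ _ _ MoveS); first by apply: mem_ctls => //; apply: geq_minr.
  by rewrite rp // symbol_top /delta fetch_clamp Ei.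
- move=> ne n0 n1 Ei gE [? ?]; subst pc s1 => /=.
  have nE e : fetch P x <> IEnd e by rewrite Ei.
  have [iE tE] : stk (fetch P x) = i /\ target (fetch P x) None = ne by rewrite Ei.
  have iK : i < K by rewrite -iE; apply: stk_le.
  exists f => //.
  have := @reach_go x f nE; cbv beta; rewrite iE => G.
  have := @reach_climb x s f rp nE None; cbv beta; rewrite iE gE => C.
  have := @reach_home x nE f None; cbv beta; rewrite iE tE => H.
  have cE : cell i 1 = (cell i 1 + shift MoveS)%R by rewrite GRing.addr0.
  have S1 : reach machine 1 (encode (inl ((clamp x, 1), (0, None)))) f (cell i 1)
      (encode (inl ((clamp x, 2), (stride i, None)))) f (cell i 1).
    rewrite {2}cE; apply: reach_stay; first by apply: mem_ctls => //; apply: geq_minr.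
    by have := symbol_top s i; rewrite rp // gE => ->; rewrite /delta fetch_clamp Ei.
  have S2 : reach machine (stride i) (encode (inl ((clamp x, 2), (stride i, None)))) f (cell i 1)
      (encode (inl ((clamp x, 2), (0, None)))) f (cell i 0).
    rewrite (shift_inward i 0); apply: reach_walk; rewrite ?geq_minr ?stride_le // => c h.
    by rewrite delta_walk // iE.
  have S3 : reach machine 1 (encode (inl ((clamp x, 2), (0, None)))) f (cell i 0)
      (encode (inl ((clamp x, 4), (i, None)))) f (cell i 0).
    rewrite -{2}[cell i 0]GRing.addr0.
    apply: (@reach_stay _ _ _ _ MoveS); first by apply: mem_ctls => //; apply: geq_minr.
    by rewrite rp // /delta fetch_clamp Ei.
  apply: reach_le (reach_trans G (reach_trans C (reach_trans S1 (reach_trans S2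
    (reach_trans S3 H))))).
  have := stride_le i; rewrite /= -/K; move: (sumn _) => N; nia.
- move=> ne n0 n1 b l Ei gE [? ?]; subst pc s1 => /=.
  have nE e : fetch P x <> IEnd e by rewrite Ei.
  have [iE tE] : stk (fetch P x) = i /\ target (fetch P x) (Some b) = if b then n1 else n0.
    by rewrite Ei.
  have iK : i < K by rewrite -iE; apply: stk_le.
  have lE : size (get s i) = (size l).+1 by rewrite gE.
  set L := (size l).
  have topE : f (cell i L.+1) = Some b.
    by rewrite rp //= gE nth_symbols eqxx.
  have rp' : rep (put s i l) (write f (cell i L.+1) None).
    apply: rep_write => // [[|j]] //=; rewrite get_put gE nth_symbols eqSS.
    by case: eqP => // ->; rewrite nth_default // size_map size_rev.
  exists (write f (cell i L.+1) None) => //.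
  have := @reach_go x f nE; cbv beta; rewrite iE => G.
  have := @reach_climb x s f rp nE None; cbv beta; rewrite iE lE => C.
  have := @reach_descend x nE _ _ (Some b) L rp'; cbv beta; rewrite iE tE get_put => /(_ (leqnn _)) D.
  have S1 : reach machine 1 (encode (inl ((clamp x, 1), (0, None)))) f (cell i L.+2)
      (encode (inl ((clamp x, 2), (stride i, None)))) f (cell i L.+2).
    rewrite -{2}[cell i L.+2]GRing.addr0.
    apply: (@reach_stay _ _ _ _ MoveS); first by apply: mem_ctls => //; apply: geq_minr.
    by have := symbol_top s i; rewrite lE rp // => ->; rewrite /delta fetch_clamp Ei.
  have S2 : reach machine (stride i) (encode (inl ((clamp x, 2), (stride i, None)))) f (cell i L.+2)
      (encode (inl ((clamp x, 2), (0, None)))) f (cell i L.+1).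
    rewrite (shift_inward i L.+1); apply: reach_walk; rewrite ?geq_minr ?stride_le // => c h.
    by rewrite delta_walk // iE.
  have S3 : reach machine 1 (encode (inl ((clamp x, 2), (0, None)))) f (cell i L.+1)
      (encode (inl ((clamp x, 3), (stride i, Some b)))) (write f (cell i L.+1) None) (cell i L.+1).
    rewrite -{3}[cell i L.+1]GRing.addr0.
    apply: (@reach_step _ _ _ _ _ MoveS); first by apply: mem_ctls => //; apply: geq_minr.
    by rewrite topE /delta fetch_clamp Ei.
  apply: reach_le (reach_trans G (reach_trans C (reach_trans S1 (reach_trans S2
    (reach_trans S3 D))))).
  have := stride_le i; have := get_le i; rewrite lE -/L -/K.
  move: (sumn _) => N; nia.
Qed.

Lemma istep_size x y : istep P x y -> sumn (map size y.2) <= (sumn (map size x.2)).+1.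
Proof.
have E s i v : sumn (map size (put s i v)) + size (get s i) = sumn (map size s) + size v.
  rewrite /put /get; elim: s i => [|a s IH] [|i] /=; try lia.
  - by elim: i => /= [|i]; lia.
  - by have := IH i; lia.
case=> {x y} pc s i /= => [b n _|//|ne n0 n1 b l _ g].
  by have := E s i (b :: get s i); rewrite /=; lia.
by have := E s i l; rewrite g /=; lia.
Qed.

Lemma reach_isteps t x y f : isteps P t x y -> rep x.2 f ->
  exists2 f', rep y.2 f' &
  reach machine (t * (2 * K.+1 * (sumn (map size x.2) + t + 3)))
    (encode (inl (entry x.1))) f 0%R (encode (inl (entry y.1))) f' 0%R.
Proof.
move=> st; elim: st f => {t x y} [x|t x y z xy _ IH] f rp.
  by exists f => //; apply: reach0.
case: x xy rp => x s xy rp.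
have [f1 rp1 R1] := reach_istep rp xy; have [f2 rp2 R2] := IH _ rp1.
exists f2 => //; apply: reach_le (reach_trans R1 R2).
have := istep_size xy; rewrite /=; move: (sumn _) (sumn _) => N1 N2 /= le.
by rewrite mulSn leq_add // !leq_mul //; lia.
Qed.

End Compile.

(** * Input, output and verdict of the simulating machine *)

Lemma tm_outputE f tp q x : agree f 1%R tp ->
  (forall h, f (h.+1)%:Z%R = nth None (map Some x) h) -> tm_output (q, tp) = x.
Proof.
case: tp => [[l h] r] A H; rewrite /tm_output; set s := h :: r.
have {}H j : nth None s j = nth None (map Some x) j.
  by rewrite -H; have := A (Posz j); case: j => [|j] /= ->; congr f; lia.
move: (s) H => {A}; elim: x => [|b x IH] s'.
  by case: s' => [|a s'] // H; have := H 0; rewrite /= => ->.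
case: s' => [|a s'] H; first by have := H 0.
have := H 0; rewrite /= => ->; rewrite /= IH // => j; exact: (H j.+1).
Qed.

Lemma isteps_size P t x y : isteps P t x y -> sumn (map size y.2) <= sumn (map size x.2) + t.
Proof. by elim=> [z|u a b c ab _ IH]; rewrite ?addn0 //; have := istep_size ab; lia. Qed.

Definition input_tape (x : seq bool) (z : int) : sym :=
  if z is Posz h.+1 then nth None (map Some x) h else None.

Lemma rep_input P x : rep P [:: rev x] (input_tape x).
Proof.
case=> [|i] h _; first by rewrite /symbol /get /= revK; case: h.
have -> : symbol [:: rev x] i.+1 h = None by case: h => //= h; rewrite /get /= !nth_nil.
have neg z : (z < 0)%R -> input_tape x z = None by case: z.
by apply: neg; rewrite /cell /=; lia.
Qed.

Lemma agree_input x :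
  agree (input_tape x) 1%R ([::], head None (map Some x), behead (map Some x)).
Proof.
case=> [[|n]|n] /=; first by case: x.
- by rewrite /input_tape /= nth_behead.
- by rewrite nth_nil /input_tape NegzE; case: n => [|n] //; have -> : (1 - n.+2%:Z = Negz n :> int)%R by lia.
Qed.

(* The input is on stack 0 with its last bit on top, the verdict on top of stack 1
   and the output on stack 0. *)
Theorem stack_program_machine (c : cmd) : exists (M : TM) (C : nat), TM_wf M /\
  forall x t s', exec c [:: rev x] t s' -> exists t',
    [/\ t' <= C * (size x + t + 1) ^ 2,
        (tm_run M t' (tm_init x)).1 = (if head false (get s' 1) then 1 else 2)
      & tm_output (tm_run M t' (tm_init x)) = rev (get s' 0)].
Proof.
(* Addresses 0 and 1 halt. The program starts behind them and exits to address 2, which pops the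
   verdict from stack 1; an empty stack counts as rejection. *)
pose P := [:: IEnd false; IEnd true; ICase 1 0 0 1] ++ (flat c 3 2).1.
pose e := (flat c 3 2).2.
(* This [K] is the largest stack index plus two, the factor [K.+1] of [reach_istep]. The constant 12
   is generous. *)
pose K := (foldr maxn 0 [seq stk x | x <- P]).+2.
exists (machine P e), (12 * K + 2); split; first exact: machine_wf.
move=> x t s' ex.
have at3 : holds_at P 3 (flat c 3 2).1.
  by exists [:: IEnd false; IEnd true; ICase 1 0 0 1], [::]; rewrite cats0.
have st := flat_exec ex at3.
set verdict := head false _; pose s2 := if get s' 1 is b :: l then put s' 1 l else s'.
have st2 : istep P (2, s') (nat_of_bool verdict, s2).
  rewrite /verdict /s2; case g: (get s' 1) => [|b l] /=; first exact: (@SCaseE P 2 s' 1 0 0 1).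
  by have := @SCaseB P 2 s' 1 0 0 1 b l erefl g; case: b {g}.
have [f1 rp1 R1] := @reach_isteps P e _ _ _ _ st (@rep_input P x).
have [f2 rp2 R2] := @reach_istep P e _ _ _ _ rp1 st2.
have out : get s2 0 = get s' 0 by rewrite /s2; case: (get s' 1) => // b l; case: (s').
(* [IEnd] steps right from the home cell, so the head halts on the bottom of stack 0, where
   [tm_output] starts reading. Reading from the bottom upwards is what reverses the stack. *)
have R3 : reach (machine P e) 1 (encode P (inl (entry P verdict))) f2 0%R
    (encode P (inr verdict)) f2 1%R.
  have -> : 1%R = (0 + shift MoveR)%R by [].
  apply: reach_stay; first by apply: mem_ctls => //; [apply: geq_minr | apply/ltnW/stk_le].
  by rewrite /delta /entry fetch_clamp; case: (verdict).
have [tp0 E0 A0] : exists2 tp0, tm_step (machine P e) (tm_init x)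
      = (encode P (inl (entry P e)), tp0) & agree (input_tape x) 0%R tp0.
  have [//|//|tp0 E0 A0] := @tm_step_agree (machine P e) 0 (input_tape x) 1%R
    ([::], head None (map Some x), behead (map Some x)) (encode P (inl (entry P e)))
    (input_tape x 1%R) MoveL (agree_input x).
  by exists tp0 => // i; rewrite A0 write_id.
have [t' [tp' [le run A']]] := reach_trans R1 (reach_trans R2 R3) A0.
exists t'.+1; rewrite /tm_run iterSr E0 -/(tm_run _ _ _) run; split.
- apply: leq_ltn_trans le _; have := isteps_size st; rewrite /= size_rev -/K !addn0.
  move: (sumn _) (size x) (K) => N n k le; nia.
- by rewrite /encode; case: (verdict).
- apply: tm_outputE A' _ => h; have := rp2 0 h.+1 (ltn0Sn _).
  by rewrite /symbol out.
Qed.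

(** * Programs on binary trees *)

Inductive tree := Lf | Nd (a b : tree).

(** Prefix notation is self-delimiting: trees can lie above one another on a stack, and the end of
    the top one is found by counting pending subtrees. *)
Fixpoint ser (t : tree) : seq bool :=
  match t with Lf => [:: false] | Nd a b => true :: ser a ++ ser b end.

Fixpoint weight (t : tree) : nat :=
  match t with Lf => 1 | Nd a b => (weight a + weight b).+1 end.

Lemma size_ser t : size (ser t) = weight t.
Proof. by elim: t => //= a IHa b IHb; rewrite size_cat IHa IHb. Qed.

Lemma weight_gt0 t : 0 < weight t. Proof. by case: t. Qed.

(* [CIter f] maps [Nd l s] to the state obtained from [s] by applying
   [s := f (Nd a s)] to the elements [a] of the right spine of [l] in turn. *)
Inductive code :=
| CId
| CLeaf
| CComp (g f : code)
| CPair (f g : code)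
| CFst
| CSnd
| CIf (t f g : code)
| CIter (f : code).

Fixpoint titer (f : tree -> tree) (l s : tree) : tree :=
  if l is Nd a l' then titer f l' (f (Nd a s)) else s.

Fixpoint eval (c : code) (x : tree) : tree :=
  match c with
  | CId => x
  | CLeaf => Lf
  | CComp g f => eval g (eval f x)
  | CPair f g => Nd (eval f x) (eval g x)
  | CFst => if x is Nd a _ then a else Lf
  | CSnd => if x is Nd _ b then b else Lf
  | CIf t f g => if eval t x is Nd _ _ then eval f x else eval g x
  | CIter f => if x is Nd l s then titer (eval f) l s else Lf
  end.

Fixpoint itcost (f : tree -> tree) (cf : tree -> nat) (l s : tree) : nat :=
  if l is Nd a l' then
    let s' := f (Nd a s) in
    40 * (weight l + weight s + weight s') + cf (Nd a s) + itcost f cf l' s'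
  else 40.

(* An upper bound for the number of stack operations taken by the compiled code. *)
Fixpoint cost (c : code) (x : tree) : nat :=
  match c with
  | CId => 0
  | CLeaf => 40 * weight x
  | CComp g f => cost f x + cost g (eval f x)
  | CPair f g => cost g x + cost f x + 40 * (weight x + weight (eval g x))
  | CFst | CSnd => 40 * weight x
  | CIf t f g =>
      cost t x + 40 * (weight x + weight (eval t x))
      + if eval t x is Nd _ _ then cost f x else cost g x
  | CIter f => 40 * weight x + if x is Nd l s then itcost (eval f) (cost f) l s else 0
  end.

(** * Stack routines that move, drop, copy and permute serialized trees *)

Definition run (c : cmd) (s : store) (n : nat) (s' : store) : Prop :=
  exists2 t, t <= n & exec c s t s'.

Lemma run_le c s n m s' : n <= m -> run c s n s' -> run c s m s'.
Proof. by move=> le [t lt e]; exists t => //; apply: leq_trans le. Qed.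

Lemma run_seq c1 c2 s1 n1 s2 n2 s3 :
  run c1 s1 n1 s2 -> run c2 s2 n2 s3 -> run (Seq c1 c2) s1 (n1 + n2) s3.
Proof. by case=> t1 l1 e1 [t2 l2 e2]; exists (t1 + t2); [apply: leq_add | apply: ESeq e1 e2]. Qed.

Lemma run_skip s : run Skip s 0 s.
Proof. by exists 0 => //; apply: ESkip. Qed.

Lemma run_push i b s : run (Push i b) s 1 (put s i (b :: get s i)).
Proof. by exists 1 => //; apply: EPush. Qed.

Lemma run_push_to i b s v s' : get s i = v -> put s i (b :: v) = s' -> run (Push i b) s 1 s'.
Proof. by move=> <- <-; apply: run_push. Qed.

Lemma run_case i ce c0 c1 s b l n s' : get s i = b :: l ->
  run (if b then c1 else c0) (put s i l) n s' -> run (Case i ce c0 c1) s n.+1 s'.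
Proof. by move=> g [t le e]; exists t.+1 => //; apply: ECaseB g e. Qed.

Lemma run_loopE i c0 c1 s : get s i = [::] -> run (Loop i c0 c1) s 1 s.
Proof. by move=> g; exists 1 => //; apply: ELoopE. Qed.

Lemma run_loopB i c0 c1 s b l n s1 n' s' : get s i = b :: l ->
  run (if b then c1 else c0) (put s i l) n s1 -> run (Loop i c0 c1) s1 n' s' ->
  run (Loop i c0 c1) s (n + n').+1 s'.
Proof.
move=> g [t le e] [t' le' e']; exists (t + t').+1; first by rewrite ltnS leq_add.
exact: ELoopB g e e'.
Qed.

(* Stack 1 holds the serialized data, stacks 2 to 4 trees in transit, stack 5
   counts pending subtrees and stack 6 controls loops. *)
Definition regs r a b1 b2 b3 f : store := [:: r; a; b1; b2; b3; [::]; f].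

Definition move_tree (k : nat) : cmd :=
  Seq (Push 5 true)
    (Loop 5 Skip (Case 1 Skip (Push k false)
       (Seq (Push k true) (Seq (Push 5 true) (Push 5 true))))).

(** Generalised from one tree to the list [ts] of pending trees, with one token per tree on stack 5:
    a leaf discharges its token, an inner node trades it for two. The trees arrive reversed. *)
Lemma run_move_loop r b1 b2 b3 f k : 1 < k < 5 ->
  let st x y c := put (put (put (regs r [::] b1 b2 b3 f) 1 x) k y) 5 c in
  forall ts x y,
  run (Loop 5 Skip (Case 1 Skip (Push k false)
         (Seq (Push k true) (Seq (Push 5 true) (Push 5 true)))))
    (st (flatten (map ser ts) ++ x) y (nseq (size ts) true))
    (5 * size (flatten (map ser ts)) + 1)
    (st x (rev (flatten (map ser ts)) ++ y) [::]).
Proof.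
move=> kb st ts x y; move: {2}(size _) (leqnn (size (flatten (map ser ts)))) => n.
have gE : forall x y c, [/\ get (st x y c) 1 = x, get (st x y c) k = y & get (st x y c) 5 = c].
  by case: k @st kb => [|[|[|[|[|k]]]]].
have pE : forall x y c z, [/\ put (st x y c) 1 z = st z y c,
    put (st x y c) k z = st x z c & put (st x y c) 5 z = st x y z].
  by case: k @st kb {gE} => [|[|[|[|[|k]]]]].
have [g1 gk g5] : [/\ forall x y c, get (st x y c) 1 = x, forall x y c, get (st x y c) k = y
    & forall x y c, get (st x y c) 5 = c] by split=> x' y' c; case: (gE x' y' c).
have [p1 pk p5] : [/\ forall x y c z, put (st x y c) 1 z = st z y c,
    forall x y c z, put (st x y c) k z = st x z c
    & forall x y c z, put (st x y c) 5 z = st x y z].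
  by split=> x' y' c z; case: (pE x' y' c z).
move: st g1 gk g5 p1 pk p5 {gE pE} => st g1 gk g5 p1 pk p5.
elim: n ts x y => [|n IH] [|[|a b] ts] x y //= le; try by apply: (@run_le _ _ 1) => //; apply: run_loopE; rewrite g5.
  rewrite rev_cons cat_rcons; apply: run_le; last first.
    apply: run_loopB; [by rewrite g5 | | by apply: IH; lia].
    rewrite p5 /=; apply: run_case; first by rewrite g1.
    by rewrite p1; apply: run_push_to; [apply: gk | apply: pk].
  by rewrite /=; lia.
have := IH (a :: b :: ts) x (true :: y).
rewrite /= !size_cat -catA rev_cons !catA cat_rcons => {}IH.
rewrite !size_cat in le IH *.
apply: run_le; last first.
  apply: run_loopB; [by rewrite g5 | | by apply: IH; lia].
  rewrite p5 /=; apply: run_case; first by rewrite g1.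
  rewrite p1; apply: run_seq; first by apply: run_push_to; [apply: gk | apply: pk].
  apply: run_seq; first by apply: run_push_to; [apply: g5 | apply: p5].
  by apply: run_push_to; [apply: g5 | apply: p5].
by rewrite /=; lia.
Qed.

Lemma run_move2 t r a b1 b2 b3 f :
  run (move_tree 2) (regs r (ser t ++ a) b1 b2 b3 f) (5 * weight t + 2)
    (regs r a (rev (ser t) ++ b1) b2 b3 f).
Proof.
have := @run_move_loop r [::] b2 b3 f 2 isT [:: t] a b1; rewrite /= cats0 size_ser => H.
by apply: run_le; last (apply: run_seq; [apply: run_push | apply: H]); lia.
Qed.

Lemma run_move3 t r a b1 b2 b3 f :
  run (move_tree 3) (regs r (ser t ++ a) b1 b2 b3 f) (5 * weight t + 2)
    (regs r a b1 (rev (ser t) ++ b2) b3 f).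
Proof.
have := @run_move_loop r b1 [::] b3 f 3 isT [:: t] a b2; rewrite /= cats0 size_ser => H.
by apply: run_le; last (apply: run_seq; [apply: run_push | apply: H]); lia.
Qed.

Lemma run_move4 t r a b1 b2 b3 f :
  run (move_tree 4) (regs r (ser t ++ a) b1 b2 b3 f) (5 * weight t + 2)
    (regs r a b1 b2 (rev (ser t) ++ b3) f).
Proof.
have := @run_move_loop r b1 b2 [::] f 4 isT [:: t] a b3; rewrite /= cats0 size_ser => H.
by apply: run_le; last (apply: run_seq; [apply: run_push | apply: H]); lia.
Qed.

Definition pour (k j : nat) : cmd := Loop k (Push j false) (Push j true).

Lemma run_pour21 y r a b2 b3 f :
  run (pour 2 1) (regs r a y b2 b3 f) (2 * size y + 1) (regs r (rev y ++ a) [::] b2 b3 f).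
Proof.
elim: y a => [|b y IH] a; first by apply: (@run_le _ _ 1) => //; apply: run_loopE.
apply: run_le; last apply: run_loopB; [|reflexivity|by case: b; apply: run_push|].
  2: by rewrite rev_cons cat_rcons; apply: IH.
by rewrite /=; lia.
Qed.

Lemma run_pour31 y r a b1 b3 f :
  run (pour 3 1) (regs r a b1 y b3 f) (2 * size y + 1) (regs r (rev y ++ a) b1 [::] b3 f).
Proof.
elim: y a => [|b y IH] a; first by apply: (@run_le _ _ 1) => //; apply: run_loopE.
apply: run_le; last apply: run_loopB; [|reflexivity|by case: b; apply: run_push|].
  2: by rewrite rev_cons cat_rcons; apply: IH.
by rewrite /=; lia.
Qed.

Lemma run_pour41 y r a b1 b2 f :
  run (pour 4 1) (regs r a b1 b2 y f) (2 * size y + 1) (regs r (rev y ++ a) b1 b2 [::] f).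
Proof.
elim: y a => [|b y IH] a; first by apply: (@run_le _ _ 1) => //; apply: run_loopE.
apply: run_le; last apply: run_loopB; [|reflexivity|by case: b; apply: run_push|].
  2: by rewrite rev_cons cat_rcons; apply: IH.
by rewrite /=; lia.
Qed.

Lemma run_pour34 y r a b1 b3 f :
  run (pour 3 4) (regs r a b1 y b3 f) (2 * size y + 1) (regs r a b1 [::] (rev y ++ b3) f).
Proof.
elim: y b3 => [|b y IH] b3; first by apply: (@run_le _ _ 1) => //; apply: run_loopE.
apply: run_le; last apply: run_loopB; [|reflexivity|by case: b; apply: run_push|].
  2: by rewrite rev_cons cat_rcons; apply: IH.
by rewrite /=; lia.
Qed.

Notation data r a f := (regs r a [::] [::] [::] f).

Definition drop_tree : cmd := Seq (move_tree 2) (Loop 2 Skip Skip).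

Lemma run_drop t r a f : run drop_tree (data r (ser t ++ a) f) (10 * weight t) (data r a f).
Proof.
have H y : run (Loop 2 Skip Skip) (regs r a y [::] [::] f) (size y + 1) (data r a f).
  elim: y => [|b y IH]; first by apply: (@run_le _ _ 1) => //; apply: run_loopE.
  apply: run_le; last apply: run_loopB; [|reflexivity|by case: b; apply: run_skip|by apply: IH].
  by rewrite /=; lia.
apply: run_le (run_seq (run_move2 t r a [::] [::] [::] f) (H _)).
by rewrite cats0 size_rev size_ser; have := weight_gt0 t; lia.
Qed.

(** Every transfer reverses. The copy collected on stack 3 is already in order, so it returns to
    stack 1 by way of stack 4 to be reversed twice. *)
Definition dup_tree : cmd :=
  Seq (move_tree 2)
    (Seq (Loop 2 (Seq (Push 1 false) (Push 3 false)) (Seq (Push 1 true) (Push 3 true)))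
       (Seq (pour 3 4) (pour 4 1))).

Lemma run_dup t r a f :
  run dup_tree (data r (ser t ++ a) f) (20 * weight t) (data r (ser t ++ ser t ++ a) f).
Proof.
have H y a' b2 : run (Loop 2 (Seq (Push 1 false) (Push 3 false)) (Seq (Push 1 true) (Push 3 true)))
    (regs r a' y b2 [::] f) (3 * size y + 1) (regs r (rev y ++ a') [::] (rev y ++ b2) [::] f).
  elim: y a' b2 => [|b y IH] a' b2; first by apply: (@run_le _ _ 1) => //; apply: run_loopE.
  apply: run_le; last first.
    rewrite rev_cons !cat_rcons; apply: run_loopB (IH _ _); first reflexivity.
    by case: b; exact: (run_seq (run_push _ _ _) (run_push _ _ _)).
  by rewrite /=; lia.
have H1 := run_move2 t r a [::] [::] [::] f; have H2 := H (rev (ser t)) a [::].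
have H3 := run_pour34 (ser t) r (ser t ++ a) [::] [::] f.
have H4 := run_pour41 (rev (ser t)) r (ser t ++ a) [::] [::] f.
rewrite !(cats0, revK, size_rev, size_ser) in H1 H2 H3 H4.
by apply: run_le (run_seq H1 (run_seq H2 (run_seq H3 H4))); have := weight_gt0 t; lia.
Qed.

Definition swap_trees : cmd :=
  Seq (move_tree 2) (Seq (move_tree 3) (Seq (pour 2 1) (pour 3 1))).

Lemma run_swap t u r a f : run swap_trees (data r (ser t ++ ser u ++ a) f)
  (20 * (weight t + weight u)) (data r (ser u ++ ser t ++ a) f).
Proof.
have H1 := run_move2 t r (ser u ++ a) [::] [::] [::] f.
have H2 := run_move3 u r a (rev (ser t)) [::] [::] f.
have H3 := run_pour21 (rev (ser t)) r a (rev (ser u)) [::] f.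
have H4 := run_pour31 (rev (ser u)) r (ser t ++ a) [::] [::] f.
rewrite !(cats0, revK, size_rev, size_ser) in H1 H2 H3 H4.
apply: run_le (run_seq H1 (run_seq H2 (run_seq H3 H4))).
by have := weight_gt0 t; have := weight_gt0 u; lia.
Qed.

Definition rot_trees : cmd :=
  Seq (move_tree 2) (Seq (move_tree 3) (Seq (move_tree 4)
    (Seq (pour 3 1) (Seq (pour 4 1) (pour 2 1))))).

Lemma run_rot t u v r a f : run rot_trees (data r (ser t ++ ser u ++ ser v ++ a) f)
  (20 * (weight t + weight u + weight v)) (data r (ser t ++ ser v ++ ser u ++ a) f).
Proof.
have H1 := run_move2 t r (ser u ++ ser v ++ a) [::] [::] [::] f.
have H2 := run_move3 u r (ser v ++ a) (rev (ser t)) [::] [::] f.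
have H3 := run_move4 v r a (rev (ser t)) (rev (ser u)) [::] f.
have H4 := run_pour31 (rev (ser u)) r a (rev (ser t)) (rev (ser v)) f.
have H5 := run_pour41 (rev (ser v)) r (ser u ++ a) (rev (ser t)) [::] f.
have H6 := run_pour21 (rev (ser t)) r (ser v ++ ser u ++ a) [::] [::] f.
rewrite !(cats0, revK, size_rev, size_ser) in H1 H2 H3 H4 H5 H6.
apply: run_le (run_seq H1 (run_seq H2 (run_seq H3 (run_seq H4 (run_seq H5 H6))))).
by have := weight_gt0 t; have := weight_gt0 u; have := weight_gt0 v; lia.
Qed.

Fixpoint compile (c : code) : cmd :=
  match c with
  | CId => Skip
  | CLeaf => Seq drop_tree (Push 1 false)
  | CComp g f => Seq (compile f) (compile g)
  | CPair f g =>
      Seq dup_tree (Seq (compile g) (Seq swap_trees (Seq (compile f) (Push 1 true))))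
  | CFst => Case 1 Skip (Push 1 false) (Seq swap_trees drop_tree)
  | CSnd => Case 1 Skip (Push 1 false) drop_tree
  | CIf t f g =>
      Seq dup_tree (Seq (compile t)
        (Case 1 Skip (compile g) (Seq drop_tree (Seq drop_tree (compile f)))))
  | CIter f =>
      Case 1 Skip (Push 1 false)
        (Seq (Push 6 true) (Loop 6 Skip
          (Case 1 Skip Skip
             (Seq rot_trees (Seq (Push 1 true) (Seq (compile f)
               (Seq swap_trees (Push 6 true))))))))
  end.

(** The rest [a] of stack 1 is arbitrary because subprograms run above saved trees. Stack 6 can be
    required empty, even for nested iterators, since a loop consumes its control symbol before the
    body runs. The constant 40 pays for two transfers at 20 per unit of weight, single steps
    included. *)
Theorem run_compile c x r a :
  run (compile c) (data r (ser x ++ a) [::]) (cost c x) (data r (ser (eval c x) ++ a) [::]).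
Proof.
elim: c x a => [||g IHg f IHf|f IHf g IHg|||t IHt f IHf g IHg|f IHf] x a /=.
- exact: run_skip.
- apply: run_le; last first.
    apply: run_seq (run_drop x r a [::]) _; exact: run_push.
  by have := weight_gt0 x; lia.
- exact: run_seq (IHf _ _) (IHg _ _).
- apply: run_le; last first.
    apply: run_seq (run_dup x r a [::]) (run_seq (IHg _ _) (run_seq (run_swap _ _ _ _ _)
    (run_seq (IHf _ _) _))); rewrite -catA; exact: run_push.
  by have := weight_gt0 x; have := weight_gt0 (eval g x); lia.
- case: x => [|u v] /=.
    apply: (@run_le _ _ 2) => //; apply: run_case; first reflexivity.
    exact: run_push.
  apply: run_le; last first.
    apply: run_case; first reflexivity.
    rewrite /= -catA; apply: run_seq (run_swap _ _ _ _ _) (run_drop _ _ _ _).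
  lia.
- case: x => [|u v] /=.
    apply: (@run_le _ _ 2) => //; apply: run_case; first reflexivity.
    exact: run_push.
  apply: run_le; last first.
    apply: run_case; first reflexivity.
    rewrite /= -catA; apply: run_drop.
  lia.
- have T : run (Case 1 Skip (compile g) (Seq drop_tree (Seq drop_tree (compile f))))
      (data r (ser (eval t x) ++ ser x ++ a) [::])
      (20 * weight (eval t x) + 1 + if eval t x is Nd _ _ then cost f x else cost g x)
      (data r (ser (if eval t x is Nd _ _ then eval f x else eval g x) ++ a) [::]).
    case: (eval t x) => [|u v].
      apply: run_le; last (apply: run_case; [reflexivity | apply: IHg]); lia.
    apply: run_le; last first.
      apply: (@run_case _ _ _ _ _ true (ser u ++ ser v ++ ser x ++ a)).
        by rewrite /get /= -catA.
      apply: run_seq (run_drop _ _ _ _) (run_seq (run_drop _ _ _ _) (IHf _ _)).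
    by rewrite /=; lia.
  apply: run_le (run_seq (run_dup x r a [::]) (run_seq (IHt _ _) T)).
  by have := weight_gt0 x; lia.
- case: x => [|l s] /=.
    apply: (@run_le _ _ 2) => //; apply: run_case; first reflexivity.
    exact: run_push.
  apply: (@run_le _ _ (1 + (1 + itcost (eval f) (cost f) l s))); first lia.
  apply: run_case; first reflexivity.
  rewrite /= -catA; apply: run_seq; first exact: run_push.
  rewrite {1}/put /=.
  (* Invariant: stack 1 holds the remaining list above the state, and stack 6 one symbol. A leaf
     ends the list and leaves stack 6 empty, which stops the loop on the bare state. *)
  elim: l s => [|u _ l IH] s /=.
    apply: (@run_le _ _ (1 + 1).+1) => //; apply: run_loopB; first reflexivity.
      by apply: run_case; [reflexivity | apply: run_skip].
    exact: run_loopE.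
  have B : run (Seq (Push 1 true) (Seq (compile f) (Seq swap_trees (Push 6 true))))
      (data r (ser u ++ ser s ++ ser l ++ a) [::])
      (cost f (Nd u s) + 20 * (weight (eval f (Nd u s)) + weight l) + 2)
      (data r (ser l ++ ser (eval f (Nd u s)) ++ a) [:: true]).
    have := IHf (Nd u s) (ser l ++ a); rewrite /= -catA => H1.
    apply: run_le; last first.
      apply: run_seq; first exact: run_push.
      apply: run_seq H1 (run_seq (run_swap _ _ _ _ _) _); exact: run_push.
    lia.
  apply: run_le; last first.
    apply: run_loopB; [reflexivity | | exact: IH].
    apply: run_case; first reflexivity.
    rewrite /= -catA; exact: run_seq (run_rot _ _ _ _ _ _) B.
  by have := weight_gt0 l; lia.
Qed.

(** * Encoding data as trees *)

Class Enc (T : Type) := enc : T -> tree.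

Instance enc_tree : Enc tree := id.
(** Unary numbers suffice: in the algorithm they only take values bounded in the number of
    candidates, while the budget and the multiplicities stay bit strings. *)
Instance enc_num : Enc nat := fun n => iter n (Nd Lf) Lf.
Instance enc_bool : Enc bool := fun b => if b then Nd Lf Lf else Lf.
Instance enc_pair A B `{Enc A} `{Enc B} : Enc (A * B) := fun p => Nd (enc p.1) (enc p.2).
Instance enc_seq A `{Enc A} : Enc (seq A) := fix enc_s (s : seq A) : tree :=
  if s is a :: s' then Nd (enc a) (enc_s s') else Lf.

Lemma enc_cons A `{Enc A} (a : A) s : enc (a :: s) = Nd (enc a) (enc s).
Proof. by []. Qed.

Notation esize x := (weight (enc x)).

Lemma esize_nat (n : nat) : esize n = n.*2.+1.
Proof. by rewrite /enc /enc_num; elim: n => //= n ->; lia. Qed.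

(** Pushing and popping on stack 6 pads the store to the seven stacks of [regs]; the symbol left on
    stack 1 is the serialized empty list. *)
Definition start_up : cmd := Seq (Push 6 true) (Seq (Case 6 Skip Skip Skip) (Push 1 false)).

Lemma run_start_up r : run start_up [:: r] 3 (data r [:: false] [::]).
Proof.
have H : run (Case 6 Skip Skip Skip) (put [:: r] 6 [:: true]) 1 (data r [::] [::]).
  by apply: run_case; [reflexivity | apply: run_skip].
exact: (run_seq (run_push 6 true [:: r]) (run_seq H (run_push _ _ _))).
Qed.

Definition load_bits : cmd :=
  Loop 0 (Seq (Push 1 false) (Push 1 true))
    (Seq (Push 1 false) (Seq (Push 1 false) (Seq (Push 1 true) (Push 1 true)))).

Lemma run_load_bits r x :
  run load_bits (data r (ser (enc x)) [::]) (5 * size r + 1)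
    (data [::] (ser (enc (catrev r x))) [::]).
Proof.
elim: r x => [|b r IH] x; first by apply: (@run_le _ _ 1) => //; apply: run_loopE.
apply: run_le; last first.
  apply: run_loopB (IH (b :: x)); first reflexivity.
  case: b.
    apply: (@run_le _ _ 4 4) => //; exact: (run_seq (run_push _ _ _) (run_seq (run_push _ _ _) (run_seq (run_push _ _ _)
      (run_push _ _ _)))).
  by apply: (@run_le _ _ 2 4) => //; exact: (run_seq (run_push _ _ _) (run_push _ _ _)).
by rewrite /=; lia.
Qed.

Theorem code_machine (c : code) : exists (M : TM) (C : nat), TM_wf M /\
  forall x : seq bool, exists2 t, t <= C * (size x + cost c (enc x) + 1) ^ 2 &
    (tm_run M t (tm_init x)).1 = if eval c (enc x) is Nd _ _ then 1 else 2.
Proof.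
have [M [C [wf H]]] := stack_program_machine (Seq start_up (Seq load_bits (compile c))).
(* Loading adds about [5 * size x] steps to [cost], so the base of the square grows by a factor of
   at most 7. *)
exists M, (C * 49); split=> // x.
have R1 := run_load_bits (rev x) [::]; rewrite -/(rev (rev x)) revK in R1.
have R2 : run (compile c) (data [::] (ser (enc x)) [::]) (cost c (enc x))
    (data [::] (ser (eval c (enc x)) ++ [::]) [::]).
  by rewrite -{1}[ser (enc x)]cats0; apply: run_compile.
have [t le e] := run_seq (run_start_up (rev x)) (run_seq R1 R2).
have [t' [le' st _]] := H _ _ _ e; exists t'.
  apply: leq_trans le' _; rewrite -mulnA leq_mul // -[49]/(7 ^ 2) -expnMn leq_exp2r //.
  by move: le; rewrite size_rev; lia.
by rewrite st /get /= cats0; case: (eval c (enc x)).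
Qed.

Lemma rev_nseq T n (a : T) : rev (nseq n a) = nseq n a.
Proof. by elim: n => //= n IH; rewrite rev_cons IH -cats1 -(nseqD n 1) addn1. Qed.

Theorem code_computable (c : code) (f : nat -> nat) :
  (forall n, eval c (enc n) = enc (f n)) -> computable f.
Proof.
move=> cf.
pose load := Loop 0 Skip (Seq (Push 1 false) (Push 1 true)).
pose unload := Seq (Loop 1 Skip (Push 0 true)) (Push 1 true).
have [M [C [wf H]]] :=
  stack_program_machine (Seq start_up (Seq load (Seq (compile c) unload))).
exists M; split=> // j.
have R1 : run load (data (nseq j true) (ser (enc 0)) [::]) (3 * j + 1)
    (data [::] (ser (enc j)) [::]).
  have L k m : run load (data (nseq k true) (ser (enc m)) [::]) (3 * k + 1)
      (data [::] (ser (enc (k + m))) [::]).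
    elim: k m => [|k IH] m; first by apply: (@run_le _ _ 1) => //; apply: run_loopE.
    have := IH m.+1; rewrite (addnS k) -(addSn k) => {}IH.
    apply: run_le; last first.
      apply: run_loopB IH; first reflexivity.
      exact: (run_seq (run_push _ _ _) (run_push _ _ _)).
    by rewrite /=; lia.
  by have := L j 0; rewrite addn0.
have R2 : run (compile c) (data [::] (ser (enc j)) [::]) (cost c (enc j))
    (data [::] (ser (enc (f j)) ++ [::]) [::]).
  by rewrite -{1}[ser (enc j)]cats0 -cf; apply: run_compile.
have R3 : run unload (data [::] (ser (enc (f j)) ++ [::]) [::]) (5 * f j + 10)
    (data (nseq (f j) true) [:: true] [::]).
  rewrite cats0; apply: (@run_le _ _ (4 * f j + 9 + 1)); first lia.
  apply: (@run_seq _ _ _ _ (data (nseq (f j) true) [::] [::])); last exact: run_push.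
  have L k m : run (Loop 1 Skip (Push 0 true)) (data (nseq m true) (ser (enc k)) [::])
      (4 * k + 9) (data (nseq (k + m) true) [::] [::]).
    elim: k m => [|k IH] m.
      apply: (@run_le _ _ (0 + 1).+1) => //; apply: run_loopB; first reflexivity.
        exact: run_skip.
      exact: run_loopE.
    have := IH m.+1; rewrite (addnS k) -(addSn k) => {}IH.
    apply: (@run_le _ _ (1 + (0 + (4 * k + 9)).+1).+1); first lia.
    apply: run_loopB; [reflexivity | exact: run_push|].
    by apply: run_loopB; [reflexivity | exact: run_skip|].
  by have := L (f j) 0; rewrite addn0.
have := run_start_up (rev (nseq j true)); rewrite rev_nseq => R0.
have [t _ e] := run_seq R0 (run_seq R1 (run_seq R2 R3)).
have := H (nseq j true) _ _; rewrite rev_nseq => /(_ _ _ e)[t' [_ st out]].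
by exists t'; split; rewrite ?st ?out //= rev_nseq.
Qed.

(** * Functions computed by tree programs *)

Arguments enc : simpl never.

(** No cost is recorded: such programs will be run only on arguments bounded in the parameter, where
    [cost_growth] supplies a bound for free. *)
Definition CF X T `{Enc X} `{Enc T} (F : X -> T) : Prop :=
  exists c, forall x, eval c (enc x) = enc (F x).

Lemma CF_ext X T `{Enc X} `{Enc T} (F G : X -> T) : CF F -> F =1 G -> CF G.
Proof. by move=> [c E] FG; exists c => x; rewrite E FG. Qed.

Lemma CF_id X `{Enc X} : CF (fun x : X => x).
Proof. by exists CId. Qed.

Lemma const_code (t : tree) : exists c, forall x, eval c x = t.
Proof.
elim: t => [|a [c E] b [d E']]; first by exists CLeaf.
by exists (CPair c d) => x /=; rewrite E E'.
Qed.

Lemma CF_const X T `{Enc X} `{Enc T} (t : T) : CF (fun _ : X => t).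
Proof. by have [c E] := const_code (enc t); exists c. Qed.

Lemma CF_comp X Y T `{Enc X} `{Enc Y} `{Enc T} (F : Y -> T) (G : X -> Y) :
  CF F -> CF G -> CF (fun x => F (G x)).
Proof. by move=> [c E] [d E']; exists (CComp c d) => x /=; rewrite E' E. Qed.

Lemma CF_pair X A B `{Enc X} `{Enc A} `{Enc B} (F : X -> A) (G : X -> B) :
  CF F -> CF G -> CF (fun x => (F x, G x)).
Proof. by move=> [c E] [d E']; exists (CPair c d) => x /=; rewrite E' E. Qed.

Lemma CF_fst X A B `{Enc X} `{Enc A} `{Enc B} (F : X -> A * B) :
  CF F -> CF (fun x => (F x).1).
Proof. by move=> [c E]; exists (CComp CFst c) => x /=; rewrite E. Qed.

Lemma CF_snd X A B `{Enc X} `{Enc A} `{Enc B} (F : X -> A * B) :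
  CF F -> CF (fun x => (F x).2).
Proof. by move=> [c E]; exists (CComp CSnd c) => x /=; rewrite E. Qed.

Lemma CF_if X T `{Enc X} `{Enc T} (b : X -> bool) (F G : X -> T) :
  CF b -> CF F -> CF G -> CF (fun x => if b x then F x else G x).
Proof.
by move=> [c E] [d E'] [e E'']; exists (CIf c d e) => x /=; rewrite E; case: (b x); [apply: E' | apply: E''].
Qed.

(** The body of [CIter] sees only the current element and the state, so the argument on which the
    step function depends travels inside the state and is discarded at the end. *)
Definition fold_code (cl cs cf : code) : code :=
  CComp CSnd (CComp (CIter (CPair (CComp CFst CSnd) cf)) (CPair cl (CPair CId cs))).

Lemma eval_fold A S `{Enc A} `{Enc S} (f : S -> A -> S) cf x l s :
  (forall a t, eval cf (Nd (enc a) (Nd x (enc t))) = enc (f t a)) ->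
  titer (eval (CPair (CComp CFst CSnd) cf)) (enc l) (Nd x (enc s))
  = Nd x (enc (foldl f s l)).
Proof. move=> E; elim: l s => // a l IH s. by rewrite enc_cons /= E IH. Qed.

Lemma CF_foldl X S A `{Enc X} `{Enc S} `{Enc A} (f : X -> S -> A -> S) s (l : X -> seq A) :
  CF (fun q : A * (X * S) => f q.2.1 q.2.2 q.1) -> CF s -> CF l ->
  CF (fun x => foldl (f x) (s x) (l x)).
Proof.
move=> [cf Ef] [cs Es] [cl El]; exists (fold_code cl cs cf) => x.
rewrite /fold_code -[eval _ _]/(eval CSnd (titer (eval (CPair (CComp CFst CSnd) cf))
  (eval cl (enc x)) (Nd (enc x) (eval cs (enc x))))).
rewrite El Es (@eval_fold _ _ _ _ (f x)) // => a t.
exact: (Ef (a, (x, t))).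
Qed.

Lemma enc_nseq_tt (n : nat) : enc n = enc (nseq n Lf).
Proof. by elim: n => // n IH; rewrite /= enc_cons -IH. Qed.

Lemma CF_size X A `{Enc X} `{Enc A} (l : X -> seq A) : CF l -> CF (fun x => size (l x)).
Proof.
move=> Cl; have C : CF (fun n : nat => n.+1).
  have [c E] := const_code Lf; exists (CPair c CId) => x /=; by rewrite E.
apply: CF_ext (CF_foldl (f := fun _ n _ => n.+1) _ (CF_const 0) Cl) _.
  exact: (CF_comp C (CF_snd (CF_snd CF_id))).
by move=> x; rewrite -(add0n (size _)); elim: (l x) 0 => [|a s IH] n /=; rewrite ?addn0 // IH addSnnS.
Qed.

Lemma CF_iter X S `{Enc X} `{Enc S} (n : X -> nat) (f : X -> S -> S) (s : X -> S) :
  CF (fun q : X * S => f q.1 q.2) -> CF n -> CF s -> CF (fun x => iter (n x) (f x) (s x)).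
Proof.
move=> Cf [cn En] Cs; have Cl : CF (fun x => nseq (n x) Lf).
  by exists cn => x; rewrite En enc_nseq_tt.
apply: CF_ext (CF_foldl (f := fun x t _ => f x t) (CF_comp Cf (CF_snd CF_id)) Cs Cl) _.
by move=> x; elim: (n x) (s x) => //= k IH t; rewrite IH -iterSr.
Qed.

Lemma CF_succn X `{Enc X} (n : X -> nat) : CF n -> CF (fun x => (n x).+1).
Proof.
by move=> [c E]; have [d D] := const_code Lf; exists (CPair d c) => x /=; rewrite E D.
Qed.

Lemma CF_predn X `{Enc X} (n : X -> nat) : CF n -> CF (fun x => (n x).-1).
Proof. by move=> [c E]; exists (CComp CSnd c) => x /=; rewrite E; case: (n x). Qed.

Lemma CF_cons X A `{Enc X} `{Enc A} (a : X -> A) (l : X -> seq A) :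
  CF a -> CF l -> CF (fun x => a x :: l x).
Proof. by move=> [c E] [d D]; exists (CPair c d) => x /=; rewrite E D. Qed.

Lemma CF_behead X A `{Enc X} `{Enc A} (l : X -> seq A) : CF l -> CF (fun x => behead (l x)).
Proof. by move=> [c E]; exists (CComp CSnd c) => x /=; rewrite E; case: (l x). Qed.

Lemma CF_nilp X A `{Enc X} `{Enc A} (l : X -> seq A) : CF l -> CF (fun x => nilp (l x)).
Proof.
move=> [c E]; have [d D] := const_code (enc true); exists (CIf c CLeaf d) => x /=.
by rewrite E; case: (l x) => //; apply: D.
Qed.

Lemma CF_head X A `{Enc X} `{Enc A} (a : A) (l : X -> seq A) :
  CF l -> CF (fun x => head a (l x)).
Proof.
move=> [c E]; have [d D] := const_code (enc a); exists (CIf c (CComp CFst c) d) => x /=.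
by rewrite E; case: (l x) => //; apply: D.
Qed.

Lemma CF_negb X `{Enc X} (b : X -> bool) : CF b -> CF (fun x => ~~ b x).
Proof. by move=> Cb; exact: (CF_if Cb (CF_const false) (CF_const true)). Qed.

Lemma CF_andb X `{Enc X} (a b : X -> bool) : CF a -> CF b -> CF (fun x => a x && b x).
Proof. by move=> Ca Cb; exact: (CF_if Ca Cb (CF_const false)). Qed.

Lemma CF_orb X `{Enc X} (a b : X -> bool) : CF a -> CF b -> CF (fun x => a x || b x).
Proof. by move=> Ca Cb; exact: (CF_if Ca (CF_const true) Cb). Qed.

Lemma CF_addb X `{Enc X} (a b : X -> bool) : CF a -> CF b -> CF (fun x => a x (+) b x).
Proof. by move=> Ca Cb; apply: CF_ext (CF_if Ca (CF_negb Cb) Cb) _ => x; case: (a x). Qed.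

Lemma CF_rev X A `{Enc X} `{Enc A} (l : X -> seq A) : CF l -> CF (fun x => rev (l x)).
Proof.
move=> Cl; apply: CF_ext (CF_foldl (f := fun _ s a => a :: s) _ (CF_const [::]) Cl) _.
  exact: (CF_cons (CF_fst CF_id) (CF_snd (CF_snd CF_id))).
by move=> x; rewrite /rev; elim: (l x) [::] => //= a s IH t; rewrite IH.
Qed.

Lemma CF_foldr X S A `{Enc X} `{Enc S} `{Enc A} (f : X -> A -> S -> S) s (l : X -> seq A) :
  CF (fun q : A * (X * S) => f q.2.1 q.1 q.2.2) -> CF s -> CF l ->
  CF (fun x => foldr (f x) (s x) (l x)).
Proof.
move=> Cf Cs Cl; apply: CF_ext (CF_foldl (f := fun x t a => f x a t) Cf Cs (CF_rev Cl)) _.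
by move=> x; rewrite foldl_rev.
Qed.

(* Dispatching on the head symbol keeps unification from unfolding fixpoints. *)
Ltac cf_eta := lazymatch goal with |- @CF ?X ?T ?hX ?hT ?f =>
  let g := eval cbv beta in (fun x : X => f x) in change (@CF X T hX hT g) end.
Ltac cf_base := cf_eta; first [exact: CF_id | assumption | exact: CF_const | lazymatch goal with
  | |- CF (fun _ => pair _ _) => apply: CF_pair
  | |- CF (fun _ => if _ then _ else _) => apply: CF_if
  | |- CF (fun _ => foldl _ _ _) => apply: CF_foldl
  | |- CF (fun _ => foldr _ _ _) => apply: CF_foldr
  | |- CF (fun _ => iter _ _ _) => apply: CF_iter
  | |- CF (fun _ => S _) => apply: CF_succn
  | |- CF (fun _ => predn _) => apply: CF_predn
  | |- CF (fun _ => cons _ _) => apply: CF_cons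
  | |- CF (fun _ => behead _) => apply: CF_behead
  | |- CF (fun _ => nilp _) => apply: CF_nilp
  | |- CF (fun _ => head _ _) => apply: CF_head
  | |- CF (fun _ => negb _) => apply: CF_negb
  | |- CF (fun _ => andb _ _) => apply: CF_andb
  | |- CF (fun _ => orb _ _) => apply: CF_orb
  | |- CF (fun _ => addb _ _) => apply: CF_addb
  | |- CF (fun _ => rev _) => apply: CF_rev
  | |- CF (fun _ => size _) => apply: CF_size
  end].
Ltac cf_proj := cf_eta; lazymatch goal with
  | |- CF (fun _ => fst _) => apply: CF_fst
  | |- CF (fun _ => snd _) => apply: CF_snd
  end.

Ltac cf0 := repeat first [cf_base | cf_proj].

Lemma CF_cat X A `{Enc X} `{Enc A} (s t : X -> seq A) : CF s -> CF t -> CF (fun x => s x ++ t x).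
Proof.
move=> Cs Ct; apply: (@CF_ext _ _ _ _ (fun x => foldr cons (t x) (s x))).
  by cf0.
by move=> x; elim: (s x) => //= a l ->.
Qed.

Lemma CF_map X A B `{Enc X} `{Enc A} `{Enc B} (f : X -> A -> B) (s : X -> seq A) :
  CF (fun q : X * A => f q.1 q.2) -> CF s -> CF (fun x => map (f x) (s x)).
Proof.
move=> Cf Cs; apply: (@CF_ext _ _ _ _ (fun x => foldr (fun a t => f x a :: t) [::] (s x))).
  apply: CF_foldr => //; last exact: CF_const.
  apply: CF_cons; last by cf0.
  by apply: (CF_comp Cf (G := fun q : A * (X * seq B) => (q.2.1, q.1))); cf0.
by move=> x; elim: (s x) => //= a l ->.
Qed.

Lemma CF_filter X A `{Enc X} `{Enc A} (p : X -> A -> bool) (s : X -> seq A) :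
  CF (fun q : X * A => p q.1 q.2) -> CF s -> CF (fun x => filter (p x) (s x)).
Proof.
move=> Cp Cs.
apply: (@CF_ext _ _ _ _ (fun x => foldr (fun a t => if p x a then a :: t else t) [::] (s x))).
  apply: CF_foldr => //; last exact: CF_const.
  apply: CF_if; last by cf0.
    by apply: (CF_comp Cp (G := fun q : A * (X * seq A) => (q.2.1, q.1))); cf0.
  by cf0.
by move=> x; elim: (s x) => //= a l ->.
Qed.

Lemma CF_has X A `{Enc X} `{Enc A} (p : X -> A -> bool) (s : X -> seq A) :
  CF (fun q : X * A => p q.1 q.2) -> CF s -> CF (fun x => has (p x) (s x)).
Proof.
move=> Cp Cs; apply: (@CF_ext _ _ _ _ (fun x => foldr (fun a b => p x a || b) false (s x))).
  apply: CF_foldr => //; last exact: CF_const.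
  apply: CF_orb; last by cf0.
  by apply: (CF_comp Cp (G := fun q : A * (X * bool) => (q.2.1, q.1))); cf0.
by move=> x; elim: (s x) => //= a l ->.
Qed.

Lemma CF_all X A `{Enc X} `{Enc A} (p : X -> A -> bool) (s : X -> seq A) :
  CF (fun q : X * A => p q.1 q.2) -> CF s -> CF (fun x => all (p x) (s x)).
Proof.
move=> Cp Cs; apply: (@CF_ext _ _ _ _ (fun x => ~~ has (fun a => ~~ p x a) (s x))).
  by apply: CF_negb; apply: CF_has => //; apply: CF_negb.
by move=> x; rewrite has_predC negbK.
Qed.

Lemma CF_flatten X A `{Enc X} `{Enc A} (s : X -> seq (seq A)) :
  CF s -> CF (fun x => flatten (s x)).
Proof.
move=> Cs; apply: CF_foldr => //; last exact: CF_const.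
by apply: CF_cat; cf0.
Qed.

Lemma CF_addn X `{Enc X} (m n : X -> nat) : CF m -> CF n -> CF (fun x => m x + n x).
Proof.
move=> Cm Cn; apply: (@CF_ext _ _ _ _ (fun x => iter (m x) S (n x))).
  by cf0.
by move=> x; rewrite iter_succn addnC.
Qed.

Lemma CF_subn X `{Enc X} (m n : X -> nat) : CF m -> CF n -> CF (fun x => m x - n x).
Proof.
move=> Cm Cn; apply: (@CF_ext _ _ _ _ (fun x => iter (n x) predn (m x))).
  by cf0.
by move=> x; elim: (n x) => [|k IH] /=; rewrite ?subn0 // IH subnS.
Qed.

Lemma CF_muln X `{Enc X} (m n : X -> nat) : CF m -> CF n -> CF (fun x => m x * n x).
Proof.
move=> Cm Cn; apply: (@CF_ext _ _ _ _ (fun x => iter (m x) (addn (n x)) 0)).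
  apply: CF_iter => //; last exact: CF_const.
  by apply: CF_addn; [apply: (CF_comp Cn)|]; cf0.
by move=> x; rewrite iter_addn_0 mulnC.
Qed.

Lemma CF_leq X `{Enc X} (m n : X -> nat) : CF m -> CF n -> CF (fun x => m x <= n x).
Proof.
move=> Cm Cn; apply: (@CF_ext _ _ _ _ (fun x => nilp (nseq (m x - n x) Lf))).
  apply: CF_nilp; have [c E] := CF_subn Cm Cn.
  by exists c => x; rewrite E enc_nseq_tt.
by move=> x; rewrite -subn_eq0; case: (_ - _).
Qed.

Lemma CF_half X `{Enc X} (n : X -> nat) : CF n -> CF (fun x => (n x)./2).
Proof.
move=> Cn; pose step (p : nat * bool) := if p.2 then (p.1.+1, false) else (p.1, true).
apply: (@CF_ext _ _ _ _ (fun x => (iter (n x) step (0, false)).1)).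
  by rewrite /step; cf0.
move=> x; suff -> : iter (n x) step (0, false) = ((n x)./2, odd (n x)) by [].
elim: (n x) => //= k ->; rewrite /step /= uphalf_half; by case: (odd k).
Qed.

Definition CFeq (T : eqType) `{Enc T} := CF (fun p : T * T => p.1 == p.2).
Arguments CFeq T {_}.

Lemma CF_eq X (T : eqType) `{Enc X} `{Enc T} (F G : X -> T) :
  CFeq T -> CF F -> CF G -> CF (fun x => F x == G x).
Proof. by move=> C CF1 CG; apply: (CF_comp C (CF_pair CF1 CG)). Qed.

Lemma CFeq_nat : CFeq nat.
Proof.
apply: (@CF_ext _ _ _ _ (fun p : nat * nat => (p.1 <= p.2) && (p.2 <= p.1))).
  by apply: CF_andb; apply: CF_leq; cf0.
by move=> p; rewrite eqn_leq.
Qed.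

Lemma CF_drop X A `{Enc X} `{Enc A} (n : X -> nat) (s : X -> seq A) :
  CF n -> CF s -> CF (fun x => drop (n x) (s x)).
Proof.
move=> Cn Cs; apply: (@CF_ext _ _ _ _ (fun x => iter (n x) behead (s x))).
  by cf0.
move=> x; elim: (n x) => [|k IH] /=; rewrite ?drop0 // IH -drop1 drop_drop add1n //.
Qed.

Lemma CF_nth X A `{Enc X} `{Enc A} (a : A) (n : X -> nat) (s : X -> seq A) :
  CF n -> CF s -> CF (fun x => nth a (s x) (n x)).
Proof.
move=> Cn Cs; apply: (CF_ext (CF_head a (CF_drop Cn Cs))) => x.
by rewrite -nth0 nth_drop addn0.
Qed.

Lemma CF_iota X `{Enc X} (m n : X -> nat) : CF m -> CF n -> CF (fun x => iota (m x) (n x)).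
Proof.
move=> Cm Cn; apply: (@CF_ext _ _ _ _ (fun x => iter (n x) (fun s => m x :: map S s) [::])).
  apply: CF_iter => //; last exact: CF_const.
  apply: CF_cons; first by apply: (CF_comp Cm); cf0.
  by apply: CF_map; cf0.
by move=> x; elim: (n x) => //= k ->; rewrite -(iotaDl 1).
Qed.

Lemma CFeq_seq (T : eqType) `{Enc T} (a : T) : CFeq T -> CFeq (seq T).
Proof.
move=> C; apply: (@CF_ext _ _ _ _ (fun p : seq T * seq T => (size p.1 == size p.2) &&
  all (fun i => nth a p.1 i == nth a p.2 i) (iota 0 (size p.1)))).
  apply: CF_andb; first by apply: CF_eq; [apply: CFeq_nat | |]; cf0.
  apply: CF_all; last by apply: CF_iota; cf0.
  by apply: CF_eq => //; apply: CF_nth; cf0.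
move=> [s t] /=; apply/andP/eqP => [[/eqP E /allP P]|->].
  apply: (eq_from_nth (x0 := a)) => // i lt; apply/eqP/P; by rewrite mem_iota.
by split=> //; apply/allP.
Qed.

Lemma CF_mem X (T : eqType) `{Enc X} `{Enc T} (a : X -> T) (s : X -> seq T) :
  CFeq T -> CF a -> CF s -> CF (fun x => a x \in s x).
Proof.
move=> C Ca Cs; apply: (@CF_ext _ _ _ _ (fun x => has (fun b => b == a x) (s x))).
  apply: CF_has => //; apply: CF_eq => //; first by cf0.
  by apply: (CF_comp Ca); cf0.
by move=> x; rewrite has_pred1.
Qed.

Lemma CF_index X (T : eqType) `{Enc X} `{Enc T} (a : X -> T) (s : X -> seq T) :
  CFeq T -> CF a -> CF s -> CF (fun x => index (a x) (s x)).
Proof.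
move=> C Ca Cs.
apply: (@CF_ext _ _ _ _ (fun x => foldr (fun b n => if b == a x then 0 else n.+1) 0 (s x))).
  apply: CF_foldr => //; last exact: CF_const.
  apply: CF_if; [|exact: CF_const | by cf0].
  apply: CF_eq => //; first by cf0.
  by apply: (CF_comp Ca); cf0.
by move=> x; rewrite /index; elim: (s x) => //= b l ->.
Qed.

Lemma CF_uniq X (T : eqType) `{Enc X} `{Enc T} (s : X -> seq T) :
  CFeq T -> CF s -> CF (fun x => uniq (s x)).
Proof.
move=> C Cs; apply: (@CF_ext _ _ _ _ (fun x =>
  (foldr (fun a p => (a :: p.1, (a \notin p.1) && p.2)) ([::], true) (s x)).2)).
  apply: CF_snd; apply: CF_foldr => //; last exact: CF_const.
  apply: CF_pair; first by cf0.
  apply: CF_andb; last by cf0.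
  by apply: CF_negb; apply: CF_mem => //; cf0.
move=> x; suff -> : foldr (fun a p => (a :: p.1, (a \notin p.1) && p.2)) ([::], true) (s x)
  = (s x, uniq (s x)) by [].
by elim: (s x) => //= a l ->.
Qed.

Lemma CF_last X A `{Enc X} `{Enc A} (a : X -> A) (s : X -> seq A) :
  CF a -> CF s -> CF (fun x => last (a x) (s x)).
Proof.
move=> Ca Cs; apply: (@CF_ext _ _ _ _ (fun x => foldl (fun _ b => b) (a x) (s x))).
  by cf0.
by move=> x; elim: (s x) (a x) => //= b l IH c; rewrite IH.
Qed.

Lemma CF_zip X A B `{Enc X} `{Enc A} `{Enc B} (b : B) (s : X -> seq A) (t : X -> seq B) :
  CF s -> CF t -> CF (fun x => zip (s x) (t x)).
Proof.
move=> Cs Ct; pose step (p : seq B * seq (A * B)) a :=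
  (behead p.1, if nilp p.1 then p.2 else (a, head b p.1) :: p.2).
apply: (@CF_ext _ _ _ _ (fun x => rev (foldl step (t x, [::]) (s x)).2)).
  by rewrite /step; cf0.
move=> x; suff E acc : (foldl step (t x, acc) (s x)).2 = catrev (zip (s x) (t x)) acc.
  by rewrite E /rev -[catrev _ [::]]/(rev _) -/(rev (rev _)) revK.
elim: (s x) (t x) acc => [|a s' IH] [|b' t'] acc //=; rewrite /step /= -/step ?IH //.
by case: s' {IH}.
Qed.

Lemma CF_sumn X `{Enc X} (s : X -> seq nat) : CF s -> CF (fun x => sumn (s x)).
Proof.
move=> Cs; apply: CF_foldr => //; last exact: CF_const.
by apply: CF_addn; cf0.
Qed.

Lemma CFeq_seq_nat : CFeq (seq nat).
Proof. exact: (CFeq_seq 0 CFeq_nat). Qed.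

Lemma CF_eqn X `{Enc X} (m n : X -> nat) : CF m -> CF n -> CF (fun x => m x == n x).
Proof. exact: (CF_eq CFeq_nat). Qed.

Lemma CF_eqs X `{Enc X} (s t : X -> seq nat) : CF s -> CF t -> CF (fun x => s x == t x).
Proof. exact: (CF_eq CFeq_seq_nat). Qed.

Lemma CF_mems X `{Enc X} a (s : X -> seq (seq nat)) : CF a -> CF s -> CF (fun x => a x \in s x).
Proof. exact: (CF_mem CFeq_seq_nat). Qed.

Lemma CF_indexn X `{Enc X} a (s : X -> seq nat) : CF a -> CF s -> CF (fun x => index (a x) (s x)).
Proof. exact: (CF_index CFeq_nat). Qed.

Lemma CF_indexs X `{Enc X} a (s : X -> seq (seq nat)) :
  CF a -> CF s -> CF (fun x => index (a x) (s x)).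
Proof. exact: (CF_index CFeq_seq_nat). Qed.

Lemma CF_uniqn X `{Enc X} (s : X -> seq nat) : CF s -> CF (fun x => uniq (s x)).
Proof. exact: (CF_uniq CFeq_nat). Qed.

Ltac cf_step := cf_eta; first [cf_base | cf_proj | lazymatch goal with
  | |- CF (fun _ => cat _ _) => apply: CF_cat
  | |- CF (fun _ => map _ _) => apply: CF_map
  | |- CF (fun _ => filter _ _) => apply: CF_filter
  | |- CF (fun _ => has _ _) => apply: CF_has
  | |- CF (fun _ => all _ _) => apply: CF_all
  | |- CF (fun _ => flatten _) => apply: CF_flatten
  | |- CF (fun _ => addn _ _) => apply: CF_addn
  | |- CF (fun _ => subn _ _) => apply: CF_subn
  | |- CF (fun _ => muln _ _) => apply: CF_muln
  | |- CF (fun _ => leq _ _) => apply: CF_leq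
  | |- CF (fun _ => half _) => apply: CF_half
  | |- CF (fun _ => drop _ _) => apply: CF_drop
  | |- CF (fun _ => nth _ _ _) => apply: CF_nth
  | |- CF (fun _ => iota _ _) => apply: CF_iota
  | |- CF (fun _ => last _ _) => apply: CF_last
  | |- CF (fun _ => sumn _) => apply: CF_sumn
  | |- CF (fun _ => eq_op _ _) => first [apply: CF_eqn | apply: CF_eqs]
  | |- CF (fun _ => in_mem _ _) => apply: CF_mems
  | |- CF (fun _ => index _ _) => first [apply: CF_indexn | apply: CF_indexs]
  | |- CF (fun _ => uniq _) => apply: CF_uniqn
  end].
Ltac cf := repeat cf_step.

(** * Cost bounds *)

(** The admissible parameter functions. Monotonicity lets bounds be substituted into bounds; being
    in [CF] yields [computable] at the end. *)
Definition growth (b : nat -> nat) : Prop := {homo b : m n / m <= n} /\ CF b.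

Lemma growth_id : growth id.
Proof. by split=> //; exact: CF_id. Qed.

Lemma growth_const k : growth (fun _ => k).
Proof. by split=> //; exact: CF_const. Qed.

Lemma growth_add b c : growth b -> growth c -> growth (fun n => b n + c n).
Proof.
move=> [mb Cb] [mc Cc]; split; last exact: CF_addn.
by move=> m n le; rewrite leq_add ?mb ?mc.
Qed.

Lemma growth_mul b c : growth b -> growth c -> growth (fun n => b n * c n).
Proof.
move=> [mb Cb] [mc Cc]; split; last exact: CF_muln.
by move=> m n le; rewrite leq_mul ?mb ?mc.
Qed.

Ltac growth_tac := repeat first [assumption | exact: growth_id | exact: growth_const
  | lazymatch goal with
    | |- growth (fun _ => addn _ _) => apply: growth_add
    | |- growth (fun _ => muln _ _) => apply: growth_mul
    | |- growth (muln ?k) => exact: (growth_mul (growth_const k) growth_id)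
    end].

Lemma growth_comp b c : growth b -> growth c -> growth (fun n => b (c n)).
Proof.
move=> [mb Cb] [mc Cc]; split; last exact: CF_comp Cb Cc.
by move=> m n le; rewrite mb ?mc.
Qed.

Lemma leq_iter b k l : (forall n, n <= b n) -> k <= l -> forall n, iter k b n <= iter l b n.
Proof.
move=> infl le n; rewrite -(subnK le); elim: (l - k) => // j IH.
by rewrite addSn /=; apply: leq_trans IH (infl _).
Qed.

Lemma iter_mono b k m n : {homo b : m n / m <= n} -> m <= n -> iter k b m <= iter k b n.
Proof. by move=> mb le; elim: k => //= k IH; apply: mb. Qed.

(** A loop composes the size bound of its body with itself once per element, so the class of bounds
    has to be closed under iteration. *)
Lemma growth_iter b c : growth b -> (forall n, n <= b n) -> growth c ->
  growth (fun n => iter n b (c n)).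
Proof.
move=> [mb Cb] infl [mc Cc]; split.
  move=> m n le; apply: leq_trans (leq_iter infl le _) _.
  by apply: iter_mono => //; apply: mc.
by apply: CF_iter => //; [apply: (CF_comp Cb); cf | cf].
Qed.

(** The growth of the output is paid for by counted operations, so cost bounds are size bounds as
    well, and compositions need no separate size analysis. *)
Lemma weight_eval c x : weight (eval c x) <= weight x + cost c x.
Proof.
elim: c x => [||g IHg f IHf|f IHf g IHg|||t IHt f IHf g IHg|f IHf] x /=.
- lia.
- by have := weight_gt0 x; lia.
- by have := IHf x; have := IHg (eval f x); lia.
- by have := IHf x; have := weight_gt0 x; lia.
- by case: x => //= *; lia.
- by case: x => //= *; lia.
- by have := IHf x; have := IHg x; case: (eval t x) => *; lia.
- case: x => //= l s; apply: (@leq_trans (weight s + weight l + itcost (eval f) (cost f) l s)); last lia.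
  by elim: l s => //= [|u _ l IH] s; [lia | have := IH (eval f (Nd u s)); lia].
Qed.

Theorem cost_growth c : exists b, growth b /\ forall x, cost c x <= b (weight x).
Proof.
elim: c => [||g [bg [Gg Hg]] f [bf [Gf Hf]]|f [bf [Gf Hf]] g [bg [Gg Hg]]|||
  t [bt [Gt Ht]] f [bf [Gf Hf]] g [bg [Gg Hg]]|f [bf [Gf Hf]]].
- by exists (fun _ => 0); split; first exact: growth_const.
- exists (fun n => 40 * n); split=> //.
  exact: (growth_mul (growth_const 40) growth_id).
- exists (fun n => bf n + bg (n + bf n)); split=> [|x /=].
    exact: growth_add Gf (growth_comp Gg (growth_add growth_id Gf)).
  rewrite leq_add ?Hf //; apply: leq_trans (Hg _) _; apply: Gg.1.
  by apply: leq_trans (weight_eval f x) _; rewrite leq_add2l Hf.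
- exists (fun n => bg n + bf n + 40 * (n + (n + bg n))); split=> [|x /=].
    growth_tac.
  by have := Hg x; have := Hf x; have := weight_eval g x; lia.
- exists (fun n => 40 * n); split=> //.
  exact: (growth_mul (growth_const 40) growth_id).
- exists (fun n => 40 * n); split=> //.
  exact: (growth_mul (growth_const 40) growth_id).
- exists (fun n => bt n + 40 * (n + (n + bt n)) + (bf n + bg n)); split=> [|x /=].
    growth_tac.
  have := Hg x; have := Hf x; have := Ht x; have := weight_eval t x.
  by case: (eval t x) => *; lia.
(* If [n] bounds the argument of the body, then [d n] bounds its result, with one more [n] left over
   for the list and the constants. *)
- pose d n := n + bf n + n.
  have Gd : growth d by rewrite /d; growth_tac.
  have infl n : n <= d n by rewrite /d; lia.
  (* Here 121 is 3 * 40 + 1: three weights at 40 each and the cost of the body, every one of them at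
     most [d W]. *)
  exists (fun n => 40 * n + (n * (121 * iter n d (2 * n + 1)) + 40)); split.
    growth_tac; apply: growth_iter => //; growth_tac.
  case=> [|l s]; rewrite [cost _ _]/=; first by rewrite addn0 leq_addr.
  rewrite leq_add2l; set N := weight _.
  have aux W : 1 + weight l + weight s <= W ->
    itcost (eval f) (cost f) l s <= weight l * (121 * iter (weight l) d W) + 40.
    (* [M] freezes the weight of the initial list. The remaining list only shrinks below it, so [W]
       has to follow the state alone and is replaced by [d W] in each turn. *)
    move=> leW; move: {2 3}(weight l) (leqnn (weight l)) leW => M.
    elim: l s W {N} => [|u _ l IH] s W //= leM leW; first lia.
    have leW' : 1 + M + weight (eval f (Nd u s)) <= d W.
      have := weight_eval f (Nd u s); have := Hf (Nd u s).
      have : bf (weight (Nd u s)) <= bf W by apply: Gf.1; rewrite /=; lia.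
      by rewrite /d /=; lia.
    have := IH (eval f (Nd u s)) (d W) (ltac:(lia)) leW'.
    have step : 40 * ((weight u + weight l).+1 + weight s + weight (eval f (Nd u s)))
      + cost f (Nd u s) <= 121 * d W.
      have := Hf (Nd u s); have : bf (weight (Nd u s)) <= bf W by apply: Gf.1; rewrite /=; lia.
      have := infl W; move: leW'; rewrite /d /=; lia.
    rewrite -iterSr => IH'.
    have L1 : d W <= iter (weight u + weight l).+1 d W.
      by rewrite -[d W]/(iter 1 d W); apply: leq_iter.
    have L2 : iter (weight l).+1 d W <= iter (weight u + weight l).+1 d W.
      by apply: leq_iter => //; lia.
    have L3 := leq_mul (leqnn (weight l)) (leq_mul (leqnn 121) L2).
    rewrite [iter _.+1 d W]/= in L1; rewrite [iter (_ + _).+1 d W]/= in L2 L3; set A := d (iter (weight u + weight l) d W) in L1 L2 L3 *; set B := iter (weight l).+1 d W in L2 L3 IH' *.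
    move: A B L1 L2 L3 IH' step; clear => A B L1 L2 L3 IH' step.
    rewrite (mulSn (weight u + weight l)) (mulnDl (weight u)); lia.
  have NE : N = (weight l + weight s).+1 by [].
  apply: leq_trans (aux (2 * N + 1) _) _; first lia.
  rewrite leq_add2r; apply: leq_mul; first lia.
  by rewrite leq_mul2l; apply: leq_iter => //; lia.
Qed.

(** * Fixed-parameter tractable functions *)

Definition fpt X `{Enc X} (dom : X -> Prop) (prm : X -> nat) (g : X -> nat) : Prop :=
  exists b d, growth b /\ forall x, dom x -> g x <= b (prm x) * esize x ^ d.

Section Bounds.

Context {X : Type} `{Enc X}.
Variables (dom : X -> Prop) (prm : X -> nat).

Lemma esize_gt0 (x : X) : 0 < esize x. Proof. exact: weight_gt0. Qed.

Lemma fpt_le g h : (forall x, dom x -> g x <= h x) -> fpt dom prm h -> fpt dom prm g.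
Proof.
move=> le [b [d [gb B]]]; exists b, d; split=> // x dx.
exact: leq_trans (le x dx) (B x dx).
Qed.

Lemma fpt_growth b : growth b -> fpt dom prm (fun x => b (prm x)).
Proof. by move=> gb; exists b, 0; split=> // x _; rewrite muln1. Qed.

Lemma fpt_const k : fpt dom prm (fun _ => k).
Proof. exact: fpt_growth (growth_const k). Qed.

Lemma fpt_esize : fpt dom prm (fun x => esize x).
Proof. by exists (fun _ => 1), 1; split=> [|x _]; [exact: growth_const | rewrite mul1n expn1]. Qed.

Lemma fpt_add g h : fpt dom prm g -> fpt dom prm h -> fpt dom prm (fun x => g x + h x).
Proof.
move=> [b [d [gb B]]] [c [e [gc C]]]; exists (fun n => b n + c n), (d + e).
split=> [|x dx]; first exact: growth_add.
have s0 := esize_gt0 x.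
rewrite mulnDl expnD leq_add //.
  by apply: leq_trans (B x dx) _; rewrite leq_mul2l leq_pmulr ?expn_gt0 ?s0 ?orbT.
by apply: leq_trans (C x dx) _; rewrite leq_mul2l leq_pmull ?expn_gt0 ?s0 ?orbT.
Qed.

Lemma fpt_mul g h : fpt dom prm g -> fpt dom prm h -> fpt dom prm (fun x => g x * h x).
Proof.
move=> [b [d [gb B]]] [c [e [gc C]]]; exists (fun n => b n * c n), (d + e).
split=> [|x dx]; first exact: growth_mul.
by rewrite expnD mulnACA leq_mul ?B ?C.
Qed.

Lemma fpt_exp g k : fpt dom prm g -> fpt dom prm (fun x => g x ^ k).
Proof.
move=> Fg; elim: k => [|k IH]; first exact: fpt_const.
by apply: fpt_le (fpt_mul Fg IH) => x _; rewrite expnS.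
Qed.

End Bounds.

Lemma fpt_comp X Y `{Enc X} `{Enc Y} dom prm dom' prm' (G : X -> Y) g c :
  fpt dom' prm' g -> growth c -> (forall x, dom x -> dom' (G x)) ->
  (forall x, dom x -> prm' (G x) <= c (prm x)) -> fpt dom prm (fun x => esize (G x)) ->
  fpt dom prm (fun x => g (G x)).
Proof.
move=> [b [d [gb B]]] gc D P FG.
apply: (fpt_le (h := fun x => b (c (prm x)) * esize (G x) ^ d)) => [x dx|].
  by apply: leq_trans (B _ (D x dx)) _; rewrite leq_mul2r gb.1 ?orbT ?P.
by apply: fpt_mul; [apply: fpt_growth (growth_comp gb gc) | apply: fpt_exp].
Qed.

(** Correctness is demanded on all inputs, since programs are total; only the cost may rely on
    [dom]. Invariants of the data thus enter the time bounds and nothing else. *)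
Definition FC X T `{Enc X} `{Enc T} (dom : X -> Prop) (prm : X -> nat) (F : X -> T) : Prop :=
  exists2 c, forall x, eval c (enc x) = enc (F x) & fpt dom prm (fun x => cost c (enc x)).

Lemma esize_cat A `{Enc A} (s t : seq A) : (esize (s ++ t)).+1 = esize s + esize t.
Proof. by elim: s => // a s IH; rewrite cat_cons !enc_cons /=; lia. Qed.

Lemma size_esize A `{Enc A} (s : seq A) : size s <= esize s.
Proof. by elim: s => // a s IH; rewrite enc_cons /=; lia. Qed.

Section Closure.

Context {X : Type} `{Enc X}.
Variables (dom : X -> Prop) (prm : X -> nat).

Lemma FC_ext T `{Enc T} (F G : X -> T) : FC dom prm F -> F =1 G -> FC dom prm G.
Proof. by move=> [c E B] FG; exists c => // x; rewrite E FG. Qed.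

Lemma FC_esize T `{Enc T} (F : X -> T) : FC dom prm F -> fpt dom prm (fun x => esize (F x)).
Proof.
move=> [c E B]; apply: fpt_le (fpt_add (fpt_esize _ _) B) => x _.
by rewrite -E weight_eval.
Qed.

Lemma FC_id : FC dom prm (fun x => x).
Proof. by exists CId => //; exact: fpt_const. Qed.

Lemma FC_const T `{Enc T} (t : T) : FC dom prm (fun _ => t).
Proof.
have [c E B] : exists2 c, forall x : X, eval c (enc x) = enc t & fpt dom prm (fun x => cost c (enc x)).
  elim: (enc t) => [|a [c E B] b [d E' B']].
    by exists CLeaf => //; exact: fpt_mul (fpt_const _ _ 40) (fpt_esize _ _).
  exists (CPair c d) => [x|]; first by rewrite /= E E'.
  apply: fpt_le (fpt_add (fpt_add B' B) (fpt_mul (fpt_const _ _ 40)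
    (fpt_add (fpt_esize _ _) (fpt_const _ _ (weight b))))) => x _ /=.
  by rewrite E'.
by exists c.
Qed.

Lemma FC_pair A B `{Enc A} `{Enc B} (F : X -> A) (G : X -> B) :
  FC dom prm F -> FC dom prm G -> FC dom prm (fun x => (F x, G x)).
Proof.
move=> [c E Bc] FG; have := FC_esize FG; case: FG => [d E' Bd] Bs.
exists (CPair c d) => [x|]; first by rewrite /= E E'.
apply: fpt_le (fpt_add (fpt_add Bd Bc) (fpt_mul (fpt_const _ _ 40)
    (fpt_add (fpt_esize _ _) Bs))) => x _ /=.
by rewrite E'.
Qed.

Lemma FC_cons A `{Enc A} (F : X -> A) (G : X -> seq A) :
  FC dom prm F -> FC dom prm G -> FC dom prm (fun x => F x :: G x).
Proof. by move=> FF FG; have [c E B] := FC_pair FF FG; exists c. Qed.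

Lemma FC_post T U `{Enc T} `{Enc U} (k : code) (h : T -> U) (F : X -> T) :
  (forall t, eval k (enc t) = enc (h t)) -> (forall t, cost k t <= 40 * weight t) ->
  FC dom prm F -> FC dom prm (fun x => h (F x)).
Proof.
move=> kE kC FF; have := FC_esize FF; case: FF => [c E B] Bs.
exists (CComp k c) => [x|]; first by rewrite /= E kE.
apply: fpt_le (fpt_add B (fpt_mul (fpt_const _ _ 40) Bs)) => x _ /=.
by rewrite leq_add2l E.
Qed.

Lemma FC_fst A B `{Enc A} `{Enc B} (F : X -> A * B) :
  FC dom prm F -> FC dom prm (fun x => (F x).1).
Proof. exact: (FC_post (k := CFst)). Qed.

Lemma FC_snd A B `{Enc A} `{Enc B} (F : X -> A * B) :
  FC dom prm F -> FC dom prm (fun x => (F x).2).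
Proof. exact: (FC_post (k := CSnd)). Qed.

Lemma FC_behead A `{Enc A} (F : X -> seq A) :
  FC dom prm F -> FC dom prm (fun x => behead (F x)).
Proof. by apply: (FC_post (k := CSnd)) => //; case. Qed.

Lemma FC_headb (F : X -> seq bool) : FC dom prm F -> FC dom prm (fun x => head false (F x)).
Proof. by apply: (FC_post (k := CFst)) => //; case. Qed.

Lemma FC_if T `{Enc T} (b : X -> bool) (F G : X -> T) :
  FC dom prm b -> FC dom prm F -> FC dom prm G ->
  FC dom prm (fun x => if b x then F x else G x).
Proof.
move=> Fb [c E Bc] [d E' Bd]; have := FC_esize Fb; case: Fb => [a Ea Ba] Bs.
exists (CIf a c d) => [x|]; first by rewrite /= Ea; case: (b x); [apply: E | apply: E'].
apply: fpt_le (fpt_add (fpt_add Ba (fpt_mul (fpt_const _ _ 40) (fpt_add (fpt_esize _ _) Bs)))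
  (fpt_add Bc Bd)) => x _ /=.
by rewrite Ea leq_add2l; case: (b x); rewrite ?leq_addr ?leq_addl.
Qed.

Lemma FC_comp Y T `{Enc Y} `{Enc T} dom' prm' (F : Y -> T) (G : X -> Y) c :
  FC dom' prm' F -> growth c -> (forall x, dom x -> dom' (G x)) ->
  (forall x, dom x -> prm' (G x) <= c (prm x)) -> FC dom prm G ->
  FC dom prm (fun x => F (G x)).
Proof.
move=> [k E Bk] gc D P FG; have := FC_esize FG; case: FG => [l E' Bl] Bs.
exists (CComp k l) => [x|]; first by rewrite /= E' E.
apply: fpt_le (fpt_add Bl (fpt_comp Bk gc D P Bs)) => x _ /=.
by rewrite E'.
Qed.

(** The bridge from [CF] to [FC]: by [cost_growth], every program is admissible when the size of its
    argument is itself taken as the parameter. *)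
Lemma FC_small Y T `{Enc Y} `{Enc T} (F : Y -> T) (G : X -> Y) c :
  CF F -> growth c -> (forall x, dom x -> esize (G x) <= c (prm x)) -> FC dom prm G ->
  FC dom prm (fun x => F (G x)).
Proof.
move=> [k E] gc P FG.
apply: (FC_comp (dom' := fun _ => True) (prm' := fun y => esize y) _ gc) => //.
exists k => //; have [b [gb Hb]] := cost_growth k.
exists b, 0; split=> // y _; rewrite muln1; exact: Hb.
Qed.

(** A polynomial bound composed with itself once per element need not be polynomial. The sizes of
    all intermediate states must therefore be bounded beforehand, by [B], and the step need only be
    cheap on states that a prefix of the list produces. *)
Lemma FC_foldl S A `{Enc S} `{Enc A} (f : X -> S -> A -> S) s (l : X -> seq A)
    (dom' : A * (X * S) -> Prop) (B : X -> nat) :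
  FC dom' (fun q => prm q.2.1) (fun q => f q.2.1 q.2.2 q.1) ->
  FC dom prm s -> FC dom prm l -> fpt dom prm B ->
  (forall x l1 a l2, dom x -> l x = l1 ++ a :: l2 -> dom' (a, (x, foldl (f x) (s x) l1))) ->
  (forall x l1 l2, dom x -> l x = l1 ++ l2 -> esize (foldl (f x) (s x) l1) <= B x) ->
  FC dom prm (fun x => foldl (f x) (s x) (l x)).
Proof.
move=> [cf Ef [b [d [gb Hb]]]] Fs Fl FB D W.
have Ss := FC_esize Fs; have Sl := FC_esize Fl.
case: Fs Fl => [cs Es Bs] [cl El Bl].
exists (fold_code cl cs cf).
  move=> x; rewrite /fold_code -[eval _ _]/(eval CSnd (titer (eval (CPair (CComp CFst CSnd) cf))
    (eval cl (enc x)) (Nd (enc x) (eval cs (enc x))))).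
  rewrite El Es (@eval_fold _ _ _ _ (f x)) // => a t; exact: (Ef (a, (x, t))).
pose L x := weight (@enc _ (@enc_seq _ H1) (l x)).
(* [N] bounds all data handled in one turn, and [K] below bounds the cost of one turn. *)
pose N x := 10 * (weight (@enc _ H x) + L x + B x).
pose K x := 200 * N x + b (prm x) * N x ^ d.
have FN : fpt dom prm N by do ![assumption | exact: fpt_const | exact: fpt_esize | apply: fpt_mul | apply: fpt_add].
have FK : fpt dom prm K.
  apply: fpt_add; first exact: fpt_mul (fpt_const _ _ _) FN.
  exact: fpt_mul (fpt_growth _ _ gb) (fpt_exp _ FN).
apply: (fpt_le (h := fun x => cost cl (enc x) + cost cs (enc x) + esize (l x) * K x
  + 1000 * (esize x + esize (l x) + esize (s x) + B x + 1))); last first.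
  do ![assumption | exact: fpt_const | exact: fpt_esize | apply: fpt_mul | apply: fpt_add].
move=> x dx; rewrite /fold_code.
have loop : itcost (eval (CPair (CComp CFst CSnd) cf)) (cost (CPair (CComp CFst CSnd) cf))
    (enc (l x)) (Nd (enc x) (enc (s x))) <= size (l x) * K x + 40.
  pose Q l1 l2 := itcost (eval (CPair (CComp CFst CSnd) cf)) (cost (CPair (CComp CFst CSnd) cf))
    (@enc _ (@enc_seq _ H1) l2) (Nd (@enc _ H x) (@enc _ H0 (foldl (f x) (s x) l1))) <= size l2 * K x + 40.
  have: forall l1 l2, l x = l1 ++ l2 -> Q l1 l2; last by move=> /(_ [::] (l x) erefl).
  move=> l1 l2; elim: l2 l1 => [|a l2 IH] l1 lE; first by [].
  have := IH (rcons l1 a); rewrite cat_rcons => /(_ lE); rewrite /Q.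
  have := W x l1 _ dx lE; have := W x (rcons l1 a) l2 dx; rewrite cat_rcons => /(_ lE).
  have dq := D x l1 a l2 dx lE.
  rewrite -cats1 foldl_cat [foldl _ _ [:: a]]/=; set t := foldl _ _ l1 in dq *.
  have Et : eval cf (Nd (enc a) (Nd (enc x) (enc t))) = enc (f x t a) by exact: (Ef (a, (x, t))).
  have Hc : cost cf (Nd (enc a) (Nd (enc x) (enc t)))
      <= b (prm x) * weight (Nd (enc a) (Nd (enc x) (enc t))) ^ d by exact: (Hb _ dq).
  move=> W1 W2.
  rewrite enc_cons /= Et => IH'.
  have leN : weight (enc a) + weight (enc l2) + esize x + esize t + esize (f x t a) + 10 <= N x.
    have : weight (enc a) + weight (enc l2) < esize (l x).
      by have := @esize_cat _ H1 l1 (a :: l2); have := weight_gt0 (@enc _ (@enc_seq _ H1) l1); rewrite -lE enc_cons /=; lia.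
    rewrite /N /L; have := weight_gt0 (@enc _ H x); lia.
  have {}Hc : cost cf (Nd (enc a) (Nd (enc x) (enc t))) <= b (prm x) * N x ^ d.
    apply: leq_trans Hc _; rewrite leq_mul2l; apply/orP; right.
    have [->|d0] := posnP d; first by rewrite !expn0.
    by rewrite leq_exp2r //=; lia.
  rewrite mulSn /K; rewrite /K in IH'; lia.
have sl := @size_esize _ H1 (l x).
have Wl := W x (l x) [::] dx; rewrite cats0 in Wl; have {}Wl := Wl erefl.
have slK := leq_mul sl (leqnn (K x)).
have costE : cost (fold_code cl cs cf) (enc x) <=
    cost cl (enc x) + cost cs (enc x) + size (l x) * K x
    + 200 * (esize x + esize (l x) + esize (s x) + esize (foldl (f x) (s x) (l x)) + 1).
  have Ev := @eval_fold A S H1 H0 (f x) cf (enc x) (l x) (s x) (fun a t => Ef (a, (x, t))).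
  rewrite /fold_code.
  rewrite -[cost _ _]/((cost cs (enc x) + 0 + 40 * (esize x + weight (eval cs (enc x))))
    + cost cl (enc x) + 40 * (esize x + weight (Nd (enc x) (eval cs (enc x))))
    + (40 * weight (Nd (eval cl (enc x)) (Nd (enc x) (eval cs (enc x))))
       + itcost (eval (CPair (CComp CFst CSnd) cf)) (cost (CPair (CComp CFst CSnd) cf))
           (eval cl (enc x)) (Nd (enc x) (eval cs (enc x))))
    + 40 * weight (titer (eval (CPair (CComp CFst CSnd) cf)) (eval cl (enc x))
             (Nd (enc x) (eval cs (enc x))))).
  rewrite El Es Ev; move: loop; set I := itcost _ _ _ _ => loop; rewrite /=; lia.
by apply: leq_trans costE _; lia.
Qed.

End Closure.

(** * Parsing *)

Notation poly F := (FC (fun _ => True) (fun _ => 0) F).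

Lemma poly_FC X Y T `{Enc X} `{Enc Y} `{Enc T} dom prm (F : Y -> T) (G : X -> Y) :
  poly F -> FC dom prm G -> FC dom prm (fun x => F (G x)).
Proof.
move=> PF FG; apply: (@FC_comp _ _ _ _ _ _ _ _ (fun _ => True) (fun _ => 0) F G (fun _ => 0)) => //.
exact: growth_const.
Qed.

Lemma esize_pair A B `{Enc A} `{Enc B} (a : A) (b : B) : esize (a, b) = (esize a + esize b).+1.
Proof. by []. Qed.

Section Parsers.

Context {A B : Type} `{Enc A} `{Enc B}.

Definition parses T (p : seq bool -> A * seq bool) (e : T -> seq bool) (g : T -> A) : Prop :=
  forall x r, p (e x ++ r) = (g x, r).

(* The linear tradeoff between output and consumed input keeps iterated parsers
   polynomial. *)
Definition tame (p : seq bool -> A * seq bool) : Prop :=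
  poly p /\ exists w c, forall r,
    size (p r).2 <= size r /\ weight (enc (p r).1) + w * size (p r).2 <= w * size r + c.

(** The only loop available is a fold over a given list, so the parser takes as many steps as the
    input has bits. That is enough, since every step before the end consumes a marker; the flag
    makes the remaining steps idle. *)
Definition plist_step (p : seq bool -> A * seq bool) (st : (seq A * seq bool) * bool) :=
  if st.2 then st
  else if head false st.1.2
       then let q := p (behead st.1.2) in ((q.1 :: st.1.1, q.2), false)
       else ((st.1.1, behead st.1.2), true).

Definition plist p (s : seq bool) : seq A * seq bool :=
  let st := foldl (fun st _ => plist_step p st) (([::], s), false) s in
  (rev st.1.1, st.1.2).

Lemma esize_bits (r : seq bool) : size r <= esize r <= 4 * size r + 1.
Proof. by elim: r => // b r IH; rewrite enc_cons /=; case: b => /=; lia. Qed.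

End Parsers.

Lemma foldl_iter S A (f : S -> S) s (l : seq A) : foldl (fun s _ => f s) s l = iter (size l) f s.
Proof. by elim: l s => //= a l IH s; rewrite IH -iterSr. Qed.

Lemma plist_parses A T p (e : T -> seq bool) (g : T -> A) :
  parses p e g -> parses (plist p) (enc_list e) (map g).
Proof.
move=> P xs r; rewrite /plist foldl_iter.
have done_ acc r' n : iter n (plist_step p) ((acc, r'), true) = ((acc, r'), true).
  by elim: n => //= n ->.
have key n acc : size xs < n -> iter n (plist_step p) ((acc, enc_list e xs ++ r), false)
    = ((catrev (map g xs) acc, r), true).
  elim: xs n acc => [|x xs IH] [|n] acc // lt; rewrite iterSr; first by rewrite done_.
  have -> : enc_list e (x :: xs) ++ r = true :: e x ++ (enc_list e xs ++ r).
    by rewrite /enc_list /= -!catA.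
  by rewrite {2}/plist_step /= P /= IH.
rewrite key ?revK // size_cat ltn_addr // /enc_list size_cat addn1 ltnS.
by elim: xs {key} => //= x xs IH; rewrite size_cat; lia.
Qed.

Lemma esize_rev A `{Enc A} (s : seq A) : esize (rev s) = esize s.
Proof.
rewrite /rev; have E t : (esize (catrev s t)).+1 = esize s + esize t.
  elim: s t => // a s IH t; rewrite IH !enc_cons /=; lia.
have e0 : weight (@enc (seq A) _ [::]) = 1 by [].
by have := E [::]; rewrite e0; lia.
Qed.

Lemma poly_rev A `{Enc A} : poly (fun s : seq A => rev s).
Proof.
apply: (FC_ext (F := fun s => foldl (fun t a => a :: t) [::] s)); last first.
  by move=> s; rewrite /rev; elim: s [::] => //= a s IH t; rewrite IH.
apply: (FC_foldl (f := fun _ t a => a :: t) (dom' := fun _ => True) (B := fun s => esize s)) => //.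
- exact: FC_cons (FC_fst (FC_id _ _)) (FC_snd (FC_snd (FC_id _ _))).
- exact: FC_const.
- exact: FC_id.
- exact: fpt_esize.
- move=> s l1 l2 _ ->.
  have -> : foldl (fun t a => a :: t) [::] l1 = rev l1.
    by rewrite /rev; elim: l1 [::] => //= a l IH t; rewrite IH.
  rewrite esize_rev; have := @esize_cat _ H l1 l2; have := weight_gt0 (@enc _ (@enc_seq _ H) l2).
  by lia.
Qed.

(** The marker bit in front of an item pays for the constant [c] of the item parser and for the new
    list cell. This is why the slope rises from [w] to [w + c + 1] while the additive constant stays
    1. *)
Lemma plist_tame A `{Enc A} (p : seq bool -> A * seq bool) : tame p -> tame (plist p).
Proof.
move=> [Pp [w [c Hp]]].
have inv s n (st := iter n (plist_step p) (([::], s), false)) :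
    size st.1.2 <= size s /\ weight (@enc _ (@enc_seq _ H) st.1.1) + (w + c + 1) * size st.1.2 <= (w + c + 1) * size s + 1.
  rewrite {}/st; elim: n => [|n [IH1 IH2]]; first by rewrite /=; lia.
  rewrite iterS; move: (iter n _ _) IH1 IH2 => [[acc r] b]; rewrite /plist_step /=.
  case: b; first by [].
  case: r => [|[] r] /=; rewrite ?enc_cons; try by lia.
  have [h1 h2] := Hp r => IH1 IH2; split; first lia.
  rewrite /=; have := leq_mul (leqnn (c + 1)) h1; rewrite -[weight (enc_seq acc)]/(esize acc); lia.
split; last first.
  exists (w + c + 1), 1 => s; rewrite /plist foldl_iter /= esize_rev; exact: inv.
have step : poly (fun q : seq A * seq bool * bool => plist_step p q).
  apply: FC_if; first exact: FC_snd (FC_id _ _).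
    exact: FC_id.
  apply: FC_if; first exact: FC_headb (FC_snd (FC_fst (FC_id _ _))).
    have Q : poly (fun q : seq A * seq bool * bool => p (behead q.1.2)).
      by apply: poly_FC Pp _; exact: FC_behead (FC_snd (FC_fst (FC_id _ _))).
    apply: FC_pair; last exact: FC_const.
    apply: FC_pair; last exact: FC_snd Q.
    exact: FC_cons (FC_fst Q) (FC_fst (FC_fst (FC_id _ _))).
  apply: FC_pair; last exact: FC_const.
  by apply: FC_pair; [exact: FC_fst (FC_fst (FC_id _ _)) |
    exact: FC_behead (FC_snd (FC_fst (FC_id _ _)))].
have loop : poly (fun s : seq bool => foldl (fun st _ => plist_step p st) (([::], s), false) s).
  apply: (FC_foldl (f := fun _ st _ => plist_step p st) (dom' := fun _ => True)
    (B := fun s => (w + c + 10) * esize s + 10)) => //.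
  - by apply: poly_FC step _; exact: FC_snd (FC_snd (FC_id _ _)).
  - by do !apply: FC_pair; [exact: FC_const | exact: FC_id | exact: FC_const].
  - exact: FC_id.
  - by do ![exact: fpt_const | exact: fpt_esize | apply: fpt_mul | apply: fpt_add].
  - move=> s l1 l2 _ sE; rewrite foldl_iter; have [] := inv s (size l1).
    case: (iter _ _ _) => [[acc r] b]; rewrite !esize_pair [((acc, r), b).1]/= [(acc, r).1]/= [(acc, r).2]/=.
    have /andP[_ E1] := esize_bits r; have /andP[E2 _] := esize_bits s.
    have := leq_mul (leqnn (w + c + 1)) E2.
    by have : weight (@enc _ enc_bool b) <= 3; [case: (b) | lia].
apply: FC_pair; last exact: FC_snd (FC_fst loop).
exact: (poly_FC (@poly_rev A H) (FC_fst (FC_fst loop))).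
Qed.

Definition pbit (s : seq bool) : bool * seq bool := (head false s, behead s).

Lemma pbit_tame : tame pbit.
Proof.
split; first by apply: FC_pair; [exact: FC_headb (FC_id _ _) | exact: FC_behead (FC_id _ _)].
by exists 0, 3 => r; rewrite /pbit /=; split; [rewrite size_behead; lia | case: r => [|[] r]].
Qed.

Lemma pbit_parses : parses pbit (fun b => [:: b]) id.
Proof. by []. Qed.

Definition pseq A B (p : seq bool -> A * seq bool) (q : seq bool -> B * seq bool) s :=
  let u := p s in let v := q u.2 in ((u.1, v.1), v.2).

Lemma pseq_parses A B T U p q (e : T -> seq bool) (g : T -> A) (e' : U -> seq bool) (g' : U -> B) :
  parses p e g -> parses q e' g' ->
  parses (pseq p q) (fun x => e x.1 ++ e' x.2) (fun x => (g x.1, g' x.2)).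
Proof. by move=> P Q [x y] r; rewrite /pseq -catA P Q. Qed.

Lemma pseq_tame A B `{Enc A} `{Enc B} (p : seq bool -> A * seq bool) (q : seq bool -> B * seq bool) :
  tame p -> tame q -> tame (pseq p q).
Proof.
move=> [P [w [c Hp]]] [Q [w' [c' Hq]]]; split.
  have R : poly (fun s => q (p s).2) by apply: poly_FC Q _; exact: FC_snd P.
  by apply: FC_pair; [apply: FC_pair; [exact: FC_fst P | exact: FC_fst R] | exact: FC_snd R].
exists (w + w'), (c + c' + 1) => r; have [h1 h2] := Hp r; have [h3 h4] := Hq (p r).2.
rewrite /pseq; split; first by rewrite /=; lia.
rewrite [((_, _), _).1]/= [((_, _), _).2]/= esize_pair.
have := leq_mul (leqnn w) h3; have := leq_mul (leqnn w') h1; lia.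
Qed.

Definition pret A (a : A) (s : seq bool) := (a, s).

Lemma pret_tame A `{Enc A} (a : A) : tame (pret a).
Proof.
split; first by apply: FC_pair; [exact: FC_const | exact: FC_id].
by exists 0, (esize a) => r; rewrite /= !mul0n addn0 add0n.
Qed.

Definition pnat := plist pbit.

Lemma pnat_parses : parses pnat enc_nat bits.
Proof.
move=> n r; have := plist_parses pbit_parses (bits n) r; rewrite map_id; exact.
Qed.

Lemma pnat_tame : tame pnat. Proof. exact: plist_tame pbit_tame. Qed.

Definition pvote := plist pnat.

Lemma pvote_parses : parses pvote enc_vote (map bits).
Proof. exact: plist_parses pnat_parses. Qed.

Lemma pvote_tame : tame pvote. Proof. exact: plist_tame pnat_tame. Qed.

Definition item := (seq (seq bool) * seq bool)%type.

(** In both models an item becomes a vote with a binary multiplicity, least significant bit first. A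
    nonsuccinct vote receives the multiplicity 1 without consuming input. *)
Definition pitem (succinct : bool) : seq bool -> item * seq bool :=
  if succinct then pseq pvote pnat else pseq pvote (pret [:: true]).

Lemma pitem_tame b : tame (pitem b).
Proof.
by case: b; apply: pseq_tame; [exact: pvote_tame | exact: pnat_tame | exact: pvote_tame
  | exact: pret_tame].
Qed.

Definition pinstance b := pseq pnat (pseq (plist (pitem b)) (pseq pnat pnat)).

Lemma pinstance_tame b : tame (pinstance b).
Proof.
do !apply: pseq_tame; try exact: pnat_tame.
exact: plist_tame (pitem_tame b).
Qed.

Lemma pinstance_s x : (pinstance true (s_enc x)).1 =
  (bits (s_m x), ([seq (map bits vn.1, bits vn.2) | vn <- s_votes x], (bits (s_p x), bits (s_k x)))).
Proof.
have P := pseq_parses pnat_parses (pseq_parses (plist_parses (pseq_parses pvote_parses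
  pnat_parses)) (pseq_parses pnat_parses pnat_parses)).
have := P (s_m x, (s_votes x, (s_p x, s_k x))) [::]; rewrite cats0 => E.
exact: (congr1 fst E).
Qed.

Lemma pinstance_ns x : (pinstance false (ns_enc x)).1 =
  (bits (ns_m x), ([seq (map bits v, [:: true]) | v <- ns_votes x], (bits (ns_p x), bits (ns_k x)))).
Proof.
have Q : parses (pitem false) enc_vote (fun v => (map bits v, [:: true])).
  by move=> v r; rewrite /pitem /pseq pvote_parses.
have P := pseq_parses pnat_parses (pseq_parses (plist_parses Q)
  (pseq_parses pnat_parses pnat_parses)).
have := P (ns_m x, (ns_votes x, (ns_p x, ns_k x))) [::]; rewrite cats0 => E.
exact: (congr1 fst E).
Qed.

(** * The algorithm *)

Definition natval (s : seq bool) : nat := foldr (fun b n => nat_of_bool b + (n + n)) 0 s.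

Definition words T (A : seq T) (k : nat) : seq (seq T) :=
  iter k (fun ws => flatten [seq [seq a :: w | w <- ws] | a <- A]) [:: [::]].

Definition votes (m : nat) : seq (seq nat) := filter uniq (words (iota 0 m) m).

Definition quads (m : nat) : seq (seq nat) := words (iota 0 m) 4.

(* Coordinates: the given counts [n_v], the unknown counts [y_v] after bribery, the
   unknown numbers [a_v] bounding the votes removed, and the budget [k]. *)
Definition vec (n y a : seq nat) (k : nat) : seq nat := n ++ y ++ a ++ [:: k].

Definition fill (m k : nat) : seq nat := [seq k | _ <- votes m].

(* A form [(P, N)] stands for the inequality [N <= P]. *)
Definition linform := (seq nat * seq nat)%type.

Definition removal_forms (m : nat) : seq linform :=
  [seq let e := [seq nat_of_bool (w == v) | w <- votes m] in
       (vec (fill m 0) e e 0, vec e (fill m 0) (fill m 0) 0) | v <- votes m].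

Definition budget_forms (m : nat) : seq linform :=
  let z := fill m 0 in let o := fill m 1 in
  [:: (vec z z z 1, vec z z o 0); (vec z o z 0, vec o z z 0); (vec o z z 0, vec z o z 0)].

Definition pair_pref (v : seq nat) (c d c' d' : nat) : nat :=
  nat_of_bool (prefers v c d) + nat_of_bool (prefers v d' c').

(* The form of the quadruple [c, d, c', d'] says [D(c', d') <= D(c, d)]. *)
Definition majority_forms (m : nat) : seq linform :=
  [seq let z := fill m 0 in
       let c := nth 0 q 0 in let d := nth 0 q 1 in
       let c' := nth 0 q 2 in let d' := nth 0 q 3 in
       (vec z [seq pair_pref v c d c' d' | v <- votes m] z 0,
        vec z [seq pair_pref v d c d' c' | v <- votes m] z 0) | q <- quads m].

Definition forms (m : nat) : seq linform :=
  removal_forms m ++ budget_forms m ++ majority_forms m.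

(** A common bound B for the absolute value of every carry: one position contributes at most B in
    absolute value, and half the sum of two numbers in [-B, B] stays there. *)
Definition offset (m : nat) : nat := sumn [seq sumn f.1 + sumn f.2 | f <- forms m].

Definition dot (c z : seq nat) : nat := sumn [seq p.1 * p.2 | p <- zip c z].

(* A state carries, for every form, the carry shifted by [offset m] so that it is
   a natural number. *)
Definition carry (B : nat) (fs : seq linform) (u z : seq nat) : seq nat :=
  [seq (p.1 + B + dot p.2.1 z - dot p.2.2 z)./2 | p <- zip u fs].

Definition states (m : nat) : seq (seq nat) :=
  words (iota 0 (offset m + offset m).+1) (size (forms m)).

Definition guesses (m : nat) : seq (seq nat) :=
  words [:: 0; 1] (size (votes m) + size (votes m)).

Definition digits (m : nat) (O : seq (seq nat)) (z : seq nat) (kb : bool) : seq nat :=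
  [seq nat_of_bool (v \in O) | v <- votes m] ++ z ++ [:: nat_of_bool kb].

(** Filtering the table of all states, rather than collecting successors, removes duplicates. A
    collected list would be multiplied by the number of guesses in every round. *)
Definition step (m : nat) (O : seq (seq nat)) (kb : bool) (R : seq (seq nat)) : seq (seq nat) :=
  [seq u' <- states m | has (fun u => has (fun z =>
     carry (offset m) (forms m) u (digits m O z kb) == u') (guesses m)) R].

Definition start (m : nat) : seq (seq nat) := [:: [seq offset m | _ <- forms m]].

Definition geq_D (m : nat) (s : seq bool) (c d c' d' : nat) : bool :=
  nth false (drop (size (votes m) + 3) s) (index [:: c; d; c'; d'] (quads m)).

Definition edges (c : nat) (s : seq nat) : seq (nat * nat) := zip (c :: s) s.

Definition paths (m c d : nat) : seq (seq nat) :=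
  [seq s <- flatten [seq words (iota 0 m) l | l <- iota 0 m.+1] |
   [&& ~~ nilp s, last c s == d, uniq (c :: s) & all (fun x => x < m) (c :: s)]].

(** The strength of [t] is at most that of [p] iff some edge of [t] weighs at most every edge of
    [p]. Hence comparisons between single edge weights suffice. *)
Definition winner (m : nat) (s : seq bool) (c : nat) : bool :=
  all (fun d => (d == c) || has (fun p => all (fun t =>
    has (fun e' => all (fun e => geq_D m s e.1 e.2 e'.1 e'.2) (edges c p)) (edges d t))
    (paths m d c)) (paths m c d)) (iota 0 m).

Definition verdict (constructive unique : bool) (m p : nat) (s : seq bool) : bool :=
  let w := winner m s p &&
    (if unique then all (fun d => (d == p) || ~~ winner m s d) (iota 0 m) else true) in
  if constructive then w else ~~ w.

Definition accepts (constructive unique : bool) (m p : nat) (R : seq (seq nat)) : bool :=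
  has (fun u => let s := [seq offset m <= x | x <- u] in
    all (fun i => nth false s i) (iota 0 (size (votes m) + 3))
    && verdict constructive unique m p s) R.

Definition vote_of (raw : seq (seq bool)) : seq nat := [seq natval c | c <- raw].

(** The set of votes met an odd number of times so far, with multiplicities taken modulo 2. As a
    sublist of [votes m] it stays small. *)
Definition toggle (m : nat) (O : seq (seq nat)) (v : seq nat) (b : bool) : seq (seq nat) :=
  [seq w <- votes m | (b && (w == v)) (+) (w \in O)].

(* In the nonsuccinct case every second voter with the same vote survives a pass. *)
Definition next_item (succinct : bool) (O : seq (seq nat)) (it : item) : item :=
  (it.1, if succinct then behead it.2
         else if head false it.2 && (vote_of it.1 \in O) then [:: true] else [::]).

Definition item_step (succinct : bool) (m : nat) (st : seq (seq nat) * seq item) (it : item) :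
    seq (seq nat) * seq item :=
  (toggle m st.1 (vote_of it.1) (head false it.2), next_item succinct st.1 it :: st.2).

Definition pass succinct m (its : seq item) : seq (seq nat) * seq item :=
  foldl (item_step succinct m) ([::], [::]) its.

Definition progress := (seq item * (seq bool * seq (seq nat)))%type.

Definition round succinct m (st : progress) : progress :=
  let q := pass succinct m st.1 in
  (q.2, (behead st.2.1, step m q.1 (head false st.2.1) st.2.2)).

(** The last component, the raw input, acts only as a clock: one round per input bit shifts out all
    bits of the counts and of the budget. *)
Definition rounds succinct (y : nat * (seq item * (seq bool * (seq bool * seq bool)))) : progress :=
  foldl (fun st _ => round succinct y.1 st) (y.2.1, (y.2.2.1, start y.1)) y.2.2.2.2.

Definition prepare succinct (x : seq bool) :=
  let P := (pinstance succinct x).1 in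
  (natval P.1, (P.2.1, (P.2.2.2, (P.2.2.1, x)))).

Definition decide succinct constructive unique (x : seq bool) : bool :=
  let y := prepare succinct x in
  accepts constructive unique y.1 (natval y.2.2.2.1) (rounds succinct y).2.2.

(** * Complexity of the algorithm *)

Lemma CF_nat_of_bool X `{Enc X} (b : X -> bool) : CF b -> CF (fun x => nat_of_bool (b x)).
Proof.
by move=> Cb; apply: CF_ext (CF_if Cb (CF_const 1) (CF_const 0)) _ => x; case: (b x).
Qed.

Lemma CF_natval X `{Enc X} (s : X -> seq bool) : CF s -> CF (fun x => natval (s x)).
Proof. by move=> Cs; rewrite /natval; cf; apply: CF_nat_of_bool; cf. Qed.

Lemma CF_words X A `{Enc X} `{Enc A} (s : X -> seq A) k :
  CF s -> CF k -> CF (fun x => words (s x) (k x)).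
Proof.
move=> Cs Ck; rewrite /words; cf.
by apply: (CF_comp Cs (G := fst)); cf.
Qed.

Lemma CF_comp2 X A B T `{Enc X} `{Enc A} `{Enc B} `{Enc T} (F : A -> B -> T) G1 G2 :
  CF (fun q : A * B => F q.1 q.2) -> CF G1 -> CF G2 -> CF (fun x : X => F (G1 x) (G2 x)).
Proof. by move=> CF C1 C2; apply: (CF_comp CF (CF_pair C1 C2)). Qed.

Lemma CF_comp3 X A B C T `{Enc X} `{Enc A} `{Enc B} `{Enc C} `{Enc T} (F : A -> B -> C -> T)
    G1 G2 G3 : CF (fun q : A * (B * C) => F q.1 q.2.1 q.2.2) ->
  CF G1 -> CF G2 -> CF G3 -> CF (fun x : X => F (G1 x) (G2 x) (G3 x)).
Proof. by move=> CF C1 C2 C3; apply: (CF_comp CF (CF_pair C1 (CF_pair C2 C3))). Qed.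

Lemma CF_comp4 X A B C D T `{Enc X} `{Enc A} `{Enc B} `{Enc C} `{Enc D} `{Enc T}
    (F : A -> B -> C -> D -> T) G1 G2 G3 G4 :
  CF (fun q : A * (B * (C * D)) => F q.1 q.2.1 q.2.2.1 q.2.2.2) ->
  CF G1 -> CF G2 -> CF G3 -> CF G4 -> CF (fun x : X => F (G1 x) (G2 x) (G3 x) (G4 x)).
Proof.
by move=> CF C1 C2 C3 C4; apply: (CF_comp CF (CF_pair C1 (CF_pair C2 (CF_pair C3 C4)))).
Qed.

Lemma CF_votes : CF votes.
Proof. by rewrite /votes; cf; apply: CF_words; cf. Qed.

Lemma CF_quads : CF quads.
Proof. by rewrite /quads; apply: CF_words; cf. Qed.

Lemma CF_prefers : CF (fun q : seq nat * (nat * nat) => prefers q.1 q.2.1 q.2.2).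
Proof. by rewrite /prefers; cf. Qed.

Lemma CF_vec : CF (fun q : seq nat * (seq nat * (seq nat * nat)) =>
  vec q.1 q.2.1 q.2.2.1 q.2.2.2).
Proof. by rewrite /vec; cf. Qed.

Lemma CF_fill : CF (fun q : nat * nat => fill q.1 q.2).
Proof. by rewrite /fill; cf; apply: (CF_comp CF_votes); cf. Qed.

Ltac cf1 := cf_eta; first [cf_step | lazymatch goal with
  | |- CF (fun _ => nat_of_bool _) => apply: CF_nat_of_bool
  | |- CF (fun _ => natval _) => apply: CF_natval
  | |- CF (fun _ => words _ _) => apply: CF_words
  | |- CF (fun _ => votes _) => apply: (CF_comp CF_votes)
  | |- CF (fun _ => quads _) => apply: (CF_comp CF_quads)
  | |- CF (fun _ => prefers _ _ _) => apply: (CF_comp3 CF_prefers)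
  | |- CF (fun _ => vec _ _ _ _) => apply: (CF_comp4 CF_vec)
  | |- CF (fun _ => fill _ _) => apply: (CF_comp2 CF_fill)
  | |- CF (fun _ => zip _ _) => apply: CF_zip
  end].

Lemma CF_forms : CF forms.
Proof.
by rewrite /forms /removal_forms /budget_forms /majority_forms /pair_pref; repeat cf1.
Qed.

Lemma CF_offset : CF offset.
Proof. by rewrite /offset; repeat cf1; apply: (CF_comp CF_forms); cf. Qed.

Lemma CF_dot : CF (fun q : seq nat * seq nat => dot q.1 q.2).
(* The goal left open is the default element that [CF_zip] asks for. *)
Proof. by rewrite /dot; repeat cf1; exact: 0. Qed.

Lemma CF_carry : CF (fun q : nat * (seq linform * (seq nat * seq nat)) =>
  carry q.1 q.2.1 q.2.2.1 q.2.2.2).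
Proof.
rewrite /carry; repeat (cf1 || apply: (CF_comp2 CF_dot)); exact: ([::], [::]).
Qed.

Lemma CF_states : CF states.
Proof.
rewrite /states; repeat (cf1 || apply: (CF_comp CF_offset) || apply: (CF_comp CF_forms)).
Qed.

Ltac cf2 := cf_eta; first [cf1 | lazymatch goal with
  | |- CF (fun _ => offset _) => apply: (CF_comp CF_offset)
  | |- CF (fun _ => forms _) => apply: (CF_comp CF_forms)
  | |- CF (fun _ => states _) => apply: (CF_comp CF_states)
  | |- CF (fun _ => carry _ _ _ _) => apply: (CF_comp4 CF_carry)
  end].

Lemma CF_step : CF (fun q : nat * (seq (seq nat) * (bool * seq (seq nat))) =>
  step q.1 q.2.1 q.2.2.1 q.2.2.2).
Proof. by rewrite /step /guesses /digits; repeat cf2. Qed.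

Lemma CF_start : CF start.
Proof. by rewrite /start; repeat cf2. Qed.

Lemma CF_geq_D : CF (fun q : (nat * seq bool) * ((nat * nat) * (nat * nat)) =>
  geq_D q.1.1 q.1.2 q.2.1.1 q.2.1.2 q.2.2.1 q.2.2.2).
Proof. by rewrite /geq_D; repeat cf2. Qed.

Lemma CF_edges : CF (fun q : nat * seq nat => edges q.1 q.2).
Proof. by rewrite /edges; repeat cf2; exact: 0. Qed.

Lemma CF_paths : CF (fun q : nat * (nat * nat) => paths q.1 q.2.1 q.2.2).
Proof. by rewrite /paths; repeat cf2. Qed.

Lemma CF_winner : CF (fun q : nat * (seq bool * nat) => winner q.1 q.2.1 q.2.2).
Proof.
rewrite /winner; repeat first [cf2 | apply: (CF_comp2 CF_edges) | apply: (CF_comp3 CF_paths)].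
by apply: (CF_comp CF_geq_D (G := fun q : ((nat * (seq bool * nat) * nat * seq nat * seq nat)
  * (nat * nat) * (nat * nat)) => ((q.1.1.1.1.1.1, q.1.1.1.1.1.2.1), (q.2, q.1.2)))); cf.
Qed.

Lemma CF_accepts con uni : CF (fun q : nat * (nat * seq (seq nat)) =>
  accepts con uni q.1 q.2.1 q.2.2).
Proof.
have V : CF (fun q : nat * (nat * seq bool) => verdict con uni q.1 q.2.1 q.2.2).
  by rewrite /verdict; case: con; case: uni; repeat first [cf2 | apply: (CF_comp3 CF_winner)].
by rewrite /accepts; repeat first [cf2 | apply: (CF_comp3 V)].
Qed.

Lemma CF_vote_of : CF vote_of.
Proof. by rewrite /vote_of; repeat cf2. Qed.

Lemma CF_toggle : CF (fun q : nat * (seq (seq nat) * (seq (seq bool) * bool)) =>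
  toggle q.1 q.2.1 (vote_of q.2.2.1) q.2.2.2).
Proof. by rewrite /toggle; repeat first [cf2 | apply: (CF_comp CF_vote_of)]. Qed.

(** Bounds tables such as [votes m] and [states m] without estimating them: the cost of computing
    them already bounds their size. *)
Lemma CF_growth T `{Enc T} (F : nat -> T) : CF F ->
  exists2 b, growth b & forall n, esize (F n) <= b n.
Proof.
move=> [c E]; have [b [gb Hb]] := cost_growth c.
have gd : growth (fun n => (2 * n + 1) + b (2 * n + 1)).
  growth_tac; apply: (growth_comp gb); growth_tac.
eexists; first exact: gd.
move=> n; rewrite -E; have := weight_eval c (@enc _ enc_num n); have := Hb (@enc _ enc_num n).
by rewrite esize_nat (_ : n.*2.+1 = 2 * n + 1); lia.
Qed.

Lemma esize_filter A `{Enc A} (p : pred A) (s : seq A) : esize (filter p s) <= esize s.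
Proof.
elim: s => // a s IH; rewrite [filter p _]/=; case: (p a); rewrite !enc_cons /=; lia.
Qed.

Lemma weight_cons A `{Enc A} (a : A) s : esize (a :: s) = (esize a + esize s).+1.
Proof. by []. Qed.

(** * Cost of a pass, of a round and of the whole decision procedure *)

Section Rounds.

Variables (succinct : bool) (bv : nat -> nat).
Hypothesis gbv : growth bv.

(** Only the votes are bounded in the parameter. Multiplicities may be long, and are touched only
    through their first bit. *)
Definition small_items (m : nat) (its : seq item) : Prop :=
  forall it, it \in its -> esize it.1 <= bv m.

(** The vote and the parity set are small, so [FC_small] covers all computation with them. The long
    data, namely the multiplicity and the list of items already treated, only undergo list
    operations of polynomial cost. *)
Lemma FC_item_step c : growth c ->
  FC (fun q : item * ((nat * progress) * (seq (seq nat) * seq item)) =>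
        esize q.1.1 <= bv q.2.1.1 /\ esize q.2.2.1 <= c q.2.1.1)
     (fun q => q.2.1.1)
     (fun q => item_step succinct q.2.1.1 q.2.2 q.1).
Proof.
move=> gc; set dom := fun q => _ /\ _; set prm := fun q => _.
have Fm : FC dom prm (fun q => q.2.1.1) by exact: FC_fst (FC_fst (FC_snd (FC_id _ _))).
have FO : FC dom prm (fun q => q.2.2.1) by exact: FC_fst (FC_snd (FC_snd (FC_id _ _))).
have Fv : FC dom prm (fun q => q.1.1) by exact: FC_fst (FC_fst (FC_id _ _)).
have Fb : FC dom prm (fun q => head false q.1.2) by exact: FC_headb (FC_snd (FC_fst (FC_id _ _))).
have gb : growth (fun n => 10 * n + bv n + c n + 20) by growth_tac.
have small q : dom q -> esize (q.2.1.1, (q.2.2.1, (q.1.1, head false q.1.2)))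
    <= 10 * prm q + bv (prm q) + c (prm q) + 20.
  move=> [h1 h2]; rewrite !esize_pair esize_nat.
  have : weight (@enc _ enc_bool (head false q.1.2)) <= 3 by case: (head false q.1.2).
  by rewrite /prm; lia.
have Farg := FC_pair Fm (FC_pair FO (FC_pair Fv Fb)).
rewrite /item_step /next_item.
apply: FC_pair; first exact: (FC_small CF_toggle gb small Farg).
apply: FC_cons; last exact: FC_snd (FC_snd (FC_snd (FC_id _ _))).
apply: FC_pair; first exact: Fv.
case: (succinct); first exact: FC_behead (FC_snd (FC_fst (FC_id _ _))).
apply: FC_if; [|exact: FC_const | exact: FC_const].
have C : CF (fun q : nat * (seq (seq nat) * (seq (seq bool) * bool)) =>
  q.2.2.2 && (vote_of q.2.2.1 \in q.2.1)) by repeat first [cf2 | apply: (CF_comp CF_vote_of)].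
exact: (FC_small C gb small Farg).
Qed.

(** The rewritten items are the input of the next round, so any growth would compound over the
    rounds. *)
Lemma esize_next_item O it : esize (next_item succinct O it) <= esize it.
Proof.
case: it => raw cnt; rewrite /next_item !esize_pair ltnS leq_add2l [(_, _).2]/= [(_, _).1]/=.
case: cnt => [|b cnt]; first by case: succinct.
have pos : 0 < esize cnt by exact: weight_gt0.
rewrite weight_cons [behead _]/= [head _ _]/=.
case: succinct; case: b; rewrite ?andbF //=; first lia.
  by rewrite -[weight (enc_seq cnt)]/(esize cnt); lia.
by case: ifP => _; rewrite -?[esize [:: true]]/5 -?[esize [::]]/1; lia.
Qed.

Lemma pass_bound m its O acc (st := foldl (item_step succinct m) (O, acc) its) :
  [/\ (weight (@enc _ (@enc_seq item _) st.2)).+1 <= esize acc + esize its,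
      esize O <= esize (votes m) -> weight (@enc (seq (seq nat)) _ st.1) <= esize (votes m)
    & small_items m acc -> small_items m its -> small_items m st.2].
Proof.
rewrite {}/st; elim: its O acc => [|it its IH] O acc.
  by split=> //; rewrite addn1.
rewrite [foldl _ _ _]/= /item_step -/(item_step succinct m).
set O' := toggle _ _ _ _; set acc' := _ :: acc.
have [h1 h2 h3] := IH O' acc'; split.
- apply: leq_trans h1 _; rewrite /acc' !weight_cons.
  by have := esize_next_item O it; rewrite /=; lia.
- by move=> _; apply: h2; apply: esize_filter.
- move=> ha hi; apply: h3 => it' h; last by apply: hi; rewrite inE h orbT.
  by move: h; rewrite in_cons => /orP[/eqP->|h]; [exact: (hi it (mem_head _ _)) | exact: ha].
Qed.

Definition domain (z : nat * progress) : Prop := small_items z.1 z.2.1.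

Lemma FC_pass : FC domain fst (fun z => pass succinct z.1 z.2.1).
Proof.
have [c gc Hc] := CF_growth CF_votes.
apply: (FC_foldl (f := fun z st it => item_step succinct z.1 st it) (s := fun _ => ([::], [::]))
  (B := fun z => c z.1 + esize z + 10) (FC_item_step gc)).
- exact: FC_const.
- exact: FC_fst (FC_snd (FC_id _ _)).
- apply: fpt_add; last exact: fpt_const.
  by apply: fpt_add; [exact: fpt_growth | exact: fpt_esize].
- move=> z l1 a l2 dz lE; split; first by apply: dz; rewrite lE mem_cat inE eqxx orbT.
  have [_ h _] := pass_bound z.1 l1 [::] [::].
  exact: leq_trans (h (weight_gt0 _)) (Hc z.1).
- move=> z l1 l2 dz lE.
  have [h1 h2 _] := pass_bound z.1 l1 [::] [::].
  have {}h2 := h2 (weight_gt0 _).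
  rewrite [X in esize X]surjective_pairing esize_pair.
  have h3 : esize z.2.1 <= esize z by case: (z) => m [its y]; rewrite !esize_pair [(_, _).1]/=; lia.
  have e1 : (esize (l1 ++ l2)).+1 = esize l1 + esize l2 by exact: esize_cat.
  have e2 : 0 < esize l2 by exact: weight_gt0.
  have e3 : esize ([::] : seq item) = 1 by [].
  rewrite lE in h3; rewrite e3 in h1; set st := foldl _ _ l1 in h1 h2.
  apply: (@leq_trans (esize st.1 + esize st.2).+1); first exact: leqnn.
  by have := Hc z.1; lia.
Qed.

Lemma FC_round c : growth c ->
  FC (fun z => domain z /\ esize z.2.2.2 <= c z.1) fst (fun z => round succinct z.1 z.2).
Proof.
move=> gc; set dom := fun z => _ /\ _.
have FP : FC dom fst (fun z => pass succinct z.1 z.2.1).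
  by apply: (FC_comp (c := id) FC_pass growth_id _ _ (FC_id _ _)) => // z [].
have [d gd Hd] := CF_growth CF_votes.
have F2 : FC dom fst (fun z : nat * progress => z.2.2) by exact: FC_snd (FC_snd (FC_id _ _)).
apply: FC_pair; first exact: FC_snd FP.
apply: FC_pair; first exact: FC_behead (FC_fst F2).
have gb : growth (fun n => 10 * n + d n + c n + 20) by growth_tac.
apply: (FC_small CF_step gb _ (FC_pair (FC_fst (FC_id _ _)) (FC_pair (FC_fst FP)
  (FC_pair (FC_headb (FC_fst F2)) (FC_snd F2))))) => z [_ h].
rewrite !esize_pair esize_nat.
have : weight (@enc _ enc_bool (head false z.2.2.1)) <= 3 by case: (head false z.2.2.1).
have [_ h2 _] := pass_bound z.1 z.2.1 [::] [::]; have {}h2 := h2 (weight_gt0 _).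
by have := Hd z.1; move: h2; rewrite -/(pass _ _ _) => h2; lia.
Qed.

Lemma round_bound m st (st' := round succinct m st) :
  [/\ weight (@enc (seq item) _ st'.1) <= esize st.1,
      weight (@enc (seq bool) _ st'.2.1) <= esize st.2.1,
      weight (@enc (seq (seq nat)) _ st'.2.2) <= esize (states m)
    & small_items m st.1 -> small_items m st'.1].
Proof.
have [h1 _ h3] := pass_bound m st.1 [::] [::].
rewrite {}/st' /round; split.
- have e3 : esize ([::] : seq item) = 1 by [].
  by move: h1; rewrite e3 add1n ltnS.
- case: st h1 h3 => [its [kb R]] _ _ /=; case: kb => // b s; rewrite weight_cons /=.
  by rewrite leqW // leq_addl.
- exact: esize_filter.
- by move=> hi; apply: h3 => // it; rewrite in_nil.
Qed.

Lemma rounds_bound m its kb R (l : seq bool) c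
    (st := foldl (fun st _ => round succinct m st) (its, (kb, R)) l) :
  esize (states m) <= c -> esize R <= c -> small_items m its ->
  [/\ small_items m st.1, weight (@enc (seq (seq nat)) _ st.2.2) <= c
    & weight (@enc progress _ st) <= esize its + esize kb + c + 2].
Proof.
rewrite {}/st => hs; elim: l its kb R => [|a l IH] its kb R hR hi.
  by split=> //; rewrite [foldl _ _ _]/= !esize_pair; lia.
rewrite [foldl _ _ _]/=; have [h1 h2 h3 h4] := round_bound m (its, (kb, R)).
move: h1 h2 h3 h4; case: (round _ _ _) => its' [kb' R'] /= h1 h2 h3 h4.
have [g1 g2 g3] := IH its' kb' R' (leq_trans h3 hs) (h4 hi).
by split=> //; apply: leq_trans g3 _; lia.
Qed.

Lemma FC_rounds : FC (fun y => small_items y.1 y.2.1) fst (fun y => rounds succinct y).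
Proof.
have [c1 gc1 Hc1] := CF_growth CF_states; have [c2 gc2 Hc2] := CF_growth CF_start.
pose c n := c1 n + c2 n; have gc : growth c by rewrite /c; growth_tac.
apply: (FC_foldl (f := fun y st (_ : bool) => round succinct y.1 st)
  (dom' := fun q => domain (q.2.1.1, q.2.2) /\ esize q.2.2.2.2 <= c q.2.1.1)
  (B := fun y => esize y + c y.1)).
- apply: (FC_comp (c := id) (FC_round gc) growth_id
    (G := fun q : bool * (_ * progress) => (q.2.1.1, q.2.2))) => //.
  apply: FC_pair; first exact: FC_fst (FC_fst (FC_snd (FC_id _ _))).
  exact: FC_snd (FC_snd (FC_id _ _)).
- apply: FC_pair; first exact: FC_fst (FC_snd (FC_id _ _)).
  apply: FC_pair; first exact: FC_fst (FC_snd (FC_snd (FC_id _ _))).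
  apply: (FC_small CF_start (c := fun n => 2 * n + 1)); [growth_tac | | exact: FC_fst (FC_id _ _)].
  by move=> y _; rewrite esize_nat; lia.
- exact: FC_snd (FC_snd (FC_snd (FC_snd (FC_id _ _)))).
- by apply: fpt_add; [exact: fpt_esize | exact: fpt_growth].
- move=> [m [its [kb [p x]]]] l1 a l2 dy _.
  have [||h1 h2 _] := @rounds_bound m its kb (start m) l1 (c m) _ _ dy; rewrite /c.
  + by have := Hc1 m; lia.
  + by have := Hc2 m; lia.
  + by split.
- move=> [m [its [kb [p x]]]] l1 l2 dy _.
  have [||_ _ h3] := @rounds_bound m its kb (start m) l1 (c m) _ _ dy; rewrite /c.
  + by have := Hc1 m; lia.
  + by have := Hc2 m; lia.
  + apply: leq_trans h3 _; rewrite /c !esize_pair [(_, _).1]/=; lia.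
Qed.

Definition modest (x : seq bool) : Prop :=
  let P := (pinstance succinct x).1 in let m := natval P.1 in
  [/\ esize P.1 <= bv m, esize P.2.2.1 <= bv m & small_items m P.2.1].

Definition parameter (x : seq bool) : nat := (prepare succinct x).1.

Lemma FC_decide con uni : FC modest parameter (fun x => decide succinct con uni x).
Proof.
have FP : FC modest parameter (fun x => (pinstance succinct x).1).
  exact: FC_fst (poly_FC (pinstance_tame succinct).1 (FC_id _ _)).
have Fy : FC modest parameter (fun x => prepare succinct x).
  apply: FC_pair; last first.
    apply: FC_pair; first exact: FC_fst (FC_snd FP).
    apply: FC_pair; first exact: FC_snd (FC_snd (FC_snd FP)).
    by apply: FC_pair; [exact: FC_fst (FC_snd (FC_snd FP)) | exact: FC_id].
  by apply: (FC_small (CF_natval CF_id) gbv _ (FC_fst FP)) => x [].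
have FR : FC modest parameter (fun x => rounds succinct (prepare succinct x)).
  by apply: (FC_comp (c := id) FC_rounds growth_id _ _ Fy) => // x [].
have C : CF (fun q : nat * (seq bool * seq (seq nat)) => accepts con uni q.1 (natval q.2.1) q.2.2).
  by apply: (CF_comp3 (CF_accepts con uni)); repeat cf2.
have [c1 gc1 Hc1] := CF_growth CF_states; have [c2 gc2 Hc2] := CF_growth CF_start.
apply: (FC_small (c := fun n => 2 * n + bv n + c1 n + c2 n + 10) C _ _
  (FC_pair (FC_fst Fy) (FC_pair (FC_fst (FC_snd (FC_snd (FC_snd Fy)))) (FC_snd (FC_snd FR))))).
  by growth_tac.
move=> x [_ hp hi]; rewrite !esize_pair esize_nat.
have [||_ h _] := @rounds_bound (parameter x) (prepare succinct x).2.1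
  (prepare succinct x).2.2.1 (start (parameter x)) x (c1 (parameter x) + c2 (parameter x)) _ _ hi.
- by have := Hc1 (parameter x); lia.
- by have := Hc2 (parameter x); lia.
have hr : esize (rounds succinct (prepare succinct x)).2.2 <= c1 (parameter x) + c2 (parameter x).
  exact: h.
have hp' : esize (prepare succinct x).2.2.2.1 <= bv (parameter x) by exact: hp.
by move: hr hp'; rewrite -/(parameter x); lia.
Qed.

Theorem decide_machine con uni : exists (M : TM) (f : nat -> nat) (c : nat),
  [/\ TM_wf M, computable f & forall x, modest x -> exists2 t,
    t <= f (parameter x) * (size x).+1 ^ c &
    (tm_run M t (tm_init x)).1 = if decide succinct con uni x then 1 else 2].
Proof.
have [k E [b [d [gb Hb]]]] := FC_decide con uni.
have [M [C [wf H]]] := code_machine k.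
(* The encoded input has weight at most 5 times [(size x).+1]. The base of the square in
   [code_machine] is therefore at most [1 + 5 ^ d * b n] times [(size x).+1 ^ d.+1]. *)
have gf : growth (fun n => C * ((1 + 5 ^ d * b n) * (1 + 5 ^ d * b n))) by growth_tac.
exists M, (fun n => C * ((1 + 5 ^ d * b n) * (1 + 5 ^ d * b n))), (d.+1 * 2); split=> //.
  by have [c Ec] := gf.2; apply: code_computable Ec.
move=> x mx; have [t le st] := H x; exists t; last first.
  by rewrite st E; case: decide.
apply: leq_trans le _; rewrite -mulnA leq_mul2l; apply/orP; right.
rewrite expnM mulnn -expnMn leq_exp2r //.
have /andP[_ e5] := esize_bits x.
have h1 : esize x ^ d <= 5 ^ d * (size x).+1 ^ d.
  rewrite -expnMn; have [->|d0] := posnP d; first by rewrite !expn0.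
  by rewrite leq_exp2r //; lia.
have := leq_trans (Hb x mx) (leq_mul (leqnn _) h1).
have : 0 < (size x).+1 ^ d by rewrite expn_gt0.
rewrite expnS; move: (b _) (5 ^ d) (_ ^ d) => B F G G0; nia.
Qed.

End Rounds.

(** * Correctness of the carry automaton *)

Lemma natval_cons b s : natval (b :: s) = b + (natval s).*2.
Proof. by rewrite /= addnn. Qed.

Lemma natval_behead s : natval (behead s) = (natval s)./2.
Proof. by case: s => // b s; rewrite natval_cons half_bit_double. Qed.

Lemma natval_head s : head false s = odd (natval s).
Proof. by case: s => // b s; rewrite natval_cons oddD odd_double addbF oddb. Qed.

Lemma natval_bits n : natval (bits n) = n.
Proof.
rewrite /bits; move: {2 3}n (leqnn n) => m; elim: m n => [|m IH] [|n] // le; rewrite [bits_aux _ _]/= natval_cons.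
rewrite IH; first exact: (odd_double_half n.+1).
by rewrite uphalf_half; lia.
Qed.

Lemma natval_lt s : natval s < 2 ^ size s.
Proof. by elim: s => // b s IH; rewrite natval_cons [size _]/= expnS; case: b; lia. Qed.

Lemma mem_words (T : eqType) (A : seq T) k w :
  (w \in words A k) = (size w == k) && all (mem A) w.
Proof.
elim: k w => [|k IH] w; first by rewrite inE; case: w.
rewrite /words iterS -/(words A k); apply/flatten_mapP/andP.
  move=> [a aA /mapP[v]]; rewrite IH => /andP[/eqP sv av] ->.
  by rewrite /= sv eqxx; split=> //; apply/andP.
case: w => [[]|a v] //=; rewrite eqSS => -[/eqP sv /andP[aA av]].
by exists a => //; apply: map_f; rewrite IH sv eqxx.
Qed.

Lemma words_uniq (T : eqType) (A : seq T) k : uniq A -> uniq (words A k).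
Proof.
move=> uA; elim: k => // k IH; rewrite /words iterS -/(words A k).
apply: (@allpairs_uniq _ _ _ cons A (words A k)) => //.
by move=> [a v] [b w] _ _ /= [-> ->].
Qed.

Lemma mem_votes m v : (v \in votes m) = is_vote m v.
Proof.
rewrite mem_filter mem_words /is_vote; apply/idP/idP.
  move=> /and3P[u /eqP sv /allP av]; apply: uniq_perm; rewrite ?iota_uniq //.
  have le : size (iota 0 m) <= size v by rewrite size_iota sv.
  by have [_ E] := uniq_min_size u av le.
move=> pv; rewrite (perm_uniq pv) iota_uniq (perm_size pv) size_iota eqxx /=.
by apply/allP => x; rewrite (perm_mem pv).
Qed.

Lemma votes_uniq m : uniq (votes m).
Proof. by rewrite filter_uniq // words_uniq // iota_uniq. Qed.

Lemma dot_cons c cs z zs : dot (c :: cs) (z :: zs) = c * z + dot cs zs.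
Proof. by []. Qed.

Definition halves (w : seq nat) : seq nat := [seq x./2 | x <- w].
Definition parities (w : seq nat) : seq nat := [seq nat_of_bool (odd x) | x <- w].

Lemma dot_halves c w : dot c w = (dot c (halves w)).*2 + dot c (parities w).
Proof.
elim: c w => [|c cs IH] [|x w] //; rewrite /= !dot_cons IH.
by rewrite -{1}(odd_double_half x); lia.
Qed.

Lemma dot_le c z : all (fun x => x <= 1) z -> dot c z <= sumn c.
Proof.
elim: c z => [|c cs IH] [|x z] // /andP[x1 h].
by rewrite dot_cons [sumn _]/= leq_add ?IH //; case: x x1 => [|[]] // _; rewrite ?muln0 ?muln1.
Qed.

Lemma dot0 c z : all (fun x => x == 0) z -> dot c z = 0.
Proof.
elim: c z => [|c cs IH] [|x z] // /andP[/eqP-> h].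
by rewrite dot_cons IH // muln0.
Qed.

Lemma offset_ge m f : f \in forms m -> sumn f.1 + sumn f.2 <= offset m.
Proof.
rewrite /offset; elim: (forms m) => //= g fs IH; rewrite inE => /orP[/eqP->|/IH]; lia.
Qed.

Definition sat (m : nat) (u w : seq nat) : seq bool :=
  [seq offset m + dot p.2.2 w <= p.1 + dot p.2.1 w | p <- zip u (forms m)].

(** Let t = x - B be the true carry. The value t + P.w - N.w is nonnegative iff its floor half is,
    and for w = 2 w1 + w0 that half is floor((t + P.w0 - N.w0)/2) + P.w1 - N.w1. Shifting the new
    carry by B gives the formula of [carry], whose subtraction does not truncate because N.w0 <=
    B. *)
Lemma sat_carry m u w :
  sat m u w = sat m (carry (offset m) (forms m) u (parities w)) (halves w).
Proof.
rewrite /sat /carry.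
have: forall f, f \in forms m -> sumn f.1 + sumn f.2 <= offset m by exact: offset_ge.
elim: (forms m) u => [|f fs IH] [|x u] //= H; congr cons; last first.
  by apply: IH => g gin; apply: H; rewrite inE gin orbT.
have := H f (mem_head _ _) => {H IH}.
have b01 : all (fun x => x <= 1) (parities w).
  by apply/allP => y /mapP[z _ ->]; case: (odd z).
have := dot_le f.2 b01.
rewrite (dot_halves f.2 w) (dot_halves f.1 w).
move: (dot f.2 _) (dot f.2 _) (dot f.1 _) (dot f.1 _) (offset m) => a b c d B.
lia.
Qed.

Lemma mem_iota0 n x : (x \in iota 0 n) = (x < n).
Proof. by rewrite mem_iota add0n. Qed.

(** In shifted form: a carry at most 2B plus B plus a contribution at most B, halved, is again at
    most 2B. *)
Lemma carry_states m u z : u \in states m -> all (fun x => x <= 1) z ->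
  carry (offset m) (forms m) u z \in states m.
Proof.
rewrite !mem_words => /andP[/eqP su au] z1.
rewrite size_map size_zip su minnn eqxx andTb.
apply/allP => _ /mapP[[x f] pin ->].
have xin : x \in u by rewrite -(unzip1_zip (s := u) (t := forms m)) ?su //; apply: (map_f fst pin).
have fin : f \in forms m by rewrite -(unzip2_zip (s := u) (t := forms m)) ?su //; apply: (map_f snd pin).
have xlt : (x : nat) < (offset m + offset m).+1 by rewrite -mem_iota0; apply: (allP au).
rewrite -[mem _ _]/(_ \in iota 0 _) mem_iota0 /=.
have key (y B a b c d : nat) : y < (B + B).+1 -> a <= c -> c + d <= B ->
  (y + B + a - b)./2 < (B + B).+1 by lia.
exact: key xlt (dot_le f.1 z1) (offset_ge fin).
Qed.

Lemma start_states m : {subset start m <= states m}.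
Proof.
move=> u; rewrite inE => /eqP->; rewrite mem_words size_map eqxx andTb.
by apply/allP => _ /mapP[f _ ->]; rewrite -[mem _ _]/(_ \in iota 0 _) mem_iota0; lia.
Qed.

Lemma step_states m O kb R : {subset step m O kb R <= states m}.
Proof. by move=> u; rewrite mem_filter => /andP[]. Qed.

Definition solvable (m : nat) (Phi : pred (seq bool)) (N : nat) (n : seq nat) (k : nat)
    (R : seq (seq nat)) : Prop :=
  exists u w, [/\ u \in R, size w = size (votes m) + size (votes m),
    all (fun x => x < 2 ^ N) w & Phi (sat m u (n ++ w ++ [:: k]))].

(** The lowest bits of the unknowns are the guess, and their halves solve the remaining problem.
    Conversely a guess and a solution of the halved problem recombine. The satisfied forms agree by
    [sat_carry]. *)
Lemma solvable_step m Phi N n k R O :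
  {subset R <= states m} -> [seq v \in O | v <- votes m] = [seq odd x | x <- n] ->
  solvable m Phi N.+1 n k R <->
  solvable m Phi N (halves n) k./2 (step m O (odd k) R).
Proof.
move=> RS Oodd.
have digE z : [seq nat_of_bool (v \in O) | v <- votes m] ++ z ++ [:: nat_of_bool (odd k)]
    = parities n ++ z ++ parities [:: k].
  congr (_ ++ _); have := congr1 (map nat_of_bool) Oodd; rewrite -!map_comp => E.
  by rewrite /parities -[RHS]E.
have d01 z : z \in guesses m -> all (fun x => x <= 1) (digits m O z (odd k)).
  rewrite mem_words /digits => /andP[_ /allP az]; rewrite !all_cat /=.
  apply/and3P; split; last by case: (odd k).
    by apply/allP => _ /mapP[v _ ->]; case: (_ \in _).
  by apply/allP => x /az; rewrite !inE => /orP[] /eqP->.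
split=> [[u [w [uR sw wN ok]]]|[u' [w' [/[!mem_filter]/andP[/hasP[u uR /hasP[z zg /eqP <-]] _] sw wN ok]]]].
- have zg : parities w \in guesses m.
    rewrite mem_words size_map sw eqxx /=; apply/allP => _ /mapP[x _ ->].
    by rewrite !inE; case: (odd x).
  exists (carry (offset m) (forms m) u (digits m O (parities w) (odd k))), (halves w); split.
  + rewrite mem_filter carry_states ?RS ?d01 // andbT.
    by apply/hasP; exists u => //; apply/hasP; exists (parities w).
  + by rewrite size_map.
  + apply/allP => _ /mapP[x /(allP wN) lt ->]; move: lt; rewrite expnS /=; lia.
  + by move: ok; rewrite sat_carry /digits digE /parities /halves !map_cat.
- move: (zg); rewrite mem_words => /andP[/eqP sz /allP az].
  (* The vector with halves [w'] and parities [z]. *)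
  pose w := [seq p.1.*2 + p.2 | p <- zip w' z].
  have szw : size w' = size z by rewrite sw sz.
  have wE : halves w = w' /\ parities w = z.
    rewrite /w; elim: w' z szw az {zg sw sz ok wN w} => [|x w' IH] [|y z] //= [szw] az.
    have [|-> ->] := IH z szw; first by move=> v vin; apply: az; rewrite inE vin orbT.
    have := az y (mem_head _ _); rewrite !inE => /orP[] /eqP->.
      by rewrite addn0 doubleK odd_double.
    by rewrite addn1 /= uphalf_double odd_double.
  case: wE => hw pw; exists u, w; split=> //.
  + by rewrite size_map size_zip -szw minnn.
  + apply/allP => x xw; have : x./2 \in w' by rewrite -hw; apply: map_f.
    by move=> /(allP wN); rewrite expnS /=; lia.
  + rewrite sat_carry; move: ok; rewrite /digits digE -hw -pw.
    by rewrite /parities /halves !map_cat.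
Qed.

Lemma sat0 m u w : size u = size (forms m) -> all (fun x => x == 0) w ->
  sat m u w = [seq offset m <= x | x <- u].
Proof.
move=> su w0; rewrite /sat -[in RHS](unzip1_zip (s := u) (t := forms m)) ?su // -map_comp.
by apply: eq_map => p /=; rewrite !dot0 // !addn0.
Qed.

Lemma solvable0 m Phi n R : {subset R <= states m} -> all (fun x => x == 0) n ->
  solvable m Phi 0 n 0 R <-> has (fun u => Phi [seq offset m <= x | x <- u]) R.
Proof.
move=> RS n0.
have E u w : u \in R -> all (fun x => x < 2 ^ 0) w ->
    sat m u (n ++ w ++ [:: 0]) = [seq offset m <= x | x <- u].
  move=> /RS; rewrite mem_words => /andP[/eqP su _] w0; apply: sat0 => //.
  rewrite !all_cat n0 /= andbT; apply/allP => x /(allP w0) /=; lia.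
split=> [[u [w [uR _ w0 ok]]]|/hasP[u uR ok]].
  by apply/hasP; exists u => //; rewrite -(E u w).
exists u, (nseq (size (votes m) + size (votes m)) 0); rewrite size_nseq.
have w0 : all (fun x => x < 2 ^ 0) (nseq (size (votes m) + size (votes m)) 0).
  by apply/allP => x /nseqP[->].
by split=> //; rewrite E.
Qed.

Definition item_total (v : seq nat) (its : seq item) : nat :=
  sumn [seq natval it.2 | it <- its & vote_of it.1 == v].

(** What makes a pass halve the totals exactly. With distinct votes each total sits in one item and
    is halved by dropping a bit; otherwise every item counts 0 or 1 and the halving is done by
    thinning out. *)
Definition regular (succinct : bool) (its : seq item) : bool :=
  if succinct then uniq [seq vote_of it.1 | it <- its]
  else all (fun it => it.2 \in [:: [::]; [:: true]]) its.

Lemma item_total_cons v it its :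
  item_total v (it :: its) = (if vote_of it.1 == v then natval it.2 else 0) + item_total v its.
Proof. by rewrite /item_total /=; case: ifP. Qed.

Lemma mem_toggle m O w b v : v \in votes m ->
  (v \in toggle m O w b) = (b && (v == w)) (+) (v \in O).
Proof. by move=> vV; rewrite mem_filter vV andbT. Qed.

(** A conservation law: a bit that is read enters the parity, and kept items count double. In the
    nonsuccinct case the first of two equal votes sets the parity, and the second clears it and
    survives for both. In the succinct case [O] must be fresh, since no carry is passed between
    items. *)
Lemma pass_total b m its O acc v (st := foldl (item_step b m) (O, acc) its) :
  v \in votes m -> regular b its -> (b -> {in its, forall it, vote_of it.1 \notin O}) ->
  (v \in st.1) + (item_total v st.2).*2 = (v \in O) + (item_total v acc).*2 + item_total v its.
Proof.
rewrite {}/st => vV; elim: its O acc => [|it its IH] O acc reg fresh; first by rewrite addn0.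
rewrite [foldl _ _ _]/= /item_step -/(item_step b m) [(O, acc).1]/= [(O, acc).2]/=.
rewrite IH; last 2 first.
- by case: (b) reg => /= /andP[].
- move=> bT it' itin; rewrite mem_filter negb_and addbC.
  have nO := fresh bT it'; rewrite inE itin orbT in nO; rewrite (negbTE (nO isT)) /=.
  move: reg; rewrite bT /= => /andP[/mapP ni _].
  have -> : (vote_of it'.1 == vote_of it.1) = false.
    by apply/negP => /eqP e; apply: ni; exists it'.
  by rewrite andbF.
rewrite mem_toggle // !item_total_cons /next_item [_.1]/= [_.2]/= eq_sym.
case: eqP => [vE|_]; last by rewrite andbF /= addnA.
case: b reg fresh {IH} => reg fresh.
  have nO := fresh isT it (mem_head _ _); rewrite vE in nO; rewrite (negbTE nO) andbT addbF.
  by rewrite natval_behead natval_head -[in RHS](odd_double_half (natval it.2)); lia.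
move: reg => /= /andP[]; rewrite !inE => /orP[] /eqP-> _ /=.
  by lia.
by rewrite vE; case: (v \in O) => /=; lia.
Qed.

Lemma pass_regular b m its : regular b its -> regular b (pass b m its).2.
Proof.
rewrite /pass; case: b => reg.
  have E O acc : [seq vote_of it.1 | it <- (foldl (item_step true m) (O, acc) its).2]
      = catrev [seq vote_of it.1 | it <- its] [seq vote_of it.1 | it <- acc].
    by elim: its O acc {reg} => //= it its IH O acc; rewrite IH.
  by rewrite /regular E -/(rev _) rev_uniq.
have E O acc : regular false acc -> regular false (foldl (item_step false m) (O, acc) its).2.
  elim: its O acc {reg} => //= it its IH O acc ra; apply: IH => /=.
  by rewrite !inE; case: ifP; rewrite ra ?eqxx.
exact: E.
Qed.

(** Each element of [l] consumes one bit. The bounds by [2 ^ size l] ensure that at the end all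
    totals and the budget are 0, so that the carries alone decide. *)
Lemma rounds_solvable b m Phi l its kb R : {subset R <= states m} -> regular b its ->
  {in votes m, forall v, item_total v its < 2 ^ size l} -> natval kb < 2 ^ size l ->
  solvable m Phi (size l) [seq item_total v its | v <- votes m] (natval kb) R <->
  has (fun u => Phi [seq offset m <= x | x <- u])
    (foldl (fun (st : progress) (_ : bool) => round b m st) (its, (kb, R)) l).2.2.
Proof.
elim: l its kb R => [|a l IH] its kb R RS reg tl kl.
  rewrite (_ : natval kb = 0); last by case: (natval kb) kl.
  apply: solvable0 => //; apply/allP => _ /mapP[v vV ->].
  by have := tl v vV; case: (item_total v its).
have P v : v \in votes m ->
    (v \in (pass b m its).1) + (item_total v (pass b m its).2).*2 = item_total v its.
  by move=> vV; rewrite [LHS](@pass_total b m its [::] [::] v vV reg).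
have odds : [seq v \in (pass b m its).1 | v <- votes m]
    = [seq odd x | x <- [seq item_total v its | v <- votes m]].
  rewrite -map_comp; apply/eq_in_map => v vV /=.
  by rewrite -(P v vV) oddD odd_double addbF oddb.
have halvesE : halves [seq item_total v its | v <- votes m]
    = [seq item_total v (pass b m its).2 | v <- votes m].
  rewrite /halves -map_comp; apply/eq_in_map => v vV /=.
  by rewrite -(P v vV) half_bit_double.
rewrite [foldl _ _ _]/= /round.
have [S1 S2] := solvable_step Phi (size l) (natval kb) RS odds.
have := IH (pass b m its).2 (behead kb) (step m (pass b m its).1 (head false kb) R).
rewrite natval_behead natval_head -halvesE => IH'.
have {}IH' := IH' (@step_states _ _ _ _) (pass_regular m reg).
have [||I1 I2] := IH'.
- move=> v vV; have := tl v vV; have := P v vV.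
  by rewrite [size (_ :: _)]/= expnS; case: (_ \in _) => /=; lia.
- by move: kl; rewrite [size _]/= expnS; lia.
by split=> [/S1/I1|/I2/S2].
Qed.

Lemma sat_start m w u : u \in start m ->
  sat m u w = [seq dot f.2 w <= dot f.1 w | f <- forms m].
Proof.
rewrite inE => /eqP->; rewrite /sat; elim: (forms m) (offset m) => //= f fs IH B.
by rewrite leq_add2l (IH B).
Qed.

Definition Phi con uni m p (s : seq bool) : bool :=
  all (fun i => nth false s i) (iota 0 (size (votes m) + 3)) && verdict con uni m p s.

Definition feasible con uni m p (n : seq nat) (k : nat) (N : nat) : Prop :=
  exists w, [/\ size w = size (votes m) + size (votes m), all (fun x => x < 2 ^ N) w &
    Phi con uni m p [seq dot f.2 (n ++ w ++ [:: k]) <= dot f.1 (n ++ w ++ [:: k]) | f <- forms m]].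

Lemma decide_feasible b con uni x m p k its : (pinstance b x).1 = (bits m, (its, (bits p, bits k))) ->
  regular b its -> {in votes m, forall v, item_total v its < 2 ^ size x} -> k < 2 ^ size x ->
  decide b con uni x <->
  feasible con uni m p [seq item_total v its | v <- votes m] k (size x).
Proof.
move=> px reg tl kl; rewrite /decide /prepare px /= !natval_bits /rounds /=.
have := @rounds_solvable b m (Phi con uni m p) x its (bits k) (start m) (@start_states m) reg tl.
rewrite natval_bits => /(_ kl) <-; split.
  by move=> [u [w [us sw wN ok]]]; exists w; split=> //; rewrite -(sat_start _ us).
move=> [w [sw wN ok]]; exists [seq offset m | _ <- forms m], w; split=> //.
  by rewrite inE.
by rewrite sat_start ?inE.
Qed.

Import Order.TTheory GRing.Theory Num.Theory.
Local Open Scope nat_scope.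

(** * Meaning of the linear forms *)

Lemma dot_cat c1 c2 z1 z2 : size c1 = size z1 ->
  dot (c1 ++ c2) (z1 ++ z2) = dot c1 z1 + dot c2 z2.
Proof. by move=> E; rewrite /dot zip_cat // map_cat sumn_cat. Qed.

Lemma dot_map T (s : seq T) (f g : T -> nat) :
  dot [seq f v | v <- s] [seq g v | v <- s] = \sum_(v <- s) f v * g v.
Proof. by elim: s => [|v s IH]; rewrite ?big_nil ?big_cons //= dot_cons IH. Qed.

Definition point m (n y a : seq nat -> nat) (k : nat) : seq nat :=
  [seq n v | v <- votes m] ++ ([seq y v | v <- votes m] ++ [seq a v | v <- votes m]) ++ [:: k].

Lemma dot_vec m cn cy ca ck n y a k :
  dot (vec [seq cn v | v <- votes m] [seq cy v | v <- votes m] [seq ca v | v <- votes m] ck)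
    (point m n y a k)
  = \sum_(v <- votes m) cn v * n v + \sum_(v <- votes m) cy v * y v
    + \sum_(v <- votes m) ca v * a v + ck * k.
Proof.
rewrite /vec /point -catA !dot_cat ?size_map // !dot_map -!addnA; do 3 congr (_ + _).
by rewrite dot_cons addn0.
Qed.

Lemma sum_pick m v (f : seq nat -> nat) : v \in votes m ->
  \sum_(w <- votes m) nat_of_bool (w == v) * f w = f v.
Proof.
move=> vV; rewrite (bigD1_seq v) ?votes_uniq //= eqxx mul1n big1 ?addn0 // => w /negbTE->.
by rewrite mul0n.
Qed.

Lemma sum_fill m k (f : seq nat -> nat) :
  \sum_(w <- votes m) k * f w = k * \sum_(w <- votes m) f w.
Proof. by rewrite big_distrr. Qed.

Definition pref_weight m (y : seq nat -> nat) (c d : nat) : nat :=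
  \sum_(v <- votes m) nat_of_bool (prefers v c d) * y v.

Definition holds (z : seq nat) (f : linform) : bool := dot f.2 z <= dot f.1 z.

Lemma removal_hold m n y a k :
  all (holds (point m n y a k)) (removal_forms m) = all (fun v => n v <= y v + a v) (votes m).
Proof.
rewrite /removal_forms all_map; apply: eq_in_all => v vV; rewrite /= /holds /= /fill.
by rewrite !dot_vec !sum_fill !sum_pick // !mul0n ?addn0 ?add0n.
Qed.

Lemma budget_hold m n y a k : all (holds (point m n y a k)) (budget_forms m) =
  (\sum_(v <- votes m) a v <= k) && (\sum_(v <- votes m) y v == \sum_(v <- votes m) n v).
Proof.
rewrite /budget_forms /= /holds /= /fill !dot_vec !sum_fill !mul0n !mul1n ?addn0 ?add0n.
by rewrite andbT [X in _ = _ && X]eqn_leq andbC [X in _ = _ && X]andbC andbC.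
Qed.

Lemma majority_hold m n y a k :
  [seq holds (point m n y a k) f | f <- majority_forms m] =
  [seq pref_weight m y (nth 0 q 1) (nth 0 q 0) + pref_weight m y (nth 0 q 2) (nth 0 q 3)
       <= pref_weight m y (nth 0 q 0) (nth 0 q 1) + pref_weight m y (nth 0 q 3) (nth 0 q 2)
    | q <- quads m].
Proof.
rewrite /majority_forms -map_comp; apply: eq_map => q /=.
rewrite /holds /= /fill !dot_vec !sum_fill !mul0n !addn0 !add0n /pref_weight /pair_pref.
by rewrite -!big_split /=; congr (_ <= _); apply: eq_bigr => v _; rewrite mulnDl.
Qed.

Lemma size_light m : size (removal_forms m ++ budget_forms m) = size (votes m) + 3.
Proof. by rewrite size_cat size_map. Qed.

Lemma all_nth (s t : seq bool) : all (fun i => nth false (s ++ t) i) (iota 0 (size s)) = all id s.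
Proof.
apply/allP/allP => [H b|H i].
  by move=> /(nthP false)[i lt <-]; have := H i; rewrite mem_iota nth_cat lt; apply.
by rewrite mem_iota /= add0n => lt; rewrite nth_cat lt; apply: H; apply: mem_nth.
Qed.

Definition beats m (y : seq nat -> nat) (c d c' d' : nat) : bool :=
  pref_weight m y d c + pref_weight m y c' d' <= pref_weight m y c d + pref_weight m y d' c'.

Lemma geq_DE m n y a k c d c' d' : c < m -> d < m -> c' < m -> d' < m ->
  geq_D m [seq holds (point m n y a k) f | f <- forms m] c d c' d' = beats m y c d c' d'.
Proof.
move=> cm dm c'm d'm; rewrite /geq_D /forms catA map_cat.
rewrite -size_light -(size_map (holds (point m n y a k))) drop_size_cat // majority_hold.
have qin : [:: c; d; c'; d'] \in quads m.
  rewrite mem_words; apply/allP => x; rewrite -[mem _ _]/(_ \in iota 0 m) mem_iota0 !inE.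
  by case/or4P => /eqP->.
by rewrite (nth_map [::]) ?index_mem // nth_index.
Qed.

Lemma Phi_point con uni m p n y a k (s := [seq holds (point m n y a k) f | f <- forms m]) :
  Phi con uni m p s =
  [&& all (fun v => n v <= y v + a v) (votes m), \sum_(v <- votes m) a v <= k,
      \sum_(v <- votes m) y v == \sum_(v <- votes m) n v & verdict con uni m p s].
Proof.
rewrite /Phi; have -> : all (fun i => nth false s i) (iota 0 (size (votes m) + 3)) =
    all (holds (point m n y a k)) (removal_forms m ++ budget_forms m).
  rewrite -size_light -(size_map (holds (point m n y a k))) /s /forms catA map_cat all_nth.
  by rewrite all_map.
by rewrite all_cat removal_hold budget_hold -!andbA.
Qed.

(** * Schulze winners *)

Lemma count_votes m (P : pred (seq nat)) V : all (is_vote m) V ->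
  count P V = \sum_(v <- votes m) nat_of_bool (P v) * count_mem v V.
Proof.
elim: V => [|u V IH] /=; first by rewrite big1 // => v _; rewrite muln0.
move=> /andP[uv /IH ->]; rewrite -mem_votes in uv.
rewrite -(sum_pick (fun v => nat_of_bool (P v)) uv) -big_split /=.
by apply: eq_bigr => v _; rewrite mulnDr [u == v]eq_sym [_ * nat_of_bool (v == u)]mulnC.
Qed.

Lemma beats_D m V y c d c' d' : all (is_vote m) V ->
  {in votes m, forall v, y v = count_mem v V} ->
  beats m y c d c' d' = (D V c' d' <= D V c d)%R.
Proof.
move=> aV yE; have E e f : count (fun v => prefers v e f) V = pref_weight m y e f.
  rewrite (count_votes _ aV) /pref_weight !big_seq; apply: eq_bigr => v vV.
  by rewrite yE.
by rewrite /D !E /beats; lia.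
Qed.

Lemma minz_ge (x a b : int) : (x <= minz a b)%R = (x <= a)%R && (x <= b)%R.
Proof. by rewrite /minz; case: ifP => h; lia. Qed.

Lemma minz_le (x a b : int) : (minz a b <= x)%R = (a <= x)%R || (b <= x)%R.
Proof. by rewrite /minz; case: ifP => h; lia. Qed.

Lemma strength_cons V c d s : s != [::] ->
  strength V c (d :: s) = minz (D V c d) (strength V d s).
Proof. by case: s. Qed.

Lemma strength_ge V x c s : s != [::] ->
  (x <= strength V c s)%R = all (fun e => (x <= D V e.1 e.2)%R) (edges c s).
Proof.
elim: s c => // d [|d' s] IH c _; first by rewrite /= andbT.
by rewrite strength_cons // minz_ge IH.
Qed.

Lemma strength_le V x c s : s != [::] ->
  (strength V c s <= x)%R = has (fun e => (D V e.1 e.2 <= x)%R) (edges c s).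
Proof.
elim: s c => // d [|d' s] IH c _; first by rewrite /= orbF.
by rewrite strength_cons // minz_le IH.
Qed.

Lemma strength_cmp V c s d t : s != [::] -> t != [::] ->
  (strength V d t <= strength V c s)%R =
  has (fun e' => all (fun e => (D V e'.1 e'.2 <= D V e.1 e.2)%R) (edges c s)) (edges d t).
Proof. by move=> s0 t0; rewrite strength_le //; apply: eq_has => e; rewrite strength_ge. Qed.

Lemma mem_paths m c d s : (s \in paths m c d) = simple_path m c d s.
Proof.
rewrite /paths mem_filter /simple_path /nilp size_eq0.
apply/andP/idP => [[]//|h]; split=> //; move/and4P: h => [_ _ /andP[_ u] /andP[_ a]].
apply/flattenP; exists (words (iota 0 m) (size s)).
  apply: map_f; rewrite mem_iota /= add0n ltnS -(size_iota 0 m); apply: uniq_leq_size => // x xs.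
  by rewrite mem_iota0; apply: (allP a).
rewrite mem_words eqxx; apply/allP => x /(allP a).
by rewrite -[mem _ _]/(_ \in iota 0 _) mem_iota0.
Qed.

Lemma edges_lt m c s e : all (fun x => x < m) (c :: s) -> e \in edges c s -> e.1 < m /\ e.2 < m.
Proof.
rewrite /edges; elim: s c => // d s IH c /= /and3P[cm dm sm].
by rewrite inE => /orP[/eqP->//|]; apply: IH; rewrite /= dm.
Qed.

Section Winner.

Variables (m : nat) (V : seq (seq nat)) (s : seq bool).
Hypothesis sE : forall c d c' d', c < m -> d < m -> c' < m -> d' < m ->
  geq_D m s c d c' d' = (D V c' d' <= D V c d)%R.

Lemma winner_schulze c : c < m -> winner m s c <-> schulze_winner m V c.
Proof.
move=> cm; have cmp d p t : simple_path m c d p -> simple_path m d c t ->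
    has (fun e' => all (fun e => geq_D m s e.1 e.2 e'.1 e'.2) (edges c p)) (edges d t)
    = (strength V d t <= strength V c p)%R.
  move=> /and4P[p0 _ _ pm] /and4P[t0 _ _ tm]; rewrite strength_cmp //.
  apply: eq_in_has => e' /(edges_lt tm)[h1 h2]; apply: eq_in_all => e /(edges_lt pm)[h3 h4].
  exact: sE.
rewrite /winner; split=> [/allP W|[_ W]].
  split=> // d dm dc; have := W d; rewrite mem_iota0 dm (negbTE dc) => /(_ isT) /hasP[p].
  rewrite mem_paths => pp /allP H; exists p; split=> // t tt.
  by rewrite -cmp //; apply: H; rewrite mem_paths.
apply/allP => d; rewrite mem_iota0 => dm; case: eqP => //= /eqP dc.
have [p [pp H]] := W d dm dc; apply/hasP; exists p; first by rewrite mem_paths.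
by apply/allP => t; rewrite mem_paths => tt; rewrite cmp // H.
Qed.

Lemma verdict_schulze con uni p : p < m ->
  verdict con uni m p s <->
  (let W := if uni then schulze_unique_winner m V p else schulze_winner m V p in
   if con then W else ~ W).
Proof.
move=> pm; rewrite /verdict; set b := winner m s p && _.
suff E : b <-> (if uni then schulze_unique_winner m V p else schulze_winner m V p).
  by case: con => /=; [exact: E | split=> [/negP nb /E|nW]; [|apply/negP => /E]].
rewrite /b {b}; case: (uni); last by rewrite andbT; apply: winner_schulze.
split=> [/andP[/(winner_schulze pm) W /allP H]|[/(winner_schulze pm) W H]].
  split=> // d dm dp /(winner_schulze dm) Wd.
  by have := H d; rewrite mem_iota0 dm (negbTE dp) Wd => /(_ isT).
apply/andP; split=> //; apply/allP => d; rewrite mem_iota0 => dm.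
case: eqP => //= /eqP dp; apply/negP => /(winner_schulze dm); exact: H.
Qed.

End Winner.

(** * Bribery in terms of vote counts *)

Lemma sum_count m V : all (is_vote m) V -> \sum_(v <- votes m) count_mem v V = size V.
Proof.
move=> aV; rewrite -[RHS](count_predT V) (count_votes _ aV).
by apply: eq_bigr => v _; rewrite mul1n.
Qed.

Definition surplus m (V Y : seq (seq nat)) : nat :=
  \sum_(v <- votes m) (count_mem v V - count_mem v Y).

(** Changing one voter takes away one copy of one vote, so it raises the surplus by at most 1. *)
Lemma surplus_changed m V V' : size V = size V' -> surplus m V V' <= nchanged V V'.
Proof.
rewrite /surplus /nchanged.
elim: V V' => [|u V IH] [|u' V'] //= sz; first by rewrite big1.
have [sz'] := sz; apply: leq_trans (_ : (u != u') + surplus m V V' <= _); last first.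
  by rewrite leq_add2l IH.
case: eqP => [->|_]; first by rewrite add0n; apply: leq_sum => v _; rewrite subnDl.
have [uV|uV] := boolP (u \in votes m); last first.
  apply: leq_trans (leq_addl _ _); rewrite /surplus !big_seq; apply: leq_sum => v vV.
  case: eqP => [e|_]; first by rewrite e vV in uV.
  by rewrite add0n leq_sub2l // leq_addl.
rewrite -[nat_of_bool (~~ false)]/1 -[X in _ <= X + _](sum_pick (fun _ => 1) uV) /surplus -big_split /=; apply: leq_sum => v _.
have aux (a b c d : nat) : a + c - (b + d) <= a * 1 + (c - d) by lia.
by rewrite [u == v]eq_sym; apply: aux.
Qed.

(** Greedy assignment: a voter whose vote still occurs in [Y] keeps it, and any other voter receives
    a vote of which [Y] has too many copies. Each change then lowers the surplus by at least 1. *)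
Lemma rearrange m V Y : all (is_vote m) V -> all (is_vote m) Y -> size V = size Y ->
  exists V', perm_eq V' Y /\ nchanged V V' <= surplus m V Y.
Proof.
rewrite /nchanged; elim: V Y => [|u V IH] Y /=; first by case: Y => // _ _ _; exists [::].
move=> /andP[uv aV] aY sz.
have aRem y : all (is_vote m) (rem y Y).
  by apply/allP => z /mem_rem zY; apply: (allP aY).
have cRem y v : y \in Y -> count_mem v Y = (y == v) + count_mem v (rem y Y).
  by move=> yY; rewrite (permP (perm_to_rem yY)).
have sRem y : y \in Y -> size V = size (rem y Y) by move=> yY; rewrite size_rem // -sz.
have [uY|uY] := boolP (u \in Y).
  have [V' [pV le]] := IH (rem u Y) aV (aRem u) (sRem u uY).
  exists (u :: V'); split; first by rewrite perm_sym (permPl (perm_to_rem uY)) perm_cons perm_sym.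
  rewrite /= eqxx add0n; apply: leq_trans le _; apply: leq_sum => v _ /=.
  by rewrite (cRem u v uY) subnDl.
have uV : u \in votes m by rewrite mem_votes.
(* Otherwise every vote occurs in [Y] at most as often as in [u :: V], and [u] strictly less often,
   which contradicts the equal sizes. *)
have [y [yY yex]] : exists y, y \in Y /\ count_mem y (u :: V) < count_mem y Y.
  have [/hasP[y yY lt]|/hasPn H] := boolP (has (fun y => count_mem y (u :: V) < count_mem y Y) Y).
    by exists y.
  have le v : count_mem v Y <= count_mem v (u :: V).
    have [/H|/count_memPn->//] := boolP (v \in Y); by rewrite -leqNgt.
  have aUV : all (is_vote m) (u :: V) by rewrite /= uv.
  have lt : \sum_(v <- votes m) count_mem v Y < \sum_(v <- votes m) count_mem v (u :: V).
    rewrite (bigD1_seq u) ?votes_uniq // [X in _ < X](bigD1_seq u) ?votes_uniq //.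
    rewrite -addSn; apply: leq_add; first by rewrite (count_memPn uY) /= eqxx.
    by apply: leq_sum => v _; apply: le.
  by rewrite !sum_count // -sz ltnn in lt.
have [V' [pV le]] := IH (rem y Y) aV (aRem y) (sRem y yY).
exists (y :: V'); split; first by rewrite perm_sym (permPl (perm_to_rem yY)) perm_cons perm_sym.
have uy : u != y by apply: contraNneq uY => ->.
rewrite /= uy add1n; apply: leq_ltn_trans le _.
rewrite /surplus (bigD1_seq u) ?votes_uniq //= [X in _ < X](bigD1_seq u) ?votes_uniq //= eqxx.
rewrite (count_memPn uY).
have -> : count_mem u (rem y Y) = 0 by apply/count_memPn; apply: contra uY; exact: mem_rem.
rewrite !subn0 add1n addSn ltnS leq_add2l; apply: leq_sum => v vu.
rewrite [u == v]eq_sym (negbTE vu) add0n.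
(* Handing out [y] costs nothing at [y] itself, where [Y] had an excess and the difference stays 0;
   the remaining votes are unaffected. *)
have [<-|yv] := eqVneq y v.
  move: yex; rewrite /= (negbTE uy) add0n (cRem y y yY) eqxx add1n ltnS => lt.
  by rewrite (eqP (_ : count_mem y V - count_mem y (rem y Y) == 0)) // subn_eq0.
by rewrite (cRem y v yY) (negbTE yv) add0n.
Qed.

Lemma map_nth_index (U : seq (seq nat)) (s : seq nat) : uniq U -> size s = size U ->
  [seq nth 0 s (index v U) | v <- U] = s.
Proof.
move=> uU sz; apply: (eq_from_nth (x0 := 0)); first by rewrite size_map.
by move=> i; rewrite size_map => lt; rewrite (nth_map [::]) // index_uniq.
Qed.

Lemma verdict_point con uni m p n y a k V : p < m -> all (is_vote m) V ->
  {in votes m, forall v, y v = count_mem v V} ->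
  verdict con uni m p [seq holds (point m n y a k) f | f <- forms m] <->
  (let W := if uni then schulze_unique_winner m V p else schulze_winner m V p in
   if con then W else ~ W).
Proof.
move=> pm aV yE; apply: verdict_schulze => // c d c' d' cm dm c'm d'm.
by rewrite geq_DE // (beats_D _ _ _ _ aV yE).
Qed.

Lemma feasible_bribery con uni m V p k N : p < m -> all (is_vote m) V -> size V < 2 ^ N ->
  feasible con uni m p [seq count_mem v V | v <- votes m] k N <-> bribery_yes con uni m V p k.
Proof.
move=> pm aV sV; split=> [[w [sw wN]]|[V' [sV' aV' le W]]].
  set q := size (votes m) in sw.
  pose y v := nth 0 (take q w) (index v (votes m)); pose a v := nth 0 (drop q w) (index v (votes m)).
  have wE : w = [seq y v | v <- votes m] ++ [seq a v | v <- votes m].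
    rewrite !map_nth_index ?votes_uniq ?cat_take_drop //.
      by rewrite size_drop sw addnK.
    by rewrite size_take sw; case: ltnP => //; rewrite -/q; lia.
  rewrite wE -/(point m (fun v => count_mem v V) y a k) Phi_point.
  move=> /and4P[/allP rem_ok bud /eqP same ver].
  (* An electorate realising the counts [y]; its order is irrelevant, as [rearrange] aligns it with
     [V]. *)
  pose Y := flatten [seq nseq (y v) v | v <- votes m].
  have cY v : v \in votes m -> count_mem v Y = y v.
    move=> vV; rewrite count_flatten sumnE !big_map -[RHS](sum_pick y vV).
    by apply: eq_bigr => u _; rewrite count_nseq.
  have aY : all (is_vote m) Y.
    apply/allP => v /flatten_mapP[u uV /nseqP[-> _]]; by rewrite -mem_votes.
  have sY : size V = size Y.
    rewrite -(sum_count aV) -(sum_count aY) -same !big_seq.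
    by apply: eq_bigr => v /cY.
  have [V' [pV' ch]] := rearrange aV aY sY.
  have aV' : all (is_vote m) V' by rewrite (perm_all _ pV').
  exists V'; split=> //; first by rewrite (perm_size pV').
    apply: leq_trans ch (leq_trans _ bud); rewrite /surplus !big_seq; apply: leq_sum => v vV.
    by rewrite cY // leq_subLR; apply: rem_ok.
  have yE : {in votes m, forall v, y v = count_mem v V'}.
    by move=> v vV; rewrite (permP pV') cY.
  exact: (@verdict_point con uni m p _ y a k V' pm aV' yE).1 ver.
have cN U v : all (is_vote m) U -> size U = size V -> count_mem v U < 2 ^ N.
  by move=> _ sU; apply: leq_ltn_trans sV; rewrite -sU count_size.
(* The truncated differences are the least admissible choice of the a_v, and their sum is the
   surplus. *)
exists ([seq count_mem v V' | v <- votes m] ++ [seq count_mem v V - count_mem v V' | v <- votes m]).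
split; first by rewrite size_cat !size_map.
  rewrite all_cat; apply/andP; split; apply/allP => _ /mapP[v _ ->]; first exact: cN.
  by apply: leq_ltn_trans (leq_subr _ _) _; apply: cN.
rewrite -/(point m (fun v => count_mem v V) (fun v => count_mem v V')
  (fun v => count_mem v V - count_mem v V') k) Phi_point.
apply/and4P; split.
- by apply/allP => v _; lia.
- by apply: leq_trans le; apply: surplus_changed.
- by rewrite !sum_count // sV'.
- exact: (@verdict_point con uni m p _ _ _ k V' pm aV' (fun v _ => erefl)).2 W.
Qed.

(** * Totals and sizes of encoded instances, and the assembly of both models *)

Lemma vote_of_bits v : vote_of (map bits v) = v.
Proof. by rewrite /vote_of -map_comp (eq_map natval_bits) map_id. Qed.

Lemma total_ns V v : item_total v [seq (map bits u, [:: true]) | u <- V] = count_mem v V.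
Proof. by elim: V => //= u V IH; rewrite item_total_cons IH vote_of_bits; case: eqP. Qed.

Lemma total_s S v :
  item_total v [seq (map bits vn.1, bits vn.2) | vn <- S] = count_mem v (s_expand S).
Proof.
elim: S => //= -[u n] S IH; rewrite item_total_cons IH vote_of_bits natval_bits /s_expand /=.
by rewrite count_cat count_nseq /=; case: eqP; rewrite ?mul1n ?mul0n.
Qed.

Lemma size_enc_list T (f : T -> seq bool) s : size (enc_list f s) = \sum_(x <- s) (size (f x)).+1 + 1.
Proof.
rewrite /enc_list size_cat; congr (_ + _).
by elim: s => [|x s IH]; rewrite ?big_nil ?big_cons //= size_cat IH.
Qed.

Lemma size_bits_enc n : size (bits n) <= size (enc_nat n).
Proof.
by rewrite size_enc_list; elim: (bits n) => //= b s IH; rewrite big_cons /=; lia.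
Qed.

Lemma bits_lt n : n < 2 ^ size (enc_nat n).
Proof.
rewrite -{1}(natval_bits n); apply: leq_trans (natval_lt _) _.
by rewrite leq_exp2l // size_bits_enc.
Qed.

(** The electorate may be exponential in the input, but not more. The marker bit of each item
    supplies the factor 2 needed to replace a sum of two powers of 2 by their product. *)
Lemma size_s_expand S (f : seq nat * nat -> seq bool) :
  (forall vn, size (enc_nat vn.2) <= size (f vn)) -> size (s_expand S) < 2 ^ size (enc_list f S).
Proof.
move=> H; rewrite size_enc_list; elim: S => [|[v n] S IH]; first by rewrite big_nil.
rewrite big_cons /s_expand /= size_cat size_nseq -/(s_expand S).
have lt : n < 2 ^ size (f (v, n)).
  by apply: leq_trans (bits_lt n) _; rewrite leq_exp2l //; apply: (H (v, n)).
rewrite -addnA addSn expnS expnD.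
move: (size _) (2 ^ _) (2 ^ _) IH lt => a T E h1 h2; nia.
Qed.

Lemma esize_nat_bits n : esize (bits n) <= 4 * n + 1.
Proof.
have sz : size (bits n) <= n.
  by rewrite /bits; move: {1 3}n => k; elim: k n => // k IH [|n] //; rewrite ltnS; apply: IH.
have /andP[_ h] := esize_bits (bits n); lia.
Qed.

(** One function for two purposes: a vote has m names of weight at most 4m + 1, with a list cell
    each, and the last summands cover the numerals of m and p. *)
Definition vote_bound (m : nat) : nat := (4 * m + 2) * m + 4 * m + 1.

Lemma growth_vote_bound : growth vote_bound.
Proof. by rewrite /vote_bound; growth_tac. Qed.

Lemma esize_vote m v : is_vote m v -> esize (map bits v) <= vote_bound m.
Proof.
move=> pv; have sv : size v = m by rewrite (perm_size pv) size_iota.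
have : {in v, forall c, c < m} by move=> c; rewrite (perm_mem pv) mem_iota0.
move=> lt; have le : esize (map bits v) <= (4 * m + 2) * size v + 1; last first.
  by rewrite sv in le; rewrite /vote_bound; lia.
elim: v lt {pv sv} => [|c v IH] lt; first by rewrite /= muln0.
rewrite [map _ _]/= weight_cons [size _]/=.
have lt' : {in v, forall d, d < m} by move=> d dv; apply: lt; rewrite inE dv orbT.
have := IH lt'; have := lt c (mem_head _ _); have := esize_nat_bits c; nia.
Qed.

Lemma esize_small_bits m n : n <= m -> esize (bits n) <= vote_bound m.
Proof. by move=> le; apply: leq_trans (esize_nat_bits n) _; rewrite /vote_bound; nia. Qed.

Lemma decides_of_run M x t T (b : bool) (P : Prop) : t <= T ->
  (tm_run M t (tm_init x)).1 = (if b then 1 else 2) -> (b <-> P) -> decides_within M x T P.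
Proof.
move=> le st bP; exists t; split=> //; rewrite /halting st.
by case: b st bP => _ bP; split=> //; split=> // p; [exact: bP.1 | by have := bP.2 p].
Qed.

Lemma size_infix_cat T (a s b : seq T) : size s <= size (a ++ s ++ b).
Proof. by rewrite !size_cat; lia. Qed.

Lemma decide_bribery b con uni m V p k x its :
  (pinstance b x).1 = (bits m, (its, (bits p, bits k))) -> p < m -> all (is_vote m) V ->
  regular b its -> (forall v, item_total v its = count_mem v V) ->
  size V < 2 ^ size x -> k < 2 ^ size x ->
  decide b con uni x <-> bribery_yes con uni m V p k.
Proof.
move=> px pm aV reg tE sV kN.
apply: iff_trans (feasible_bribery con uni k pm aV sV); rewrite -(eq_map tE).
apply: decide_feasible => // v _; rewrite tE.
exact: leq_ltn_trans (count_size _ _) sV.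
Qed.

Lemma modest_instance b x m its p k :
  (pinstance b x).1 = (bits m, (its, (bits p, bits k))) -> p < m ->
  {in its, forall it, exists2 v, is_vote m v & it.1 = map bits v} ->
  modest b vote_bound x /\ parameter b x = m.
Proof.
move=> px pm vits; rewrite /modest /parameter /prepare px /= natval_bits; split=> //.
split; [exact: esize_small_bits | exact: esize_small_bits (ltnW pm) |].
by move=> it /vits[v vv ->]; apply: esize_vote.
Qed.

Theorem succinct_FPT con uni : schulze_bribery_FPT true con uni.
Proof.
have [M [f [c [wf cf H]]]] := @decide_machine true vote_bound growth_vote_bound con uni.
exists M, f, c; split=> //; split=> // x [pm vx ux].
have vV vn : vn \in s_votes x -> is_vote (s_m x) vn.1 by move=> /(allP vx)/andP[].
have aV : all (is_vote (s_m x)) (s_expand (s_votes x)).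
  by apply/allP => v /flatten_mapP[vn vin /nseqP[-> _]]; apply: vV.
have px := pinstance_s x.
have [|mod par] := modest_instance px pm.
  by move=> it /mapP[vn vin ->]; exists vn.1 => //; apply: vV.
have [t le st] := H _ mod; rewrite par in le.
apply: decides_of_run le st _; apply: (decide_bribery con uni px pm aV).
- rewrite /regular -map_comp; rewrite (eq_map (g := fst)) // => vn /=.
  exact: vote_of_bits.
- exact: total_s.
- apply: leq_trans (size_s_expand (s_votes x) (f := fun vn => enc_vote vn.1 ++ enc_nat vn.2) _) _.
    by move=> vn; rewrite size_cat leq_addl.
  by rewrite leq_exp2l // /s_enc !size_cat; lia.
- by apply: leq_trans (bits_lt _) _; rewrite leq_exp2l // /s_enc !size_cat; lia.
Qed.

Theorem nonsuccinct_FPT con uni : schulze_bribery_FPT false con uni.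
Proof.
have [M [f [c [wf cf H]]]] := @decide_machine false vote_bound growth_vote_bound con uni.
exists M, f, c; split=> //; split=> // x [pm aV].
have px := pinstance_ns x.
have [|mod par] := modest_instance px pm.
  by move=> it /mapP[v vin ->]; exists v => //; apply: (allP aV).
have [t le st] := H _ mod; rewrite par in le.
apply: decides_of_run le st _; apply: (decide_bribery con uni px pm aV).
- by apply/allP => it /mapP[v _ ->]; rewrite !inE eqxx orbT.
- exact: total_ns.
(* Every listed vote takes at least its marker bit, so there are at most [size x] voters, which is
   below 2 to that power. *)
- apply: leq_trans (ltn_expl _ (isT : 1 < 2)) _; rewrite leq_exp2l //.
  apply: leq_trans (size_infix_cat _ (enc_list enc_vote (ns_votes x)) _).
  rewrite size_enc_list; elim: (ns_votes x) => // v V IH; rewrite big_cons /=; lia.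
- by apply: leq_trans (bits_lt _) _; rewrite leq_exp2l // /ns_enc !size_cat; lia.
Qed.

Theorem theorem1 :
  forall succinct constructive unique : bool,
    schulze_bribery_FPT succinct constructive unique.
Proof. by case=> con uni; [exact: succinct_FPT | exact: nonsuccinct_FPT]. Qed.
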